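(* Suppose the running cost $f$ is concave (case (II) of the context). Let $\theta(y)=c-\frac1\rho\frac{f(y)}{y}$ for $y\in(0,1]$, $u(x,i;y)=\sup_{\tau\ge0}\mathbb{E}_{(x,i)}[e^{-\rho\tau}(X_\tau-\theta(y))]$, and $$W(x,y,i):=y\,u(x,i;y)-\frac1\rho f(y),\qquad (x,y,i)\in\mathbb{R}\times[0,1]\times\{1,2\},$$ where the value at $y=0$ is understood as the limit for $y\downarrow0$. Then $W(x,0,i)=0$ for all $(x,i)\in\mathbb{R}\times\{1,2\}$, and there exists $K>0$ such that $|W(x,y,i)|\le K(1+|x|)$ for all $(x,y,i)\in\mathbb{R}\times[0,1]\times\{1,2\}$. Moreover, for any $i=1,2$, $W(\cdot,\cdot,i)\in C^0(\mathbb{R}\times[0,1])\cap C^{1,1}(\mathbb{R}\times(0,1])$ with $W_{xx}(\cdot,\cdot,i)\in L^\infty_{loc}(\mathbb{R}\times(0,1])$, and $W$ satisfies in the a.e. sense the Hamilton-Jacobi-Bellman equation $$\max\Big\{(\mathcal{G}-\rho)W(x,y,i)-f(y),\ (x-c)-W_y(x,y,i)\Big\}=0,\qquad (x,y)\in\mathbb{R}\times(0,1],\ i=1,2.$$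
   Context: Let $(\Omega,\mathcal{F},\mathbb{P})$ be a complete probability space carrying a one-dimensional Brownian motion $B$ and an independent continuous-time Markov chain $\varepsilon$ with state space $\{1,2\}$ and generator $\begin{pmatrix}-\lambda_1&\lambda_1\\ \lambda_2&-\lambda_2\end{pmatrix}$, $\lambda_1,\lambda_2>0$; $\mathbb{F}$ is the augmented filtration generated by $(B,\varepsilon)$. $dX_t=\sigma_{\varepsilon_t}dB_t$, $X_0=x$, with $\sigma_1,\sigma_2>0$; $\mathbb{E}_{(x,i)}$ is expectation given $X_0=x,\varepsilon_0=i$. Constants $\rho,c>0$. The supremum defining $u$ is over all $\mathbb{P}_{(x,i)}$-a.s. finite $\mathbb{F}$-stopping times. Case (II): $f:\mathbb{R}\to\mathbb{R}_+$ is increasing, continuous on $[0,1]$, $f(0)=0$, and $f$ is concave on $[0,1]$ and continuously differentiable on $(0,1]$. $\mathcal{G}h(x,y,i)=\frac12\sigma_i^2h_{xx}(x,y,i)+\lambda_i\big(h(x,y,3-i)-h(x,y,i)\big)$ (for fixed $y$). $C^{1,1}(\mathbb{R}\times(0,1])$ denotes functions of $(x,y)$ that are continuous together with their first partial derivatives in $x$ and in $y$ on $\mathbb{R}\times(0,1]$ (one-sided $y$-derivative at $y=1$); $L^\infty_{loc}(\mathbb{R}\times(0,1])$ means bounded on every compact subset of $\mathbb{R}\times(0,1]$ (up to null sets). *)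

(* Defs.v *)
From HB Require Import structures.
From mathcomp Require Import all_boot all_order all_algebra.
From mathcomp Require Import all_classical all_reals all_analysis.

Set Implicit Arguments.
Unset Strict Implicit.
Unset Printing Implicit Defensive.

Import Order.TTheory GRing.Theory Num.Theory.
Import numFieldNormedType.Exports.

Local Open Scope classical_set_scope.
Local Open Scope ring_scope.

(* The two regimes "1" and "2" are ord0 and ord_max in 'I_2; rev_ord is then
   the switch i |-> 3 - i. Time is R, and only times t >= 0 matter. *)

Section processes.
Context {d : measure_display} {T : measurableType d} {R : realType}.
Variable P : probability T R.

(* The events {Y_s \in C}, with s in I and C in the set system G. *)
Definition process_events {E : Type} (G : set_system E) (Y : R -> T -> E)
    (I : set R) : set_system T :=
  [set A | exists2 s, I s & exists2 C, G C & A = Y s @^-1` C].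

Definition process_sigma {E : Type} (G : set_system E) (Y : R -> T -> E)
  (I : set R) : set_system T := <<s process_events G Y I >>.

Definition independent_systems (F G : set_system T) : Prop :=
  forall A B, F A -> G B -> P (A `&` B) = (P A * P B)%E.

Definition has_continuous_paths (Y : R -> T -> R) : Prop :=
  {ae P, forall w, {within `[0, +oo[, continuous (fun t => Y t w)}}.

Record brownian_motion (B : R -> T -> R) : Prop := BrownianMotion {
  bm_measurable : forall t, 0 <= t -> measurable_fun setT (B t) ;
  bm_start : {ae P, forall w, B 0 w = 0} ;
  bm_continuous : has_continuous_paths B ;
  bm_increments : forall s t, 0 <= s -> s < t ->
    independent_systems
      (process_sigma measurable (fun=> B t \- B s) setT)
      (process_sigma measurable B `[0, s]) ;
  bm_gaussian : forall s t, 0 <= s -> s < t ->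
    forall C, measurable C ->
      P ((B t \- B s) @^-1` C) = normal_prob 0 (Num.sqrt (t - s)) C }.

Definition generator_matrix (lambda : 'I_2 -> R) : 'M[R]_2 :=
  \matrix_(i, j) (if j == i then - lambda i else lambda i).

(* The (i, j) entry of exp (t Q). *)
Definition transition (Q : 'M[R]_2) (t : R) (i j : 'I_2) : R :=
  limn (series (fun n => t ^+ n / n`!%:R * (Q ^+ n) i j)).

Record markov_chain (Q : 'M[R]_2) (eps : R -> T -> 'I_2) : Prop := MarkovChain {
  mc_measurable : forall t j, 0 <= t -> measurable (eps t @^-1` [set j]) ;
  mc_right_continuous : {ae P, forall w, forall t, 0 <= t ->
    \forall s \near t^'+, eps s w = eps t w} ;
  mc_left_limits : {ae P, forall w, forall t, 0 < t ->
    exists j, \forall s \near t^'-, eps s w = j} ;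
  mc_markov : forall s t i j A, 0 <= s -> s <= t ->
    process_sigma setT eps `[0, s] A ->
    P (A `&` (eps s @^-1` [set i]) `&` (eps t @^-1` [set j])) =
    (P (A `&` (eps s @^-1` [set i])) * (transition Q (t - s) i j)%:E)%E }.

Definition augmented_filtration (B : R -> T -> R) (eps : R -> T -> 'I_2)
    (t : R) : set_system T :=
  <<s process_events measurable B `[0, t] `|` process_events setT eps `[0, t]
      `|` P.-negligible >>.

Section filtered.
Variable F : R -> set_system T.

Definition measurable_wrt (t : R) (Z : T -> R) : Prop :=
  forall C, measurable C -> F t (Z @^-1` C).

Definition adapted (Y : R -> T -> R) : Prop :=
  forall t, 0 <= t -> measurable_wrt t (Y t).

Definition stopping_time (tau : T -> \bar R) : Prop :=
  (forall w, (0 <= tau w)%E) /\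
  forall t, 0 <= t -> F t [set w | (tau w <= t%:E)%E].

Record simple_process := SimpleProcess {
  sp_size : nat ;
  sp_time : nat -> R ;
  sp_coef : nat -> T -> R ;
  sp_time_ge0 : forall k, 0 <= sp_time k ;
  sp_time_nondecreasing : forall k, sp_time k <= sp_time k.+1 ;
  sp_coef_measurable : forall k, measurable_wrt (sp_time k) (sp_coef k) ;
  sp_coef_bounded : forall k, exists M, forall w, `|sp_coef k w| <= M }.

Definition sp_value (phi : simple_process) (s : R) (w : T) : R :=
  \sum_(k < sp_size phi)
    sp_coef phi k w * \1_(`]sp_time phi k, sp_time phi k.+1]) s.

Definition sp_integral (phi : simple_process) (B : R -> T -> R) (t : R) (w : T)
    : R :=
  \sum_(k < sp_size phi) sp_coef phi k w *
    (B (Num.min (sp_time phi k.+1) t) w - B (Num.min (sp_time phi k) t) w).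

(* J is (a version of) the Ito integral of H against B over [0, t]: the
   L2-limit of the integrals of simple processes approximating H. *)
Definition is_ito_integral (H B : R -> T -> R) (t : R) (J : T -> R) : Prop :=
  exists phi : nat -> simple_process,
    ((\int[P]_w \int[lebesgue_measure]_(s in `[0%R, t])
        ((H s w - sp_value (phi n) s w) ^+ 2)%:E)%E @[n --> \oo] --> 0%E) /\
    ((\int[P]_w ((J w - sp_integral (phi n) B t w) ^+ 2)%:E)%E
        @[n --> \oo] --> 0%E).

(* dX_t = sigma(eps_t) dB_t, X_0 = x. *)
Record regime_switching_diffusion (sigma : 'I_2 -> R) (B : R -> T -> R)
    (eps : R -> T -> 'I_2) (x : R) (X : R -> T -> R) : Prop :=
  RegimeSwitchingDiffusion {
    rsd_adapted : adapted X ;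
    rsd_continuous : has_continuous_paths X ;
    rsd_start : {ae P, forall w, X 0 w = x} ;
    rsd_ito : forall t, 0 <= t ->
      is_ito_integral (fun s w => sigma (eps s w)) B t (fun w => X t w - x) }.

End filtered.

(* Expectation under P( . | A), meaningful when P A > 0. *)
Definition expectation_given (A : set T) (Z : T -> R) : \bar R :=
  (((fine (P A))^-1)%:E * \int[P]_(w in A) (Z w)%:E)%E.

End processes.

Section value_functions.
Context {d : measure_display} {T : measurableType d} {R : realType}.
Variables (P : probability T R) (B : R -> T -> R) (eps : R -> T -> 'I_2).
(* X x is the diffusion started from x. *)
Variables (X : R -> R -> T -> R) (rho c : R) (f : R -> R).

Definition theta (y : R) : R := c - rho^-1 * (f y / y).

(* Off the P_(x,i)-null event {tau = +oo}, fine (tau w) is tau w. *)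
Definition value_u (x : R) (i : 'I_2) (y : R) : \bar R :=
  ereal_sup [set expectation_given P (eps 0 @^-1` [set i])
      (fun w => expR (- (rho * fine (tau w))) *
                (X x (fine (tau w)) w - theta y))
    | tau in [set tau : T -> \bar R |
        stopping_time (augmented_filtration P B eps) tau /\
        {ae P, forall w, eps 0 w = i -> (tau w < +oo)%E}]].

Definition W_pos (x y : R) (i : 'I_2) : R :=
  y * fine (value_u x i y) - rho^-1 * f y.

Definition value_W (x y : R) (i : 'I_2) : R :=
  if y == 0 then lim (W_pos x z i @[z --> 0^'+]) else W_pos x y i.

End value_functions.

Section calculus.
Context {R : realType}.

Definition concave_on (D : set R) (f : R -> R) : Prop :=
  convex_function (D : set R^o) (\- f : R -> R^o).

(* Difference quotients along D only: one-sided at the endpoints of D. *)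
Definition derivable_within (D : set R) (f : R -> R) (y : R) : Prop :=
  cvg ((f z - f y) / (z - y) @[z --> within (D `\ y) (nbhs y)]).

Definition derive_within (D : set R) (f : R -> R) (y : R) : R :=
  lim ((f z - f y) / (z - y) @[z --> within (D `\ y) (nbhs y)]).

Definition continuously_differentiable_on (D : set R) (f : R -> R) : Prop :=
  (forall y, D y -> derivable_within D f y) /\
  {within D, continuous (derive_within D f)}.

Definition strip_closed : set (R * R) := [set z | 0 <= z.2 <= 1].
Definition strip : set (R * R) := [set z | 0 < z.2 <= 1].

Definition d_x (h : R -> R -> R) (x y : R) : R := derive1 (h ^~ y) x.
Definition d_xx (h : R -> R -> R) (x y : R) : R := d_x (d_x h) x y.
Definition d_y (h : R -> R -> R) (x y : R) : R := derive_within `]0, 1] (h x) y.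

Definition C11_on_strip (h : R -> R -> R) : Prop :=
  [/\ {within strip, continuous (fun z => h z.1 z.2)},
      forall z, strip z -> derivable (fun x => h x z.2) z.1 1,
      forall z, strip z -> derivable_within `]0, 1] (h z.1) z.2,
      {within strip, continuous (fun z => d_x h z.1 z.2)} &
      {within strip, continuous (fun z => d_y h z.1 z.2)}].

Definition lebesgue2 : set (R * R) -> \bar R :=
  (@lebesgue_measure R \x @lebesgue_measure R)%E.

Definition ae_on_strip (Q : R -> R -> Prop) : Prop :=
  {ae lebesgue2, forall z, strip z -> Q z.1 z.2}.

(* h_xx as a locally bounded derivative of h_x: besides existing a.e. and being
   locally essentially bounded, it integrates back to h_x on every horizontal
   segment, so that the pointwise a.e. derivative is also the weak one. *)
Definition Linfty_loc_d_xx (h : R -> R -> R) : Prop :=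
  [/\ ae_on_strip (fun x y => derivable (fun x => d_x h x y) x 1),
      forall K : set (R * R), compact K -> K `<=` strip ->
        exists M : R, ae_on_strip (fun x y => K (x, y) -> `|d_xx h x y| <= M) &
      forall a b y : R, a <= b -> 0 < y <= 1 ->
        lebesgue_measure.-integrable `[a, b] (fun x => (d_xx h x y)%:E) /\
        (\int[lebesgue_measure]_(x in `[a, b]) (d_xx h x y)%:E =
          (d_x h b y - d_x h a y)%:E)%E].

(* G acts on h = h(x, y, i) for fixed y. *)
Definition generator_G (sigma lambda : 'I_2 -> R) (h : R -> R -> 'I_2 -> R)
    (x y : R) (i : 'I_2) : R :=
  2^-1 * sigma i ^+ 2 * d_xx (fun x y => h x y i) x y +
  lambda i * (h x y (rev_ord i) - h x y i).

End calculus.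

(* Main.v *)
Require Import Defs.
From HB Require Import structures.
From mathcomp Require Import all_boot all_order all_algebra.
From mathcomp Require Import all_classical all_reals all_analysis.
From mathcomp Require Import measurable_realfun ring lra.
Set Implicit Arguments.
Unset Strict Implicit.
Unset Printing Implicit Defensive.
Import Order.TTheory GRing.Theory Num.Theory.
Import numFieldNormedType.Exports.
Local Open Scope classical_set_scope.
Local Open Scope ring_scope.

(* Write z = x - theta(y). Then u(x, i; y) = v_i(z), where (v_1, v_2) solves the obstacle
   problem max((1/2) s_i^2 v_i'' + lambda_i (v_j - v_i) - rho v_i, z - v_i) = 0. For one regime
   with the other frozen, the problem is solved explicitly by an exponential average and a
   smooth-fit boundary b_i; the solution map is monotone, and the system is solved by taking
   the infimum of its supersolutions. The v_i are C^1 functions with 0 <= v_i' <= 1 and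
   v_i = z from b_i on, but v_i'' jumps at b_i.

   The identity u = v is proved with an Euler scheme Y of mesh h instead of Ito's formula. A
   third-order Taylor estimate and the Markov property show that exp(-rho t) v(Y_t) gains at
   most O(h^(3/2)) in expectation per step, and loses no more than that while Y stays below
   b - delta. By the Ito isometry X - Y is a martingale of size O(sqrt h) in L^2, because the
   chain jumps in a given step with probability O(h). Rounding a stopping time up to the grid
   and Fatou's lemma give u <= v; stopping when Y first exceeds b - delta gives u >= v.

   Finally W = y v_i(z) - f(y)/rho yields
     (x - c) - W_y = (z - v_i) + (1/rho) (f(y)/y - f'(y)) (v_i' - 1),
     (G - rho) W - f = y ((1/2) s_i^2 v_i'' + lambda_i (v_j - v_i) - rho v_i),
   where f(y)/y >= f'(y) by concavity and f(0) = 0, so both are nonpositive and one of them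
   vanishes off the Lebesgue-null set {z = b_i}. *)

(** * One-variable calculus *)

(** Ito's formula would ask for a continuous [v''] and for an integral along stopping times, while
    [v_i''] jumps and [is_ito_integral] speaks of each fixed time separately. Hence every estimate
    lives on a finite grid, and [X] enters only at grid times. The jump of [v_i''] is harmless in
    one direction: beyond [b_i] the second derivative is 0 while the curvature prescribed by the
    equation is nonnegative, so the Taylor upper bound holds across the boundary. Only the lower
    bound has to keep a distance [dl] from it, with a constant that blows up as [dl] tends to 0;
    therefore [dl] is fixed before the mesh. Losses of order [h^(3/2)] per step vanish even over a
    growing horizon once [K h^(3/2)] tends to 0. Brownian increments are tested against a
    sigma-algebra containing the whole path of the chain, so that the regime after a step is
    independent of the increment over it. Stopping at a random grid index costs nothing in the
    comparison of [X] with [Y], since their difference is a martingale. *)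

Section calc.
Context {R : realType}.
Implicit Types (f g : R -> R).

(** Lets a derivative be computed by the rules below in unsimplified form and matched afterwards to
    the wanted expression by [ring] or [field]. *)
Lemma is_derive_val f (x a b : R) : is_derive x 1 f a -> a = b -> is_derive x 1 f b.
Proof. by move=> fa <-. Qed.

Lemma is_derive_add f g (x a b : R) : is_derive x 1 f a -> is_derive x 1 g b ->
  is_derive x 1 (fun z => f z + g z) (a + b).
Proof. by move=> fa gb; have := is_deriveD fa gb. Qed.

Lemma is_derive_sub f g (x a b : R) : is_derive x 1 f a -> is_derive x 1 g b ->
  is_derive x 1 (fun z => f z - g z) (a - b).
Proof. by move=> fa gb; have := is_deriveB fa gb. Qed.

Lemma is_derive_mul f g (x a b : R) : is_derive x 1 f a -> is_derive x 1 g b ->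
  is_derive x 1 (fun z => f z * g z) (a * g x + f x * b).
Proof.
move=> fa gb; have h := is_deriveM fa gb.
by rewrite (_ : a * _ + _ = f x *: b + g x *: a)// addrC [a * _]mulrC.
Qed.

Lemma is_derive_scale (k : R) f (x a : R) : is_derive x 1 f a ->
  is_derive x 1 (fun z => k * f z) (k * a).
Proof.
move=> fa; have -> : k * a = 0 * f x + k * a by rewrite mul0r add0r.
by apply: is_derive_mul => //; exact: is_derive_cst.
Qed.

Lemma is_derive_id1 (x : R) : is_derive x 1 (fun z : R => z) 1.
Proof. exact: is_derive_id. Qed.

Lemma is_derive_compose f g (x a b : R) : is_derive x 1 g b ->
  is_derive (g x) 1 f a -> is_derive x 1 (fun z => f (g z)) (b * a).
Proof.
by move=> gb fa; have h := is_derive1_comp fa gb; rewrite [b * a]mulrC.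
Qed.

Lemma is_derive_exp (k x : R) :
  is_derive x 1 (fun z => expR (k * z)) (k * expR (k * x)).
Proof.
have h : is_derive x 1 (fun z => k * z) (k * 1).
  by apply: is_derive_scale; apply: is_derive_id1.
by have := is_derive_compose h (is_derive_expR _); rewrite mulr1.
Qed.

Lemma is_derive_continuous f (x a : R) : is_derive x 1 f a -> {for x, continuous f}.
Proof. by move=> [df _]; exact/differentiable_continuous/derivable1_diffP. Qed.

Lemma MVT_is_derive f (df : R -> R) (a b : R) : a <= b ->
  (forall x, a <= x <= b -> is_derive x 1 f (df x)) ->
  exists2 c, a <= c <= b & f b - f a = df c * (b - a).
Proof.
move=> ab fd; case: (@MVT_segment _ f df a b) => //.
- move=> x; rewrite in_itv/= => /andP[ax xb]; apply: fd.
  by rewrite (ltW ax) (ltW xb).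
- apply: derivable_within_continuous => x; rewrite in_itv/= => xab.
  by case: (fd x xab).
- by move=> c; rewrite in_itv/=; exists c.
Qed.

Lemma MVT_is_derive_oo f (df : R -> R) (a b : R) : a < b ->
  (forall x, a < x < b -> is_derive x 1 f (df x)) ->
  {for a, continuous f} -> {for b, continuous f} ->
  exists2 c, a < c < b & f b - f a = df c * (b - a).
Proof.
move=> ab fd fa fb; case: (@MVT _ f df a b) => //.
- by apply/(continuous_within_itvP _ ab); split;
    [move=> x; rewrite in_itv/= => /fd /is_derive_continuous
    |exact: cvg_at_right_filter|exact: cvg_at_left_filter].
- by move=> c; rewrite in_itv/=; exists c.
Qed.

(** Smooth fit: each difference quotient of the glued function is one of [f] or one of [g], and both
    families converge to the same [l]. *)
Lemma is_derive_glue f g (b l : R) : f b = g b ->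
  is_derive b 1 f l -> is_derive b 1 g l ->
  is_derive b 1 (fun z => if z < b then f z else g z) l.
Proof.
move=> fg fl gl.
pose h z := if z < b then f z else g z.
have hb : h b = g b by rewrite /h ltxx.
have cvf : t^-1 *: (f (t *: 1 + b) - f b) @[t --> 0^'] --> l.
  by case: fl => fd <-; exact: fd.
have cvg' : t^-1 *: (g (t *: 1 + b) - g b) @[t --> 0^'] --> l.
  by case: gl => gd <-; exact: gd.
have cvh : t^-1 *: (h (t *: 1 + b) - h b) @[t --> 0^'] --> l.
  apply/cvgrPdist_lt => e e0.
  have [/cvgrPdist_lt/(_ e e0) ef /cvgrPdist_lt/(_ e e0) eg] := (cvf, cvg').
  near=> t; rewrite hb /h; case: ifPn => _; last by near: t.
  by rewrite -fg; near: t.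
apply: DeriveDef; first by apply/cvg_ex; exists l.
exact: cvg_lim.
Unshelve. all: by end_near. Qed.

Lemma is_derive_lt_eq f g (b x l : R) : x < b -> (forall z, z < b -> f z = g z) ->
  is_derive x 1 f l -> is_derive x 1 g l.
Proof.
move=> xb fg; apply: near_eq_is_derive; near=> z; apply: fg; near: z.
exact: lt_nbhsl.
Unshelve. all: by end_near. Qed.

Lemma is_derive_gt_eq f g (b x l : R) : b < x -> (forall z, b < z -> f z = g z) ->
  is_derive x 1 f l -> is_derive x 1 g l.
Proof.
move=> xb fg; apply: near_eq_is_derive; near=> z; apply: fg; near: z.
exact: lt_nbhsr.
Unshelve. all: by end_near. Qed.

End calc.

Lemma continuous_measurable_EFin {R : realType} (D : set R) (f : R -> R) :
  measurable D -> continuous f -> measurable_fun D (EFin \o f).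
Proof.
move=> mD cf; apply/measurable_EFinP.
by apply: (@measurable_funS _ _ _ _ setT) => //; exact: continuous_measurable_fun.
Qed.

(** * Exponential averages over half-lines *)

Section exponential_average.
Context {R : realType}.
Notation mu := (@lebesgue_measure R).
Variable k : R.
Hypothesis k_gt0 : 0 < k.
Implicit Types (f : R -> R) (z : R).

Lemma integral_expR_Ny (k' z : R) : 0 < k' ->
  (\int[mu]_(t in `]-oo, z]) (expR (k' * t))%:E = (expR (k' * z) / k')%:E)%E.
Proof.
move=> k0; have cE (a : R) : continuous (fun x : R => expR (a * x)).
  by move=> x; exact: (is_derive_continuous (is_derive_exp a x)).
have := @ge0_integration_by_substitutionNy R (fun t => expR (k' * t)) (- z).
rewrite opprK => ->; last 2 first.
- by apply: continuous_subspaceT; exact: cE.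
- by move=> x _; exact: expR_ge0.
have D (x : R) : is_derive x 1 (fun x => - (k'^-1 * expR (- k' * x))) (expR (- k' * x)).
  have -> : expR (- k' * x) = (- k'^-1) * (- k' * expR (- k' * x)).
    by rewrite mulrA mulrNN mulVf ?mul1r// (gt_eqF k0).
  have -> : (fun x => - (k'^-1 * expR (- k' * x))) = (fun x => - k'^-1 * expR (- k' * x)).
    by apply/funext => y; rewrite [RHS]mulNr.
  by apply: is_derive_scale; apply: is_derive_exp.
under eq_integral do rewrite /= mulrN -mulNr.
rewrite (@ge0_continuous_FTC2y _ _ (fun x => - (k'^-1 * expR (- k' * x))) _ 0).
- by rewrite -EFinB sub0r opprK mulrNN mulrC.
- by move=> x _; exact: expR_ge0.
- by apply: continuous_subspaceT; exact: cE.
- rewrite -oppr0; apply: cvgN; rewrite -(mulr0 k'^-1); apply: cvgM; first exact: cvg_cst.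
  rewrite (_ : (fun x => expR (- k' * x)) =
               (fun z => expR (- z)) \o (fun z => k' * z)); last first.
    by apply: eq_fun => x; rewrite mulNr.
  apply: (@cvg_comp _ _ _ _ _ _ (pinfty_nbhs R)); last exact: cvgr_expR.
  exact: gt0_cvgMry.
- by move=> x _; case: (D x).
- by apply/cvg_at_right_filter; exact: is_derive_continuous (D _).
- by move=> x _; rewrite derive1E; apply: derive_val.
Qed.

Lemma integrable_expR_Ny (k' z : R) : 0 < k' ->
  mu.-integrable `]-oo, z] (fun t => (expR (k' * t))%:E).
Proof.
move=> k0; apply/integrableP; split.
  apply: continuous_measurable_EFin => // x.
  exact: (is_derive_continuous (is_derive_exp k' x)).
under eq_integral do rewrite gee0_abs ?lee_fin ?expR_ge0//.
by rewrite integral_expR_Ny// ltry.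
Qed.

(* Growth at -oo slow enough for [f t * exp (k t)] to be integrable there. *)
Definition slow_growth (f : R -> R) := forall z : R, exists A : R, forall t, t <= z ->
  `|f t| <= A * expR (- (k / 2) * t).

Lemma slow_growth_integrable f z : continuous f -> slow_growth f ->
  mu.-integrable `]-oo, z] (EFin \o (fun t => f t * expR (k * t))).
Proof.
move=> cf /(_ z)[A fA].
have k2 : 0 < k / 2 by rewrite divr_gt0.
apply: (le_integrable _ _ _ (integrableZl _ A (integrable_expR_Ny z k2))) => //.
  apply: continuous_measurable_EFin => // x.
  apply: cvgM; first exact: cf.
  exact: (is_derive_continuous (is_derive_exp k x)).
move=> t /=; rewrite in_itv/= => tz.
rewrite lee_fin normrM (ger0_norm (expR_ge0 _)).
rewrite (@le_trans _ _ (A * expR (- (k / 2) * t) * expR (k * t)))//.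
  by rewrite ler_wpM2r ?expR_ge0 ?fA.
by rewrite -mulrA -expRD (_ : _ + _ = k / 2 * t) ?ler_norm//; lra.
Qed.

(** The solution of [m' = f - k m] without the homogeneous part [exp (- k z)], which would explode
    at -oo; equivalently [1 / k] times the mean of [f] under an exponential law on []-oo, z]]. *)
Definition exp_average (f : R -> R) (z : R) : R :=
  expR (- k * z) * \int[mu]_(t in `]-oo, z]) (f t * expR (k * t)).

Lemma is_derive_exp_average f z : continuous f -> slow_growth f ->
  is_derive z 1 (exp_average f) (f z - k * exp_average f z).
Proof.
move=> cf fg.
have [d1 d2] := @continuous_FTC1 R (fun t => f t * expR (k * t)) -oo%O z (z + 1)
  ltac:(by rewrite ltrDl) (slow_growth_integrable (z + 1) cf fg) (ltNyr _)
  (cvgM (cf z) (is_derive_continuous (is_derive_exp k z))).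
have F : is_derive z 1 (fun x => \int[mu]_(t in `]-oo, x]) (f t * expR (k * t)))
    (f z * expR (k * z)).
  by apply: DeriveDef => //; rewrite -derive1E.
have := is_derive_mul (is_derive_exp (- k) z) F.
rewrite /exp_average mulrCA -expRD (_ : _ + k * z = 0) ?expR0 ?mulr1; last first.
  by rewrite mulNr addNr.
by rewrite addrC -mulrA !mulNr.
Qed.

Lemma exp_average_ge0 f z : (forall t, t <= z -> 0 <= f t) -> 0 <= exp_average f z.
Proof.
move=> f0; rewrite mulr_ge0 ?expR_ge0// Rintegral_ge0// => t /=.
by rewrite in_itv/= => tz; rewrite mulr_ge0 ?expR_ge0 ?f0.
Qed.

Lemma exp_average_le f z M : continuous f -> slow_growth f -> (forall t, t <= z -> f t <= M) ->
  exp_average f z <= M / k.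
Proof.
move=> cf fg fM; rewrite /exp_average.
have I := integrable_expR_Ny z k_gt0.
rewrite (@le_trans _ _ (expR (- k * z) * \int[mu]_(t in `]-oo, z]) (M * expR (k * t))))//.
  rewrite ler_wpM2l ?expR_ge0// le_Rintegral//.
  - exact: slow_growth_integrable.
  - by have := integrableZl _ M I; apply; exact: measurable_itv.
  - by move=> t /=; rewrite in_itv/= => tz; rewrite ler_wpM2r ?expR_ge0 ?fM.
rewrite RintegralZl// /Rintegral integral_expR_Ny//=.
have -> : expR (- k * z) * (M * (expR (k * z) / k)) =
    M / k * (expR (- k * z) * expR (k * z)) by ring.
by rewrite -expRD mulNr addNr expR0 mulr1.
Qed.

End exponential_average.

Section decay.
Context {R : realType}.

(** [D] is nondecreasing up to [z0], and the lower bound tends to 0 at -oo, where it stands in for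
    an initial condition. *)
Lemma ge0_of_decay (k M z0 : R) (D dD : R -> R) : 0 < k -> 
  (forall z, z <= z0 -> is_derive z 1 D (dD z)) -> (forall z, z <= z0 -> 0 <= dD z) ->
  (forall z, z <= z0 -> - (M * expR (k * z)) <= D z) ->
  0 <= D z0.
Proof.
move=> k0 DD dD0 DM; apply/ler_addgt0Pl => e e0.
(* [A] is positive, so that [ln (e / A)] makes sense; at or below [k^-1 ln (e / A)] the bound
   [A exp (k z)] is at most [e]. *)
pose A := Num.max M 1.
have A0 : 0 < A by rewrite lt_max ltr01 orbT.
pose z := Num.min z0 (k^-1 * ln (e / A)).
have zz0 : z <= z0 by rewrite ge_min lexx.
have [c /andP[_ cz0] /eqP] : exists2 c, z <= c <= z0 & D z0 - D z = dD c * (z0 - z).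
  by apply: MVT_is_derive => // x /andP[_ xz0]; exact: DD.
rewrite subr_eq => /eqP ->.
have h : - e <= D z.
  rewrite (le_trans _ (DM z zz0))// lerN2 (@le_trans _ _ (A * expR (k * z)))//.
    by rewrite ler_wpM2r ?expR_ge0// le_max lexx.
  rewrite -ler_pdivlMl// [leRHS]mulrC -[leRHS]lnK ?posrE ?divr_gt0// ler_expR.
  by rewrite -ler_pdivlMl// ge_min lexx orbT.
rewrite -[leLHS](addNr e) [leLHS]addrC lerD2l -[leLHS]add0r lerD// mulr_ge0 ?dD0//.
by rewrite subr_ge0.
Qed.

End decay.

(** * The obstacle problem *)

Section obstacle.
Context {R : realType}.
Variables k mu : R.
Hypotheses (k_gt0 : 0 < k) (mu_gt0 : 0 < mu) (mu_lt : mu < k ^+ 2).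
Implicit Types (w m v : R -> R) (a b z : R).

(** The class of functions preserved by the solution map. The lower bound 0 corresponds to
    postponing the stopping indefinitely, when the discounted payoff tends to 0. *)
Definition admissible w := (forall a b, a <= b -> 0 <= w b - w a <= b - a) /\
  forall z, Num.max 0 z <= w z.

Lemma admissible_ge0 w z : admissible w -> 0 <= w z.
Proof. by move=> [_ /(_ z)]; rewrite ge_max => /andP[]. Qed.

Lemma admissible_ge w z : admissible w -> z <= w z.
Proof. by move=> [_ /(_ z)]; rewrite ge_max => /andP[]. Qed.

Lemma lipschitz_continuous (f : R -> R) (L : R) :
  (forall a b, a <= b -> `|f b - f a| <= L * (b - a)) -> continuous f.
Proof.
move=> fL x; apply/cvgrPdist_lt => e e0.
have L0 : 0 < Num.max L 1 by rewrite lt_max ltr01 orbT.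
have fL' y : `|f x - f y| <= Num.max L 1 * `|x - y|.
  have [xy|/ltW yx] := leP x y.
    rewrite distrC (le_trans (fL _ _ xy))// ler0_norm ?subr_le0// opprB.
    by rewrite ler_wpM2r ?subr_ge0 ?le_max ?lexx.
  rewrite (le_trans (fL _ _ yx))// ger0_norm ?subr_ge0//.
  by rewrite ler_wpM2r ?subr_ge0 ?le_max ?lexx.
near=> y; apply: (le_lt_trans (fL' y)); rewrite -ltr_pdivlMl// mulrC.
near: y; apply: cvgr_dist_lt; last by rewrite divr_gt0.
exact: cvg_id.
Unshelve. all: by end_near. Qed.

Lemma admissible_continuous w : admissible w -> continuous w.
Proof.
move=> [wl _]; apply: (@lipschitz_continuous _ 1) => a b ab.
by have /andP[w0 w1] := wl _ _ ab; rewrite mul1r ger0_norm.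
Qed.

Lemma source_slow_growth w : admissible w -> slow_growth k (fun z => mu * w z).
Proof.
move=> wA z; exists (mu * w z * expR (k / 2 * z)) => t tz.
have [wl _] := wA; have /andP[w0 _] := wl _ _ tz.
rewrite ger0_norm ?mulr_ge0 ?(admissible_ge0 _ wA) ?(ltW mu_gt0)//.
rewrite -[leRHS]mulrA -expRD -[leLHS]mulr1.
apply: ler_pM => //; first by rewrite mulr_ge0 ?(admissible_ge0 _ wA) ?(ltW mu_gt0).
  by rewrite ler_wpM2l ?(ltW mu_gt0)//; lra.
rewrite -[leLHS]expR0 ler_expR.
by rewrite mulNr -mulrBr mulr_ge0 ?divr_ge0 ?subr_ge0 ?(ltW k_gt0).
Qed.

(** The integrating factor makes the difference nondecreasing; the lower bound on [m2 - m1],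
    multiplied by [exp (k z)], vanishes at -oo and replaces an initial value. *)
Lemma linear_ode_compare (m1 m2 r1 r2 : R -> R) (M z0 : R) :
  (forall z, is_derive z 1 m1 (r1 z - k * m1 z)) ->
  (forall z, is_derive z 1 m2 (r2 z - k * m2 z)) ->
  (forall z, z <= z0 -> r1 z <= r2 z) ->
  (forall z, z <= z0 -> - M <= m2 z - m1 z) ->
  m1 z0 <= m2 z0.
Proof.
move=> d1 d2 r12 mM.
pose D z := expR (k * z) * (m2 z - m1 z).
suff : 0 <= D z0 by rewrite pmulr_rge0 ?expR_gt0 ?subr_ge0.
apply: (@ge0_of_decay _ k M z0 D (fun z => expR (k * z) * (r2 z - r1 z))) => //.
- move=> z zz0; have := is_derive_mul (is_derive_exp k z) (is_derive_sub (d2 z) (d1 z)).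
  by move/is_derive_val; apply; ring.
- by move=> z zz0; rewrite mulr_ge0 ?expR_ge0 ?subr_ge0 ?r12.
- by move=> z zz0; rewrite -mulNr [leRHS]mulrC ler_wpM2r ?expR_ge0 ?mM.
Qed.

(* [m] is the exponential average of [mu w], which turns [v'' = k^2 v - mu w] into
   [v' = k v - m] on the continuation region [z <= b]; the boundary equation is the
   smooth fit [v'(b) = 1]. *)
Record obstacle_solution w m b v : Prop := ObstacleSolution {
  os_m_ge0 : forall z, 0 <= m z ;
  os_m_le : forall z, k * m z <= mu * w z ;
  os_m_lip : forall a b, a <= b -> 0 <= m b - m a <= mu / k * (b - a) ;
  os_m_derive : forall z, is_derive z 1 m (mu * w z - k * m z) ;
  os_boundary : k * b = 1 + m b ;
  os_stop : forall z, b <= z -> v z = z ;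
  os_stop_derive : forall z, b <= z -> is_derive z 1 v 1 ;
  os_derive : forall z, z <= b -> is_derive z 1 v (k * v z - m z) }.

Lemma muk_lt : mu / k < k.
Proof. by rewrite ltr_pdivrMr// -expr2. Qed.

(** The increments of [m] are bounded by comparing solutions of the same linear equation: the
    translate [m (z + dl)] lies above [m z] because [w] is nondecreasing, and below
    [m z + mu / k * dl] because [w] is 1-Lipschitz. *)
Lemma average_exists w : admissible w -> exists m,
  [/\ forall z, 0 <= m z, forall z, k * m z <= mu * w z,
      forall a b, a <= b -> 0 <= m b - m a <= mu / k * (b - a) &
      forall z, is_derive z 1 m (mu * w z - k * m z)].
Proof.
move=> wA; have [wl _] := wA; pose m := exp_average k (fun z => mu * w z).
have cw : continuous (fun z => mu * w z).
  by move=> z; apply: cvgM; [exact: cvg_cst|exact: admissible_continuous].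
have sg := source_slow_growth wA.
have m_ge0 z : 0 <= m z.
  by apply: exp_average_ge0 => // t _; rewrite mulr_ge0 ?(admissible_ge0 _ wA) ?(ltW mu_gt0).
have m_le z : m z <= mu * w z / k.
  apply: exp_average_le => // t tz; rewrite ler_wpM2l ?(ltW mu_gt0)//.
  by have /andP[w0 _] := wl _ _ tz; lra.
have m_der z : is_derive z 1 m (mu * w z - k * m z) by exact: is_derive_exp_average.
have w_le z z' : z <= z' -> w z <= w z' by move=> /wl/andP[w0 _]; lra.
exists m; split => //.
  by move=> z; have := m_le z; rewrite ler_pdivlMr// mulrC.
move=> a b ab.
pose dl := b - a.
have shift_der z : is_derive z 1 (fun z => m (z + dl)) (mu * w (z + dl) - k * m (z + dl)).
  have h : is_derive z 1 (fun z => z + dl) (1 + 0).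
    exact: is_derive_add (is_derive_id1 z) (is_derive_cst dl z 1).
  have := is_derive_compose h (m_der (z + dl)).
  by rewrite addr0 mul1r.
have dl0 : 0 <= dl by rewrite subr_ge0.
have mb z z' : z <= z' -> m z <= mu * w z' / k.
  move=> zz'; rewrite (le_trans (m_le z))// ler_wpM2r ?invr_ge0 ?(ltW k_gt0)//.
  by rewrite ler_wpM2l ?(ltW mu_gt0)// w_le.
have -> : b = a + dl by rewrite /dl addrC subrK.
apply/andP; split.
  rewrite subr_ge0.
  apply: (@linear_ode_compare m (fun z => m (z + dl)) (fun z => mu * w z)
    (fun z => mu * w (z + dl)) (mu * w a / k)) => //.
    by move=> z za; rewrite ler_wpM2l ?(ltW mu_gt0)// w_le// lerDl.
  by move=> z za; have := m_ge0 (z + dl); have := mb _ _ za; lra.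
have der2 z : is_derive z 1 (fun z => m z + mu / k * dl)
    (mu * w z + mu * dl - k * (m z + mu / k * dl)).
  have := is_derive_add (m_der z) (is_derive_cst (mu / k * dl) z 1).
  by move/is_derive_val; apply; field; rewrite gt_eqF.
suff h : m (a + dl) <= m a + mu / k * dl.
  by rewrite (_ : a + dl - a = dl); [lra|ring].
apply: (@linear_ode_compare (fun z => m (z + dl)) (fun z => m z + mu / k * dl)
    (fun z => mu * w (z + dl)) (fun z => mu * w z + mu * dl) (mu * w (a + dl) / k)) => //.
  move=> z za; rewrite -mulrDr ler_wpM2l ?(ltW mu_gt0)//.
  have zd : z <= z + dl by rewrite lerDl.
  by have /andP[_] := wl _ _ zd; lra.
move=> z za; have zd : z + dl <= a + dl by rewrite lerD2r.
have := mb _ _ zd; have := m_ge0 z.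
have : 0 <= mu / k * dl by rewrite mulr_ge0 ?divr_ge0 ?(ltW mu_gt0) ?(ltW k_gt0).
lra.
Qed.

Lemma obstacle_exists w : admissible w -> exists m b v, obstacle_solution w m b v.
Proof.
move=> wA; have [m [m_ge0 m_le m_lip m_der]] := average_exists wA.
have k_ge0 := ltW k_gt0.
have muk0 : 0 <= mu / k by rewrite divr_ge0 ?(ltW mu_gt0).
have cm : continuous m.
  by move=> z; exact: is_derive_continuous (m_der z).
have [b kb] : exists b, k * b = 1 + m b.
  (* [k z - (1 + m z)] is negative at 0 and grows with slope at least [g], hence is nonnegative at
     [Z]. *)
  pose g := k - mu / k; have g0 : 0 < g by rewrite subr_gt0 muk_lt.
  pose Z := (1 + m 0) / g.
  have Z0 : 0 <= Z by rewrite divr_ge0 ?(ltW g0)// addr_ge0.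
  have gZ : g * Z = 1 + m 0 by rewrite mulrC divfK// gt_eqF.
  pose F z := k * z - (1 + m z).
  have cF : continuous F.
    move=> z; apply: cvgB; first by apply: cvgM; [exact: cvg_cst|exact: cvg_id].
    by apply: cvgD; [exact: cvg_cst|exact: cm].
  have FZ : 0 <= F Z.
    have /andP[_] := m_lip _ _ Z0; rewrite subr0 /F => h.
    have E : g * Z = k * Z - mu / k * Z by rewrite mulrBl.
    by lra.
  have F0 : F 0 <= 0 by rewrite /F mulr0; have := m_ge0 0; lra.
  have [|c _ /eqP Fc] := @IVT R F 0 Z 0 Z0 (continuous_subspaceT cF).
    by apply/andP; split; [rewrite ge_min F0|rewrite le_max FZ orbT].
  by exists c; move: Fc; rewrite subr_eq0 => /eqP.
(* The solution of [v' = k v - m] that does not grow exponentially at +oo is the integral of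
   [exp (k (z - s)) m s] over [s >= z], that is, the exponential average of the reflected [m] at
   [- z]. As [m] grows at most linearly, its reflection has slow growth at -oo. *)
pose rm t := m (- t).
have crm : continuous rm.
  by move=> z; apply: (@continuous_comp _ _ _ -%R m) => //; [exact: opp_continuous|exact: cm].
have sg : slow_growth k rm.
  move=> z; pose e := expR (k / 2 * `|z|).
  have e1 : 1 <= e.
    by rewrite -[leLHS]expR0 ler_expR mulr_ge0 ?divr_ge0.
  exists ((m 0 + mu / k * `|z|) * e + mu / k * (2 / k)) => t tz.
  have k2 : 0 < k / 2 by rewrite divr_gt0.
  rewrite /rm ger0_norm//.
  have [t0|t0] := leP t 0.
    have /andP[_] := m_lip 0 (- t) ltac:(by rewrite oppr_ge0).
    rewrite subr0 => h.
    have x1 := expR_ge1Dx (- (k / 2) * t).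
    have E1 : 1 <= expR (- (k / 2) * t).
      by rewrite -[leLHS]expR0 ler_expR mulNr oppr_ge0 mulr_ge0_le0// ltW.
    have : - t <= 2 / k * expR (- (k / 2) * t).
      have -> : - t = 2 / k * (- (k / 2) * t) by field; rewrite gt_eqF.
      by rewrite ler_wpM2l ?divr_ge0//; lra.
    move=> /(ler_wpM2l muk0) h2.
    rewrite mulrDl -[X in _ <= _ + X]mulrA.
    have : m 0 <= (m 0 + mu / k * `|z|) * e * expR (- (k / 2) * t).
      rewrite -[leLHS]mulr1 ler_pM ?m_ge0//.
      rewrite -[leLHS]mulr1 ler_pM ?m_ge0//.
      by rewrite lerDl mulr_ge0.
    by lra.
  have z0 : 0 <= z by rewrite (le_trans (ltW t0)).
  have mt : m (- t) <= m 0.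
    have /andP[] := m_lip (- t) 0 ltac:(by rewrite oppr_le0 ltW).
    by lra.
  have E : 1 <= e * expR (- (k / 2) * t).
    rewrite -expRD -[leLHS]expR0 ler_expR ger0_norm// mulNr -mulrBr.
    by rewrite mulr_ge0 ?(ltW k2)// subr_ge0.
  rewrite mulrDl (le_trans mt)// (@le_trans _ _ ((m 0 + mu / k * `|z|) * e * expR (- (k / 2) * t)))//.
    rewrite -mulrA -[leLHS]mulr1 ler_pM//.
    by rewrite lerDl mulr_ge0.
  by rewrite lerDl mulr_ge0 ?expR_ge0// mulr_ge0// divr_ge0.
pose n z := exp_average k rm (- z).
have n_der z : is_derive z 1 n (k * n z - m z).
  have h : is_derive z 1 (fun z : R => - z) (- 1).
    by have := is_deriveNid z (1 : R).
  have := is_derive_compose h (is_derive_exp_average k_gt0 (- z) crm sg).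
  by move/is_derive_val; apply; rewrite /n /rm opprK; ring.
(* The multiple of [exp (k z)] is fixed by [v0 b = b]; the equation and [k b = 1 + m b] then give
   slope 1 at [b]. *)
pose v0 z := expR (k * (z - b)) * (b - n b) + n z.
have v0_der z : is_derive z 1 v0 (k * v0 z - m z).
  have h : is_derive z 1 (fun z => k * (z - b)) (k * (1 - 0)).
    exact: is_derive_scale (is_derive_sub (is_derive_id1 z) (is_derive_cst b z 1)).
  have h2 := is_derive_compose h (is_derive_expR _).
  have := is_derive_add (is_derive_mul h2 (is_derive_cst (b - n b) z 1)) (n_der z).
  by move/is_derive_val; apply; rewrite /v0 /cst /=; ring.
have v0b : v0 b = b by rewrite /v0 subrr mulr0 expR0; ring.
pose v z := if z < b then v0 z else z.
have vb : is_derive b 1 v 1.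
  have d := v0_der b; rewrite v0b kb addrK in d.
  exact: (is_derive_glue (g := fun z => z) v0b d (is_derive_id1 b)).
exists m, b, v; split => //.
- by move=> z bz; rewrite /v ltNge bz.
- move=> z; rewrite le_eqVlt => /predU1P[<-//|bz].
  apply: (is_derive_gt_eq bz _ (is_derive_id1 z)) => y bY.
  by rewrite /v ltNge (ltW bY).
- move=> z; rewrite le_eqVlt => /predU1P[->|zb].
    by rewrite {2}/v ltxx kb addrK.
  rewrite {2}/v zb; apply: (is_derive_lt_eq zb _ (v0_der z)) => y yb.
  by rewrite /v yb.
Qed.

End obstacle.

Section obstacle_properties.
Context {R : realType}.
Variables k mu : R.
Hypotheses (k_gt0 : 0 < k) (mu_gt0 : 0 < mu) (mu_lt : mu < k ^+ 2).
Implicit Types (w m v : R -> R) (a b z : R).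
Local Notation sol := (obstacle_solution k mu).

Lemma mu_div_lt : mu / k < k.
Proof. by rewrite ltr_pdivrMr// -expr2. Qed.

Lemma os_boundary_ge0 w m b v : sol w m b v -> 0 <= b.
Proof.
by move=> s; rewrite -(pmulr_rge0 _ k_gt0) (os_boundary s) addr_ge0// (os_m_ge0 s).
Qed.

(** By the mean value theorem the Lipschitz bound on [m] limits [m'] at some point of [[z, z + d]];
    monotonicity of [w] and the same bound carry this back to [z] at a cost [mu d = e]. *)
Lemma os_m_derive_le w m b v z : admissible w -> sol w m b v ->
  mu * w z - k * m z <= mu / k.
Proof.
move=> wA s; have [wl _] := wA; apply/ler_addgt0Pl => e e0.
pose d := e / mu; have d0 : 0 < d by rewrite divr_gt0.
have zd : z <= z + d by rewrite lerDl ltW.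
have [c /andP[zc cd]] := MVT_is_derive zd (fun x _ => os_m_derive s x).
have /andP[_] := os_m_lip s zd; have -> : z + d - z = d by ring.
move=> + E; rewrite E ler_pM2r// => h.
have /andP[w0 _] := wl _ _ zc.
have /andP[m0 m1] := os_m_lip s zc.
have : 0 <= mu * (w c - w z) by rewrite mulr_ge0// ltW.
have : k * (m c - m z) <= mu * d.
  rewrite (@le_trans _ _ (k * (mu / k * (c - z))))//; first by rewrite ler_pM2l.
  rewrite mulrA (mulrC k) divfK ?gt_eqF// ler_pM2l//; lra.
have -> : mu * d = e by rewrite /d mulrC divfK// gt_eqF.
lra.
Qed.

(** The slope [p = k v - m] solves [p' = k p - m'] with [p b = 1]. As [0 <= m' <= mu / k < k], both
    [exp (- k x) p] and [exp (- k x) (1 - p)] are nonincreasing up to [b], where they are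
    nonnegative. *)
Lemma os_slope w m b v z : admissible w -> sol w m b v -> z <= b ->
  0 <= k * v z - m z <= 1.
Proof.
move=> wA s zb; pose p x := k * v x - m x.
have pb : p b = 1 by rewrite /p (os_stop s)// (os_boundary s) addrK.
have dp x : x <= b -> is_derive x 1 p (k * p x - (mu * w x - k * m x)).
  move=> xb.
  exact: is_derive_sub (is_derive_scale k (os_derive s xb)) (os_m_derive s x).
have m'0 x : 0 <= mu * w x - k * m x by rewrite subr_ge0 (os_m_le s).
have m'1 x : mu * w x - k * m x <= k.
  by rewrite (le_trans (os_m_derive_le x wA s))// ltW// mu_div_lt.
rewrite -/(p z); apply/andP; split.
  have [|c /andP[_ cb] E] := @MVT_is_derive _ (fun x => expR (- k * x) * p x)
    (fun x => - (expR (- k * x) * (mu * w x - k * m x))) z b zb.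
    move=> x /andP[_ xb].
    by move: (is_derive_mul (is_derive_exp (- k) x) (dp x xb)) => /is_derive_val; apply; ring.
  rewrite -(pmulr_rge0 _ (expR_gt0 (- k * z))) -[leRHS]opprK oppr_ge0.
  have : 0 <= expR (- k * b) * p b by rewrite pb mulr1 expR_ge0.
  have : 0 <= expR (- k * c) * (mu * w c - k * m c) * (b - z).
    by rewrite mulr_ge0 ?subr_ge0// mulr_ge0 ?expR_ge0.
  by lra.
have [|c /andP[_ cb] E] := @MVT_is_derive _ (fun x => expR (- k * x) * (1 - p x))
    (fun x => expR (- k * x) * ((mu * w x - k * m x) - k)) z b zb.
  move=> x /andP[_ xb].
  have := is_derive_mul (is_derive_exp (- k) x)
    (is_derive_sub (is_derive_cst (1 : R) x 1) (dp x xb)).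
  by move=> /is_derive_val; apply; rewrite /cst /=; ring.
rewrite -subr_ge0 -(pmulr_rge0 _ (expR_gt0 (- k * z))).
move: E; rewrite pb subrr mulr0.
have : 0 <= expR (- k * c) * (k - (mu * w c - k * m c)) * (b - z).
  by rewrite mulr_ge0 ?subr_ge0// mulr_ge0 ?expR_ge0// subr_ge0.
by lra.
Qed.

Definition os_deriv m b v z : R := if z < b then k * v z - m z else 1.

Lemma os_is_derive w m b v z : sol w m b v -> is_derive z 1 v (os_deriv m b v z).
Proof.
move=> s; rewrite /os_deriv; case: ltP => zb; last exact: (os_stop_derive s zb).
exact: (os_derive s (ltW zb)).
Qed.

Lemma os_deriv_itv w m b v z : admissible w -> sol w m b v -> 0 <= os_deriv m b v z <= 1.
Proof.
move=> wA s; rewrite /os_deriv; case: ltP => zb; last by rewrite ler01 lexx.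
exact: os_slope s (ltW zb).
Qed.

Lemma os_admissible w m b v : admissible w -> sol w m b v -> admissible v.
Proof.
move=> wA s.
have vl x y : x <= y -> 0 <= v y - v x <= y - x.
  move=> xy; have [c _ ->] := MVT_is_derive xy (fun x _ => os_is_derive x s).
  have /andP[d0 d1] := os_deriv_itv c wA s.
  rewrite mulr_ge0 ?subr_ge0//=.
  by rewrite -[leRHS]mul1r ler_wpM2r ?subr_ge0.
split=> // z; rewrite ge_max.
have [bz|/ltW zb] := leP b z.
  by rewrite (os_stop s bz) lexx (le_trans (os_boundary_ge0 s)).
apply/andP; split; last by have /andP[_] := vl _ _ zb; rewrite (os_stop s (lexx b)); lra.
have /andP[h _] := os_slope wA s zb.
rewrite -(pmulr_rge0 _ k_gt0); have := os_m_ge0 s z; lra.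
Qed.

(** A larger source gives a larger average, then a larger boundary because [k b - m b] is strictly
    increasing in [b]. Below [b] the quantity [exp (- k x) (v' - v)] is nonincreasing, and at [b] it
    is nonnegative since [v' b >= b = v b]. *)
Lemma os_le w w' m b v m' b' v' : admissible w -> admissible w' ->
  (forall z, w z <= w' z) -> sol w m b v -> sol w' m' b' v' -> forall z, v z <= v' z.
Proof.
move=> wA wA' ww' s s'.
have mm z : m z <= m' z.
  apply: (@linear_ode_compare _ k k_gt0 m m' (fun z => mu * w z) (fun z => mu * w' z) (mu * w z / k)).
  - exact: os_m_derive s.
  - exact: os_m_derive s'.
  - by move=> x _; rewrite ler_wpM2l// ltW.
  move=> x xz; have := os_m_ge0 s' x.
  have : m x <= mu * w z / k.
    rewrite ler_pdivlMr// mulrC (le_trans (os_m_le s x))// ler_wpM2l ?(ltW mu_gt0)//.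
    by have [/(_ _ _ xz)/andP[]] := wA; lra.
  by lra.
have v'A := os_admissible wA' s'.
have bb : b <= b'.
  rewrite leNgt; apply/negP => b'b.
  have /andP[_ h] := os_m_lip s (ltW b'b).
  have : k * (b - b') <= mu / k * (b - b').
    by rewrite mulrBr (os_boundary s) (os_boundary s'); have := mm b'; lra.
  by rewrite ler_pM2r ?subr_gt0// leNgt mu_div_lt.
move=> z; have [bz|/ltW zb] := leP b z.
  by rewrite (os_stop s bz) (admissible_ge z v'A).
have [|c /andP[_ cb] E] := @MVT_is_derive _ (fun x => expR (- k * x) * (v' x - v x))
    (fun x => expR (- k * x) * (m x - m' x)) z b zb.
  move=> x /andP[_ xb].
  have := is_derive_mul (is_derive_exp (- k) x)
    (is_derive_sub (os_derive s' (le_trans xb bb)) (os_derive s xb)).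
  by move=> /is_derive_val; apply; ring.
rewrite -subr_ge0 -(pmulr_rge0 _ (expR_gt0 (- k * z))).
have : 0 <= expR (- k * b) * (v' b - v b).
  by rewrite mulr_ge0 ?expR_ge0// subr_ge0 (os_stop s)// (admissible_ge b v'A).
have : 0 <= expR (- k * c) * (m' c - m c) * (b - z).
  by rewrite mulr_ge0 ?subr_ge0// mulr_ge0 ?expR_ge0// subr_ge0.
by lra.
Qed.

(** Slope at most 1 means [k v <= 1 + m]; with [k m <= mu w] this gives [k^2 v <= k + mu w], and [k]
    is absorbed by [(k^2 - mu) w]. So a function that contains a large enough constant is a
    supersolution. *)
Lemma os_le_source w m b v C : admissible w -> sol w m b v ->
  k <= (k ^+ 2 - mu) * C -> (forall z, C <= w z) -> forall z, v z <= w z.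
Proof.
move=> wA s kC Cw z; have [bz|/ltW zb] := leP b z.
  by rewrite (os_stop s bz) (admissible_ge z wA).
have /andP[_ h] := os_slope wA s zb.
have k2 : 0 < k ^+ 2 by rewrite exprn_gt0.
rewrite -(ler_pM2l k2) expr2.
have h1 : k * (k * v z) <= k * (1 + m z) by rewrite ler_pM2l//; lra.
have h2 := os_m_le s z.
have : (k ^+ 2 - mu) * C <= (k ^+ 2 - mu) * w z by rewrite ler_pM2l ?subr_gt0.
by rewrite [X in _ <= X -> _]mulrBl expr2; lra.
Qed.

End obstacle_properties.

(** * The coupled obstacle problems of the two regimes *)

Section regime_system.
Context {R : realType}.
Variables k mu : 'I_2 -> R.
Hypotheses (k_gt0 : forall i, 0 < k i) (mu_gt0 : forall i, 0 < mu i)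
  (mu_lt : forall i, mu i < k i ^+ 2).

(* The fixed point is the pointwise infimum of the supersolutions, as in
   Tarski's theorem. *)
Lemma obstacle_system_exists : exists (v m : 'I_2 -> R -> R) (b : 'I_2 -> R) (C : R),
  [/\ forall i, admissible (v i),
      forall i, obstacle_solution (k i) (mu i) (v (rev_ord i)) (m i) (b i) (v i),
      0 <= C & forall i z, v i z <= C + Num.max 0 z].
Proof.
pose S (w : 'I_2 -> R -> R) := (forall i, admissible (w i)) /\
  forall i, exists m b v, obstacle_solution (k i) (mu i) (w (rev_ord i)) m b v /\
    forall z, v z <= w i z.
(* [Ci i] is the least constant accepted by [os_le_source] in regime [i]; the sum serves both
   regimes. *)
pose Ci i := k i / (k i ^+ 2 - mu i).
have Ci0 i : 0 <= Ci i by rewrite divr_ge0 ?subr_ge0 ?ltW.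
pose C := Ci ord0 + Ci ord_max.
have C0 : 0 <= C by rewrite addr_ge0.
have CiC i : Ci i <= C.
  by case: i => -[|[|//]] h; rewrite /C;
    [rewrite (_ : Ordinal h = ord0)|rewrite (_ : Ordinal h = ord_max)];
    rewrite ?lerDl ?lerDr//; apply: val_inj.
pose w0 (i : 'I_2) z := C + Num.max 0 z.
have w0A i : admissible (w0 i).
  split=> [x y xy|z]; last by rewrite /w0 lerDr.
  rewrite /w0 opprD addrACA subrr add0r.
  by case: (leP 0 x) => x0; case: (leP 0 y) => y0; apply/andP; split; lra.
have Sw0 : S w0.
  split=> // i.
  have [m [b [v s]]] := obstacle_exists (k_gt0 i) (mu_gt0 i) (mu_lt i) (w0A (rev_ord i)).
  exists m, b, v; split => //; apply: (os_le_source _ _ _ _ s (C := C)) => //.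
    apply: le_trans (ler_wpM2l _ (CiC i)); last by rewrite subr_ge0 ltW.
    by rewrite /Ci mulrCA divff ?mulr1// gt_eqF// subr_gt0.
  by move=> z; rewrite /w0 lerDl le_max lexx.
pose A i z := [set w i z | w in S].
pose wb i z := inf (A i z).
have Ane i z : A i z !=set0 by exists (w0 i z); exists w0.
have Alb i z : lbound (A i z) (Num.max 0 z).
  by move=> _ [w [wA _] <-]; have [_] := wA i; apply.
have Ahi i z : has_inf (A i z) by split; [exact: Ane|exists (Num.max 0 z); exact: Alb].
have wb_le w i z : S w -> wb i z <= w i z.
  by move=> Sw; apply: ge_inf; [exists (Num.max 0 z); exact: Alb|exists w].
have le_wb i z x : (forall w, S w -> x <= w i z) -> x <= wb i z.
  by move=> h; apply: lb_le_inf => // _ [w Sw <-]; exact: h.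
have wbA i : admissible (wb i).
  split=> [x y xy|z]; last by apply: le_wb => w [wA _]; have [_] := wA i; apply.
  apply/andP; split.
    rewrite subr_ge0; apply: le_wb => w Sw; rewrite (le_trans (wb_le _ _ _ Sw))//.
    by have [/(_ i)[/(_ _ _ xy)/andP[]]] := Sw; lra.
  suff : wb i y - (y - x) <= wb i x by lra.
  apply: le_wb => w Sw; have := wb_le _ i y Sw.
  by have [/(_ i)[/(_ _ _ xy)/andP[]]] := Sw; lra.
have /choice[m /choice[b /choice[v vs]]] : forall i, exists m b v,
    obstacle_solution (k i) (mu i) (wb (rev_ord i)) m b v.
  by move=> i; exact: obstacle_exists.
have vA i : admissible (v i) by apply: (os_admissible _ _ _ _ (vs i)) => //.
have v_le i z : v i z <= wb i z.
  apply: le_wb => w Sw; have [wA /(_ i)[m' [b' [v' [s' le']]]]] := Sw.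
  apply: le_trans (le' z); apply: (os_le _ _ _ _ _ _ (vs i) s') => // x.
  exact: wb_le.
(* By monotonicity [v], the solution with source [wb], lies below every supersolution and so below
   [wb]. Applying the solution map once more shows that [v] is itself a supersolution, whence
   [wb <= v]. *)
have Sv : S v.
  split=> // i.
  have [m' [b' [v' s']]] := obstacle_exists (k_gt0 i) (mu_gt0 i) (mu_lt i) (vA (rev_ord i)).
  exists m', b', v'; split=> //; apply: (os_le _ _ _ _ _ _ s' (vs i)) => // x.
have E i z : wb i z = v i z by apply/eqP; rewrite eq_le v_le wb_le.
exists v, m, b, C; split => //.
  by move=> i; rewrite (_ : v (rev_ord i) = wb (rev_ord i)) //; apply/funext => z.
by move=> i z; rewrite -E; exact: (wb_le w0 i z Sw0).
Qed.

End regime_system.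

Section regime_solution.
Context {R : realType}.
Variables k mu : 'I_2 -> R.

(** The value that the equation prescribes for [v_i'']. Beyond [b_i] the second derivative is 0
    instead, and the sign of this quantity decides the inequality for the generator there. *)
Definition regime_curvature (v : 'I_2 -> R -> R) (i : 'I_2) (z : R) : R :=
  k i ^+ 2 * v i z - mu i * v (rev_ord i) z.

Record regime_solution (v p : 'I_2 -> R -> R) (b : 'I_2 -> R) (C : R) : Prop :=
  RegimeSolution {
  rs_lip : forall i x y, x <= y -> 0 <= v i y - v i x <= y - x ;
  rs_ge : forall i z, Num.max 0 z <= v i z ;
  rs_le : forall i z, v i z <= C + Num.max 0 z ;
  rs_C_ge0 : 0 <= C ;
  rs_stop : forall i z, b i <= z -> v i z = z ;
  rs_derive : forall i (z : R), is_derive z 1 (v i) (p i z) ;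
  rs_deriv_itv : forall i z, 0 <= p i z <= 1 ;
  rs_deriv_continuous : forall i, continuous (p i) ;
  rs_deriv_stop : forall i z, b i <= z -> p i z = 1 ;
  rs_derive2 : forall i (z : R), z < b i -> is_derive z 1 (p i) (regime_curvature v i z) ;
  rs_curvature_ge0 : forall i z, b i <= z -> 0 <= regime_curvature v i z }.

Hypotheses (k_gt0 : forall i, 0 < k i) (mu_gt0 : forall i, 0 < mu i)
  (mu_lt : forall i, mu i < k i ^+ 2).

Lemma regime_solution_exists : exists v p b C, regime_solution v p b C.
Proof.
have [v [m [b [C [vA s C0 vC]]]]] := obstacle_system_exists k_gt0 mu_gt0 mu_lt.
pose p i z := os_deriv (k i) (m i) (b i) (v i) z.
exists v, p, b, C.
(* Freezing the argument at [b i] expresses the slope on both sides by one formula, from which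
   continuity at [b i] follows. *)
have pE i z : p i z = k i * v i (Num.min z (b i)) - m i (Num.min z (b i)).
  rewrite /p /os_deriv; case: ltP => // bz.
  by rewrite (os_stop (s i) (lexx _)) (os_boundary (s i)) addrK.
split.
- by move=> i; have [] := vA i.
- by move=> i; have [] := vA i.
- exact: vC.
- exact: C0.
- by move=> i z; exact: (os_stop (s i)).
- by move=> i z; exact: os_is_derive (s i).
- move=> i z; apply: (os_deriv_itv _ _ _ _ _ (s i)) => //.
- move=> i z; rewrite (_ : p i = fun z => k i * v i (Num.min z (b i)) - m i (Num.min z (b i)));
    last by apply/funext => y; exact: pE.
  have cmin : {for z, continuous (fun z => Num.min z (b i))}.
    apply: (@continuous_min _ _ idfun (cst (b i))); [exact: cvg_id|exact: cvg_cst].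
  apply: cvgB.
    apply: cvgM; first exact: cvg_cst.
    apply: (@continuous_comp _ _ _ (fun z => Num.min z (b i)) (v i)) => //.
    exact: (is_derive_continuous (os_is_derive _ (s i))).
  apply: (@continuous_comp _ _ _ (fun z => Num.min z (b i)) (m i)) => //.
  exact: (is_derive_continuous (os_m_derive (s i) _)).
- by move=> i z bz; rewrite /p /os_deriv ltNge bz.
- move=> i z zb.
  have h : is_derive z 1 (fun z => k i * v i z - m i z) (regime_curvature v i z).
    have := is_derive_sub (is_derive_scale (k i) (os_derive (s i) (ltW zb)))
      (os_m_derive (s i) z).
    by move=> /is_derive_val; apply; rewrite /regime_curvature; ring.
  by apply: (is_derive_lt_eq zb _ h) => y yb; rewrite /p /os_deriv yb.
(* At [b] the curvature is [k - m'(b)], positive by [m' <= mu / k < k]; beyond [b] it does not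
   decrease, since the value in the other regime is 1-Lipschitz and [mu < k^2]. *)
- move=> i z bz.
  have h0 := os_m_derive_le (k_gt0 i) (mu_gt0 i) (b i) (vA (rev_ord i)) (s i).
  have h1 := mu_div_lt (k_gt0 i) (mu_lt i).
  have [vl _] := vA (rev_ord i).
  have /andP[_ h2] := vl _ _ bz.
  rewrite /regime_curvature (os_stop (s i) bz).
  have h3 : k i ^+ 2 * b i = k i + k i * m i (b i).
    by rewrite expr2 -mulrA (os_boundary (s i)) mulrDr mulr1.
  have h4 : mu i * (v (rev_ord i) z - v (rev_ord i) (b i)) <= k i ^+ 2 * (z - b i).
    rewrite (@le_trans _ _ (mu i * (z - b i)))// ?ler_pM2l//.
    by rewrite ler_wpM2r ?subr_ge0// ltW.
  by lra.
Qed.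

End regime_solution.

(** * Third-order Taylor estimates across the free boundary *)

Section taylor.
Context {R : realType}.
Variables (k mu : 'I_2 -> R) (v p : 'I_2 -> R -> R) (b : 'I_2 -> R) (C : R).
Hypotheses (k_gt0 : forall i, 0 < k i) (mu_gt0 : forall i, 0 < mu i)
  (s : regime_solution k mu v p b C).
Local Notation g := (regime_curvature k mu v).

Lemma rs_dist i (x y : R) : `|v i x - v i y| <= `|x - y|.
Proof.
have [xy|/ltW yx] := leP x y.
  rewrite distrC [leRHS]distrC; have /andP[h0 h1] := rs_lip s i xy.
  by rewrite ger0_norm// (le_trans h1)// ler_norm.
have /andP[h0 h1] := rs_lip s i yx.
by rewrite ger0_norm// (le_trans h1)// ler_norm.
Qed.

Definition curvature_lip i : R := k i ^+ 2 + mu i.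

Lemma curvature_lip_ge0 i : 0 <= curvature_lip i.
Proof. by rewrite addr_ge0 ?ltW// exprn_gt0. Qed.

Lemma curvature_dist i (x y : R) : `|g i x - g i y| <= curvature_lip i * `|x - y|.
Proof.
rewrite /regime_curvature /curvature_lip mulrDl.
rewrite (_ : _ - _ = k i ^+ 2 * (v i x - v i y) -
  mu i * (v (rev_ord i) x - v (rev_ord i) y)); last by ring.
rewrite (le_trans (ler_normB _ _))// [X in X + _]normrM [X in _ + X]normrM.
rewrite (gtr0_norm (mu_gt0 i)) (gtr0_norm (exprn_gt0 2 (k_gt0 i))).
by apply: lerD; apply: ler_wpM2l; rewrite ?rs_dist// ltW// exprn_gt0.
Qed.

Lemma curvature_le i (x y d : R) : `|x - y| <= d -> g i x <= g i y + curvature_lip i * d.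
Proof.
move=> xyd; have := curvature_dist i x y; rewrite ler_norml => /andP[_].
have := ler_wpM2l (curvature_lip_ge0 i) xyd; lra.
Qed.

(** [p] stops changing at [b], so only the part of the interval below [b] contributes, with a
    curvature close to [g y]; the full length [x' - x] may stand on the right because [g] is
    nonnegative at [b]. The base point [y] is left free in [[x, x']] to serve steps in both
    directions. *)
Lemma deriv_incr_le i (x x' y : R) : x <= y -> y <= x' ->
  p i x' - p i x <= (x' - x) * (g i y + curvature_lip i * (x' - x)).
Proof.
move=> xy yx'; have xx' := le_trans xy yx'.
have L0 := curvature_lip_ge0 i.
have [bx|xb] := leP (b i) x.
  rewrite !(rs_deriv_stop s) ?(le_trans bx)// subrr.
  apply: mulr_ge0; first by rewrite subr_ge0.
  apply: addr_ge0; last by rewrite mulr_ge0 ?subr_ge0.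
  by apply: (rs_curvature_ge0 s); exact: le_trans xy.
have [xx|xx] := eqVneq x x'; first by rewrite xx !subrr mul0r.
have {xx}xx' : x < x' by rewrite lt_neqAle xx.
pose x2 := Num.min x' (b i).
have xx2 : x < x2 by rewrite lt_min xx'.
have px2 : p i x' = p i x2.
  by rewrite /x2; case: leP => // bx'; rewrite !(rs_deriv_stop s)// ltW.
have [c /andP[xc cx2] E] : exists2 c, x < c < x2 & p i x2 - p i x = g i c * (x2 - x).
  apply: MVT_is_derive_oo => //; try exact: rs_deriv_continuous s i _.
  move=> z /andP[_ zx2]; apply: (rs_derive2 s).
  by rewrite (lt_le_trans zx2)// ge_min lexx orbT.
have x2x' : x2 <= x' by rewrite ge_min lexx.
rewrite px2 E mulrC.
set G := g i y + _.
have cG : g i c <= G.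
  by apply: curvature_le; rewrite ler_norml; apply/andP; split; lra.
have x2x0 : 0 <= x2 - x by rewrite subr_ge0 ltW.
rewrite (@le_trans _ _ ((x2 - x) * G))// ?ler_wpM2l//.
have [bx'|bx'] := leP x' (b i); first by rewrite /x2 min_l.
rewrite ler_wpM2r ?lerD2r//.
apply: (@le_trans _ _ (g i (b i))); first exact: rs_curvature_ge0 s _ _ (lexx _).
by apply: curvature_le; rewrite ler_norml; apply/andP; split; lra.
Qed.

(** Taylor's formula without a second derivative: the remainder [H] vanishes at 0 and has a
    nonnegative derivative by the hypothesis on the increments of the slope. [e] is the direction of
    the step, [c] the side of the bound. *)
Lemma taylor_aux i (y e c T G L : R) : 0 <= T -> 0 <= L ->
  (forall t, 0 <= t <= T ->
    c * (e * (p i (y + e * t) - p i y)) <= t * (c * G + L * t)) ->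
  c * (v i (y + e * T) - v i y - p i y * (e * T) - G / 2 * T ^+ 2) <= L * T ^+ 3.
Proof.
move=> T0 L0 h.
pose H t := L * (t * t * t) - c * (v i (y + e * t) - v i y - p i y * (e * t) - G / 2 * (t * t)).
have dH (t : R) : is_derive t 1 H (L * (3 * t ^+ 2) -
    c * (e * p i (y + e * t) - p i y * e - G * t)).
  have d1 := is_derive_id1 t.
  have d2 := is_derive_mul d1 d1.
  have d3 := is_derive_mul d2 d1.
  have de := is_derive_scale e d1.
  have dv := is_derive_compose (is_derive_add (is_derive_cst y t 1) de) (rs_derive s i _).
  have := is_derive_sub (is_derive_scale L d3) (is_derive_scale c
    (is_derive_sub (is_derive_sub (is_derive_sub dv (is_derive_cst (v i y) t 1))
      (is_derive_scale (p i y) de)) (is_derive_scale (G / 2) d2))).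
  by move=> /is_derive_val; apply; rewrite /cst /=; field.
have [t /andP[t0 tT] E] := MVT_is_derive T0 (fun t _ => dH t).
suff : 0 <= H T by rewrite /H !exprS expr0 !mulr1 subr_ge0 [T * (T * T)]mulrA.
have -> : H T = H T - H 0 by rewrite /H !mulr0 addr0 !subrr mulr0 !subr0.
rewrite E subr0 mulr_ge0//.
have tT' : 0 <= t <= T by rewrite t0.
have := h t tT'.
have : 0 <= L * t ^+ 2 by rewrite mulr_ge0// exprn_ge0.
rewrite expr2; nra.
Qed.

Lemma sign_norm (xi : R) : exists2 e : R, e = 1 \/ e = -1 & xi = e * `|xi|.
Proof.
have [x0|x0] := leP 0 xi; first by exists 1; [left|rewrite ger0_norm// mul1r].
by exists (-1); [right|rewrite ltr0_norm// mulN1r opprK].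
Qed.

Lemma taylor_upper i (y xi : R) :
  v i (y + xi) <= v i y + p i y * xi + g i y / 2 * xi ^+ 2 + curvature_lip i * `|xi| ^+ 3.
Proof.
have L0 := curvature_lip_ge0 i.
have [e e1 xie] := sign_norm xi.
have := @taylor_aux i y e 1 `|xi| (g i y) (curvature_lip i) (normr_ge0 _) L0.
rewrite -xie real_normK ?num_real// !mul1r => H.
have {}H := H _; suff : forall t : R, 0 <= t <= `|xi| -> 1 * (e * (p i (y + e * t) - p i y)) <=
    t * (g i y + curvature_lip i * t) by move=> /H; lra.
move=> t /andP[t0 _]; rewrite mul1r; case: e1 => ->.
  have E : y + t - y = t by ring.
  rewrite !mul1r; have := @deriv_incr_le i y (y + t) y (lexx _) _.
  by rewrite lerDl E; apply.
have E : y - (y - t) = t by ring.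
rewrite !mulN1r opprB; have := @deriv_incr_le i (y - t) y y _ (lexx _).
by rewrite gerBl E; apply.
Qed.

Lemma deriv_incr_ge i (x x' y : R) : x <= y -> y <= x' -> x' <= b i ->
  (x' - x) * (g i y - curvature_lip i * (x' - x)) <= p i x' - p i x.
Proof.
move=> xy yx' xb; have xx' := le_trans xy yx'.
have [xx|xx] := eqVneq x x'; first by rewrite xx !subrr mul0r.
have {xx}xx' : x < x' by rewrite lt_neqAle xx.
have [c /andP[xc cx2] ->] : exists2 c, x < c < x' & p i x' - p i x = g i c * (x' - x).
  apply: MVT_is_derive_oo => //; try exact: (rs_deriv_continuous s).
  move=> z /andP[_ zx2]; apply: (rs_derive2 s).
  by rewrite (lt_le_trans zx2).
rewrite mulrC ler_wpM2r ?subr_ge0 ?(ltW xx')//.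
suff : g i y <= g i c + curvature_lip i * (x' - x) by lra.
by apply: curvature_le; rewrite ler_norml; apply/andP; split; lra.
Qed.

(** For [|xi| <= d] the segment stays below [b], where the slope is differentiable. For a longer
    step the terms are bounded crudely: [v] and [p xi] contribute at most [|xi|] each, and [g <= M];
    as [1 <= |xi| / d], the cubic term absorbs them, whence [2 / d^2] and [M / d]. *)
Lemma taylor_lower i (d : R) : 0 < d -> exists2 L, 0 <= L & forall y xi, y <= b i - d ->
  v i y + p i y * xi + g i y / 2 * xi ^+ 2 - L * `|xi| ^+ 3 <= v i (y + xi).
Proof.
move=> d0; have L0 := curvature_lip_ge0 i.
have k2 : 0 <= k i ^+ 2 by rewrite exprn_ge0// ltW.
pose M := k i ^+ 2 * (C + Num.max 0 (b i)).
have M0 : 0 <= M by rewrite mulr_ge0 ?addr_ge0 ?(rs_C_ge0 s)// le_max lexx.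
have N0 : 0 <= 2 / d ^+ 2 + M / d.
  by apply: addr_ge0; apply: divr_ge0 => //; rewrite ?exprn_ge0 // ltW.
exists (curvature_lip i + (2 / d ^+ 2 + M / d)); first by rewrite addr_ge0.
move=> y xi yb.
have X0 : 0 <= `|xi| ^+ 3 by rewrite exprn_ge0.
have [xid|dxi] := leP `|xi| d.
  have [e e1 xie] := sign_norm xi.
  have := @taylor_aux i y e (-1) `|xi| (g i y) (curvature_lip i) (normr_ge0 _) L0.
  rewrite -xie real_normK ?num_real// => H.
  suff : forall t : R, 0 <= t <= `|xi| -> -1 * (e * (p i (y + e * t) - p i y)) <=
      t * (-1 * g i y + curvature_lip i * t).
    move=> /H.
    have : 0 <= (2 / d ^+ 2 + M / d) * `|xi| ^+ 3.
      by rewrite mulr_ge0.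
    by rewrite mulrDl; lra.
  move=> t /andP[t0 txi]; have td := le_trans txi xid; case: e1 => ->.
    have E : y + t - y = t by ring.
    rewrite !mul1r; have := @deriv_incr_ge i y (y + t) y (lexx _) _ _.
    rewrite lerDl E => /(_ t0 ltac:(lra)); lra.
  have E : y - (y - t) = t by ring.
  have := @deriv_incr_ge i (y - t) y y _ (lexx _) ltac:(lra).
  rewrite gerBl E => /(_ t0); rewrite !mulN1r opprB; lra.
have gM : g i y <= M.
  rewrite /regime_curvature.
  have h1 : 0 <= mu i * v (rev_ord i) y.
    by rewrite mulr_ge0 ?(ltW (mu_gt0 i))// (le_trans _ (rs_ge s _ _))// le_max lexx.
  have h2 : k i ^+ 2 * v i y <= M.
    rewrite ler_wpM2l// (le_trans (rs_le s _ _))// lerD2l.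
    by rewrite ge_max !le_max lexx/= (_ : y <= b i) ?orbT//; lra.
  lra.
have pb : `|p i y * xi| <= `|xi|.
  have /andP[p0 p1] := rs_deriv_itv s i y.
  by rewrite normrM ger0_norm// ler_piMl.
have vb : `|v i (y + xi) - v i y| <= `|xi|.
  by have := rs_dist i (y + xi) y; rewrite (_ : y + xi - y = xi)//; ring.
move: pb vb; rewrite !ler_norml => /andP[_ pb] /andP[vb _].
have h1 : 2 * `|xi| <= 2 / d ^+ 2 * `|xi| ^+ 3.
  rewrite -mulrA ler_wpM2l// [leRHS]mulrC ler_pdivlMr ?exprn_gt0//.
  by rewrite [leRHS]exprS ler_wpM2l// lerXn2r// ?nnegrE ltW.
have h2 : g i y / 2 * xi ^+ 2 <= M / d * `|xi| ^+ 3.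
  have xi2 : 0 <= xi ^+ 2 by rewrite exprn_even_ge0.
  rewrite (@le_trans _ _ (M * xi ^+ 2))//.
    rewrite ler_wpM2r//; lra.
  rewrite -mulrA ler_wpM2l// [leRHS]mulrC ler_pdivlMr//.
  by rewrite [leRHS]exprSr real_normK ?num_real// ler_wpM2l// ltW.
have : 0 <= curvature_lip i * `|xi| ^+ 3 by rewrite mulr_ge0.
rewrite (mulrDl (curvature_lip i)) (mulrDl (2 / d ^+ 2)).
by lra.
Qed.

End taylor.

(** * Gaussian moments and transition probabilities *)

Section normal_moments.
Context {R : realType}.
Variable s : R.
Hypothesis s_gt0 : 0 < s.
Notation mu := (@lebesgue_measure R).
Local Notation nu := (normal_prob (0 : R) s).
Local Notation phi := (normal_pdf (0 : R) s).
Local Notation E n := (`[- n%:R, n%:R]%classic : set R).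

Lemma integral_normal_prob_itv (a b : R) (f : R -> R) : continuous f ->
  (\int[nu]_(x in `[a, b]) (f x)%:E = \int[mu]_(x in `[a, b]) (f x * phi x)%:E)%E.
Proof.
move=> cf.
have mf : measurable_fun `[a, b] (EFin \o f) by exact: continuous_measurable_EFin.
have intf : nu.-integrable `[a, b] (EFin \o f).
  apply: measurable_bounded_integrable => //.
  - by rewrite (le_lt_trans (probability_le1 _ _))// ltry.
  - exact/measurable_EFinP.
  - have /compact_bounded[M [_ mrt]] :=
      continuous_compact (continuous_subspaceT cf) (@segment_compact _ a b).
    by exists M; split; rewrite ?num_real // => ? ? ? ?; exact: mrt.
rewrite -(Radon_Nikodym_change_of_variables (normal_prob_dominates 0 s))//=.
under [RHS]eq_integral do rewrite EFinM.
apply: ae_eq_integral => //.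
- apply: emeasurable_funM => //; apply: (measurable_int mu).
  apply: (integrableS _ _ (@subsetT _ _)) => //=.
  by apply: Radon_Nikodym_integrable; exact: normal_prob_dominates.
- apply: emeasurable_funM => //=; apply/measurableT_comp => //=.
  by apply/measurable_funTS; exact: measurable_normal_pdf.
- apply: ae_eqe_mul2l => /=.
  rewrite Radon_NikodymE//=; first exact: normal_prob_dominates.
  move=> abmu; case: cid => /= h [h1 h2 h3].
  apply: integral_ae_eq => //=.
  + exact: integrableS h2.
  + by apply/measurable_funTS/measurableT_comp =>//; exact: measurable_normal_pdf.
  + by move=> A _ mA; rewrite -h3.
Qed.

Lemma normal_pdf_expE (x : R) :
  phi x = normal_peak s * expR (- (2 * s ^+ 2)^-1 * (x * x)).
Proof.
rewrite normal_pdfE ?gt_eqF// /normal_fun subr0; congr (_ * expR _).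
by field; rewrite gt_eqF.
Qed.

Lemma is_derive_normal_pdf (x : R) : is_derive x 1 phi (- (x / s ^+ 2) * phi x).
Proof.
have d : is_derive x 1 (fun x : R => - (2 * s ^+ 2)^-1 * (x * x)) (- (x / s ^+ 2)).
  have := is_derive_scale (- (2 * s ^+ 2)^-1) (is_derive_mul (is_derive_id1 x) (is_derive_id1 x)).
  by move=> /is_derive_val; apply; field; rewrite gt_eqF.
rewrite (funext normal_pdf_expE).
have := is_derive_scale (normal_peak s) (is_derive_compose d (is_derive_expR _)).
by move=> /is_derive_val; apply; rewrite mulrCA.
Qed.

Lemma normal_pdf_even (x : R) : phi (- x) = phi x.
Proof. by rewrite normal_pdfE ?gt_eqF// /normal_fun !subr0 sqrrN. Qed.

(** Integration by parts against the Gaussian density: [g] is chosen so that [f - g] times the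
    density is an exact derivative. On [[-n, n]] all integrals are finite, and the boundary terms
    are examined as [n] grows. *)
Lemma normal_moment_itv (f g F : R -> R) (n : nat) : continuous f -> continuous g ->
  (forall x : R, is_derive x 1 F ((f x - g x) * phi x)) ->
  (\int[nu]_(x in E n) (f x)%:E =
   \int[nu]_(x in E n) (g x)%:E + (F n%:R - F (- n%:R))%:E)%E.
Proof.
move=> cf cg dF.
have int_itv (h : R -> R) : continuous h -> nu.-integrable (E n) (EFin \o h).
  move=> ch; apply: measurable_bounded_integrable => //.
  - by rewrite (le_lt_trans (probability_le1 _ _))// ltry.
  - by apply/measurable_EFinP; exact: continuous_measurable_EFin.
  - have /compact_bounded[M [_ mrt]] :=
      continuous_compact (continuous_subspaceT ch) (@segment_compact _ (- n%:R) n%:R).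
    by exists M; split; rewrite ?num_real // => ? ? ? ?; exact: mrt.
have cfg : continuous (fun x => f x - g x).
  by move=> x; apply: cvgB; [exact: cf|exact: cg].
have cphi : continuous phi by apply: continuous_normal_pdf; rewrite gt_eqF.
have H : (\int[nu]_(x in E n) (f x - g x)%:E = (F n%:R - F (- n%:R))%:E)%E.
  rewrite integral_normal_prob_itv//.
  case: n {int_itv} => [|n].
    by rewrite oppr0 set_itv1 integral_set1 subrr.
  rewrite EFinB; apply: (@continuous_FTC2 _ (fun x => (f x - g x) * phi x)).
  - by rewrite gtrN.
  - apply: continuous_subspaceT => x; apply: cvgM; [exact: cfg|exact: cphi].
  - split.
    + by move=> x _; case: (dF x).
    + exact/cvg_at_right_filter/(is_derive_continuous (dF _)).
    + exact/cvg_at_left_filter/(is_derive_continuous (dF _)).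
  - by move=> x _; rewrite derive1E; apply: derive_val.
rewrite -H -integralD//; [|exact: int_itv|exact: int_itv].
by apply: eq_integral => x _; rewrite -EFinD addrC subrK.
Qed.

Lemma itv_nat_bigcup : \bigcup_n E n = [set: R].
Proof.
rewrite eqEsubset; split => // x _; exists (Num.truncn `|x|).+1 => //=.
rewrite in_itv/= -ler_norml; apply/ltW; exact: truncnS_gt.
Qed.

Lemma itv_nat_nondecreasing : nondecreasing_seq (fun n => E n).
Proof.
move=> m n mn; rewrite subsetEset => x /=; rewrite !in_itv/= => /andP[h1 h2].
have : (m%:R : R) <= n%:R by rewrite ler_nat.
by move=> mn'; apply/andP; split; lra.
Qed.

Lemma cvg_normal_moment (f : R -> R) : continuous f -> (forall x, 0 <= f x) ->
  (\int[nu]_(x in E n) (f x)%:E @[n --> \oo] --> \int[nu]_x (f x)%:E)%E.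
Proof.
move=> cf f0.
rewrite -[X in _ --> integral _ X _]itv_nat_bigcup.
apply: ge0_nondecreasing_set_cvg_integral.
- exact: itv_nat_nondecreasing.
- by move=> n; exact: measurable_itv.
- by move=> n; exact: continuous_measurable_EFin.
- by move=> n x _; rewrite lee_fin.
Qed.

Lemma normal_moment2 : (\int[nu]_x (x ^+ 2)%:E = (s ^+ 2)%:E)%E.
Proof.
pose F (x : R) := - s ^+ 2 * (x * phi x).
have dF (x : R) : is_derive x 1 F ((x ^+ 2 - s ^+ 2) * phi x).
  have := is_derive_scale (- s ^+ 2) (is_derive_mul (is_derive_id1 x) (is_derive_normal_pdf x)).
  by move=> /is_derive_val; apply; field; by rewrite gt_eqF.
have c2 : continuous (fun x : R => x ^+ 2) by exact: exprn_continuous.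
have cs : continuous (fun _ : R => s ^+ 2) by move=> ?; exact: cvg_cst.
have h1 := cvg_normal_moment c2 (fun x => sqr_ge0 x).
have h2 := cvg_normal_moment cs (fun x => sqr_ge0 s).
have s2 : 0 < s ^+ 2 by rewrite exprn_gt0.
(* [exp y >= 1 + y] gives [n phi n = O(n / (1 + n^2))], which is compared with the harmonic
   sequence. *)
have bound n : n%:R * phi n%:R <= normal_peak s * (4 * s ^+ 2) * @harmonic R n.
  rewrite normal_pdf_expE mulrCA -[leRHS]mulrA ler_wpM2l ?normal_peak_ge0// /harmonic.
  rewrite ler_pdivlMr ?ltr0n// mulNr expRN mulrAC ler_pdivrMr ?expR_gt0//.
  set y := (2 * s ^+ 2)^-1 * (n%:R * n%:R).
  have yE : 2 * s ^+ 2 * y = n%:R * n%:R by rewrite /y mulVKf// gt_eqF// mulr_gt0.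
  have := expR_ge1Dx y => /(ler_wpM2l (ltW s2)).
  have nn : (n%:R : R) <= n%:R * n%:R.
    by rewrite -natrM ler_nat; case: (n) => // k; rewrite leq_pmull.
  rewrite -natr1; nra.
have Fn : (F n%:R - F (- n%:R)) @[n --> \oo] --> (0 : R).
  have -> : (fun n => F n%:R - F (- n%:R)) = (fun n => - (2 * s ^+ 2) * (n%:R * phi n%:R)).
    by apply/funext => n; rewrite /F normal_pdf_even; ring.
  suff h : n%:R * phi n%:R @[n --> \oo] --> (0 : R).
    by have := cvgM (cvg_cst (- (2 * s ^+ 2))) h; rewrite mulr0; apply.
  apply: (@squeeze_cvgr _ _ _ _ (cst 0) (fun n => normal_peak s * (4 * s ^+ 2) * @harmonic R n)).
  - by apply: nearW => n; apply/andP; split; [exact: mulr_ge0 (normal_pdf_ge0 _ _ _)|exact: bound].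
  - exact: cvg_cst.
  - rewrite -(mulr0 (normal_peak s * (4 * s ^+ 2))); apply: cvgM; first exact: cvg_cst.
    exact: cvg_harmonic.
have FnE : ((F n%:R - F (- n%:R))%:E @[n --> \oo] --> 0%:E)%E.
  by apply: cvg_EFin; [exact: nearW|exact: Fn].
have H : (\int[nu]_(x in E n) (x ^+ 2)%:E @[n --> \oo] -->
    \int[nu]_x (s ^+ 2)%:E + 0%:E)%E.
  rewrite (_ : (fun n => _) = (fun n => \int[nu]_(x in E n) (s ^+ 2)%:E +
      (F n%:R - F (- n%:R))%:E)%E); last first.
    by apply/funext => n; exact: normal_moment_itv.
  by apply: cvgeD; [exact: fin_num_adde_defl|exact: h2|exact: FnE].
have -> := cvg_unique (@ereal_hausdorff R) h1 H.
by rewrite adde0 integral_cst//= probability_setT mule1.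
Qed.

(** The error estimates use only an upper bound; as the boundary term [- 2 s^2 n^3 phi n] is
    nonpositive, it is dropped instead of being sent to its limit. *)
Lemma normal_moment4 : (\int[nu]_x (x ^+ 4)%:E <= (3 * s ^+ 4)%:E)%E.
Proof.
pose F (x : R) := - s ^+ 2 * (x * x * x * phi x).
have dF (x : R) : is_derive x 1 F ((x ^+ 4 - 3 * s ^+ 2 * x ^+ 2) * phi x).
  have d1 := is_derive_id1 x.
  have := is_derive_scale (- s ^+ 2) (is_derive_mul (is_derive_mul (is_derive_mul d1 d1) d1)
    (is_derive_normal_pdf x)).
  by move=> /is_derive_val; apply; field; by rewrite gt_eqF.
have c4 : continuous (fun x : R => x ^+ 4) by exact: exprn_continuous.
have c2 : continuous (fun x : R => 3 * s ^+ 2 * x ^+ 2).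
  by move=> x; apply: cvgM; [exact: cvg_cst|exact: exprn_continuous].
have h4 := cvg_normal_moment c4 (fun x => exprn_even_ge0 (n := 4) x isT).
have c20 (x : R) : 0 <= 3 * s ^+ 2 * x ^+ 2 by apply: mulr_ge0 (sqr_ge0 x); apply: mulr_ge0 (sqr_ge0 s).
have h2 := cvg_normal_moment c2 c20.
have -> : (3 * s ^+ 4)%:E = (\int[nu]_x (3 * s ^+ 2 * x ^+ 2)%:E)%E.
  under eq_integral do rewrite EFinM.
  rewrite ge0_integralZl//=.
  - by rewrite normal_moment2 -EFinM -mulrA -exprD.
  - by apply: continuous_measurable_EFin => //; exact: exprn_continuous.
  - by move=> x _; rewrite lee_fin sqr_ge0.
  - by rewrite lee_fin mulr_ge0 ?sqr_ge0.
apply: (lee_cvg_to h4 h2); apply: nearW => n.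
rewrite (normal_moment_itv _ c4 c2 dF) -[leRHS]adde0 leeD2l// lee_fin /F normal_pdf_even.
have : 0 <= (n%:R : R) ^+ 3 * phi n%:R by rewrite mulr_ge0 ?exprn_ge0 ?normal_pdf_ge0.
have : 0 <= s ^+ 2 by rewrite sqr_ge0.
rewrite !exprS !expr0 !mulr1; nra.
Qed.

(** Monotone convergence wants nonnegative integrands, so [x + |x|] and [|x|] are compared instead
    of [x] and 0. The boundary term vanishes because the density is even. *)
Lemma normal_moment1 : nu.-integrable setT (fun x : R => x%:E) /\
  (\int[nu]_x x%:E = 0)%E.
Proof.
have cid : continuous (fun x : R => x) by move=> x; exact: cvg_id.
have cn : continuous (fun x : R => `|x|) by move=> x; exact: norm_continuous.
have int : nu.-integrable setT (fun x : R => x%:E).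
  apply/integrableP; split; first exact: continuous_measurable_EFin.
  apply: (@le_lt_trans _ _ (\int[nu]_x (1 + x ^+ 2)%:E)%E).
    apply: ge0_le_integral => //.
    - by apply: measurableT_comp => //; exact: continuous_measurable_EFin.
    - apply: continuous_measurable_EFin => // x; apply: cvgD; first exact: cvg_cst.
      exact: exprn_continuous.
    - move=> x _ /=; rewrite lee_fin; have := sqr_ge0 (`|x| - 1).
      rewrite sqrrB1 real_normK ?num_real//; nra.
  under eq_integral do rewrite EFinD.
  rewrite ge0_integralD//=.
  - by rewrite normal_moment2 integral_cst//= probability_setT mule1 -EFinD ltry.
  - by move=> x _; rewrite lee_fin sqr_ge0.
  - by apply: continuous_measurable_EFin => //; exact: exprn_continuous.
split=> //.
pose F (x : R) := - s ^+ 2 * phi x.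
have dF (x : R) : is_derive x 1 F (((x + `|x|) - `|x|) * phi x).
  have := is_derive_scale (- s ^+ 2) (is_derive_normal_pdf x).
  by move=> /is_derive_val; apply; field; by rewrite gt_eqF.
have cxn : continuous (fun x : R => x + `|x|).
  by move=> x; apply: cvgD; [exact: cid|exact: cn].
have x0 (x : R) : 0 <= x + `|x| by rewrite -lerBlDr sub0r lerNl ler_normr lexx orbT.
have h1 := cvg_normal_moment cxn x0.
have h2 := cvg_normal_moment cn (fun x => normr_ge0 x).
have : (\int[nu]_(x in E n) (x + `|x|)%:E @[n --> \oo] --> \int[nu]_x `|x|%:E)%E.
  under eq_fun do rewrite (normal_moment_itv _ cxn cn dF) /F normal_pdf_even subrr adde0.
  exact: h2.
move=> /(cvg_unique _ h1)-/(_ (@ereal_hausdorff R)).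
under eq_integral do rewrite EFinD.
rewrite integralD//; last exact: integrable_norm.
have fn : (\int[nu]_x `|x|%:E)%E \is a fin_num.
  by apply: integrable_fin_num => //; exact: integrable_norm.
move=> H; have : (\int[nu]_x x%:E = \int[nu]_x x%:E + \int[nu]_x `|x|%:E - \int[nu]_x `|x|%:E)%E.
  by rewrite addeK.
by rewrite H subee.
Qed.

End normal_moments.

(** * Transition probabilities of the two-state chain *)

Section transition_probability.
Context {R : realType}.
Variable lambda : 'I_2 -> R.
Hypothesis lambda_gt0 : forall i, 0 < lambda i.
Let Lam : R := lambda ord0 + lambda ord_max.
Let Lam_gt0 : 0 < Lam. Proof. by rewrite addr_gt0. Qed.

Lemma ord2P (i : 'I_2) : i = ord0 \/ i = ord_max.
Proof. by case: i => -[|[|//]] h; [left|right]; apply: val_inj. Qed.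

Lemma rev_ord2_neq (i : 'I_2) : rev_ord i != i.
Proof. by have [->|->] := ord2P i. Qed.

Lemma ord2_neq (i j : 'I_2) : j != i -> j = rev_ord i.
Proof. by have [->|->] := ord2P i; have [->|->] := ord2P j => // _; apply: val_inj. Qed.

Lemma generator_matrix_exp n :
  generator_matrix lambda ^+ n.+1 = (- Lam) ^+ n *: generator_matrix lambda.
Proof.
have sq : generator_matrix lambda * generator_matrix lambda =
    (- Lam) *: generator_matrix lambda.
  apply/matrixP => i j; rewrite mxE [\sum_i _]big_ord_recr big_ord_recr big_ord0 /=.
  rewrite !mxE add0r /Lam (_ : widen_ord _ ord_max = ord0); last exact: val_inj.
  have [->|->] := ord2P i; have [->|->] := ord2P j; rewrite ?eqxx /=; ring.
elim: n => [|n IH]; first by rewrite expr0 scale1r expr1.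
by rewrite exprSr IH -scalerAl sq scalerA -exprSr.
Qed.

(** [Q^2 = - Lam Q] reduces the off-diagonal series of [exp (t Q)] to that of
    [1 - exp (- Lam t)]. *)
Lemma transition_rev (t : R) i :
  transition (generator_matrix lambda) t i (rev_ord i) =
  lambda i / Lam * (1 - expR (- (Lam * t))).
Proof.
rewrite /transition; set a := (fun n => _).
have aS n : series a n.+1 =
    lambda i / Lam * (1 - series (exp_coeff (- (Lam * t))) n.+1).
  elim: n => [|n IH].
    rewrite !seriesEnat /= !big_nat1 /a /exp_coeff /= !expr0 fact0 !divr1 subrr mulr0.
    by rewrite mxE eq_sym (negbTE (rev_ord2_neq i)) mulr0.
  rewrite seriesSr IH [in RHS]seriesSr /a generator_matrix_exp !mxE.
  rewrite (negbTE (rev_ord2_neq i)) /exp_coeff /= -(mulNr Lam) exprMn [(- Lam) ^+ n.+1]exprS.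
  have : (n.+1)`!%:R != 0 :> R by rewrite pnatr_eq0 -lt0n fact_gt0.
  move: (n.+1`!%:R) => F F0; field.
  by rewrite F0 gt_eqF.
apply: cvg_lim => //; rewrite -(cvg_shiftS (series a)).
rewrite (_ : (fun n => _) = (fun n => lambda i / Lam * (1 - series (exp_coeff (- (Lam * t))) n.+1)));
  last by apply/funext => n; rewrite aS.
apply: cvgM; first exact: cvg_cst.
apply: cvgB; first exact: cvg_cst.
rewrite (cvg_shiftS (series (exp_coeff (- (Lam * t))))).
exact: is_cvg_series_exp_coeff.
Qed.

Lemma transition_rev_ge0 (t : R) i : 0 <= t ->
  0 <= transition (generator_matrix lambda) t i (rev_ord i).
Proof.
move=> t0; rewrite transition_rev mulr_ge0 ?divr_ge0 ?(ltW (lambda_gt0 _)) ?(ltW Lam_gt0)//.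
by rewrite subr_ge0 -[leRHS]expR0 ler_expR oppr_le0 mulr_ge0// ltW.
Qed.

Lemma transition_rev_le (t : R) i :
  transition (generator_matrix lambda) t i (rev_ord i) <= lambda i * t.
Proof.
rewrite transition_rev -mulrA ler_pM2l// ler_pdivrMl//.
have := expR_ge1Dx (- (Lam * t)); lra.
Qed.

Lemma transition_rev_ge (t : R) i : 0 <= t ->
  lambda i * t - lambda i * Lam * t ^+ 2 <=
  transition (generator_matrix lambda) t i (rev_ord i).
Proof.
move=> t0; rewrite transition_rev -!mulrA -mulrBr ler_pM2l// ler_pdivlMl//.
set x := Lam * t.
have x0 : 0 <= x by rewrite mulr_ge0// ltW.
rewrite (_ : Lam * (t - Lam * t ^+ 2) = x - x ^+ 2); last by rewrite /x; ring.
(* [(1 - x + x^2) (1 + x) = 1 + x^3 >= 1], and [1 + x <= exp x]. *)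
have : expR (- x) <= 1 - x + x ^+ 2.
  rewrite expRN -[leLHS]mul1r ler_pdivrMr ?expR_gt0//.
  have h := expR_ge1Dx x.
  have q : 0 < 1 - x + x ^+ 2 by nra.
  rewrite (le_trans _ (ler_wpM2l (ltW q) h))//.
  have : 0 <= x ^+ 3 by rewrite exprn_ge0.
  rewrite !exprS expr0; nra.
lra.
Qed.

End transition_probability.

(** * Random variables, filtrations and independence *)

Section sig_measurable.
Context {T : pointedType} {R : realType}.
Implicit Types (G : set_system T) (Z W : T -> R).

(** Filtrations are set systems, so measurability is phrased by preimages; [sig_measurableP] passes
    to the measurable type generated by [G], where the closure properties are available. *)
Definition sig_measurable G Z := forall C : set R, measurable C -> <<s G >> (Z @^-1` C).

Lemma sig_measurableP G Z : sig_measurable G Z <->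
  measurable_fun [set: g_sigma_algebraType G] (Z : g_sigma_algebraType G -> R).
Proof.
split=> [h _ C mC|h C mC]; first by rewrite setTI; exact: h.
by have := h measurableT C mC; rewrite setTI.
Qed.

Lemma sig_measurable_cst G (r : R) : sig_measurable G (fun=> r).
Proof. by apply/sig_measurableP; exact: measurable_cst. Qed.

Lemma sig_measurable_comp G (h : R -> R) Z : measurable_fun setT h ->
  sig_measurable G Z -> sig_measurable G (fun w => h (Z w)).
Proof. by move=> mh /sig_measurableP mZ; apply/sig_measurableP; exact: measurableT_comp. Qed.

Lemma sig_measurable_add G Z W : sig_measurable G Z -> sig_measurable G W ->
  sig_measurable G (fun w => Z w + W w).
Proof.
move=> /sig_measurableP mZ /sig_measurableP mW; apply/sig_measurableP.
exact: measurable_funD.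
Qed.

Lemma sig_measurable_sub G Z W : sig_measurable G Z -> sig_measurable G W ->
  sig_measurable G (fun w => Z w - W w).
Proof.
move=> /sig_measurableP mZ /sig_measurableP mW; apply/sig_measurableP.
exact: measurable_funB.
Qed.

Lemma sig_measurable_mul G Z W : sig_measurable G Z -> sig_measurable G W ->
  sig_measurable G (fun w => Z w * W w).
Proof.
move=> /sig_measurableP mZ /sig_measurableP mW; apply/sig_measurableP.
exact: measurable_funM.
Qed.

Lemma sig_measurable_indic G (A : set T) : <<s G >> A -> sig_measurable G (\1_A : T -> R).
Proof.
move=> mA; apply/sig_measurableP.
exact: (@measurable_indic _ (g_sigma_algebraType G) R setT A mA).
Qed.

Lemma sub_sig_measurable G H Z : <<s G >> `<=` <<s H >> ->
  sig_measurable G Z -> sig_measurable H Z.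
Proof. by move=> GH mZ C mC; apply: GH; exact: mZ. Qed.

End sig_measurable.

Section expectation.
Context {d : measure_display} {T : measurableType d} {R : realType}.
Variable P : probability T R.
Implicit Types (Z W : T -> R).

Definition L1 Z := P.-integrable setT (EFin \o Z).
Definition Ex Z : R := \int[P]_w Z w.

Lemma L1_measurable Z : L1 Z -> measurable_fun setT Z.
Proof. by move=> /measurable_int /measurable_EFinP. Qed.

Lemma L1_cst (r : R) : L1 (fun=> r).
Proof. exact: finite_measure_integrable_cst. Qed.

Lemma L1_add Z W : L1 Z -> L1 W -> L1 (fun w => Z w + W w).
Proof. by move=> iZ iW; have := integrableD measurableT iZ iW. Qed.

Lemma L1_scale (r : R) Z : L1 Z -> L1 (fun w => r * Z w).
Proof. by move=> iZ; have := integrableZl measurableT r iZ. Qed.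

Lemma L1_sub Z W : L1 Z -> L1 W -> L1 (fun w => Z w - W w).
Proof. by move=> iZ iW; have := integrableB measurableT iZ iW. Qed.

Lemma L1_le Z W : measurable_fun setT Z -> (forall w, `|Z w| <= W w) -> L1 W -> L1 Z.
Proof.
move=> mZ ZW; apply: le_integrable => //; first exact/measurable_EFinP.
by move=> w _ /=; rewrite lee_fin (le_trans (ZW w))// ler_norm.
Qed.

Lemma L1_bounded Z (M : R) : measurable_fun setT Z -> (forall w, `|Z w| <= M) -> L1 Z.
Proof. by move=> mZ ZM; apply: (L1_le mZ ZM); exact: L1_cst. Qed.

Lemma L1_norm Z : L1 Z -> L1 (fun w => `|Z w|).
Proof. exact: integrable_norm. Qed.

Lemma L1_bounded_mul Z W (M : R) : measurable_fun setT Z -> (forall w, `|Z w| <= M) ->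
  L1 W -> L1 (fun w => Z w * W w).
Proof.
move=> mZ ZM iW; apply: (@L1_le _ (fun w => M * `|W w|)).
- by apply: measurable_funM => //; exact: L1_measurable.
- by move=> w; rewrite normrM ler_wpM2r.
- exact/L1_scale/L1_norm.
Qed.

Lemma L1_indic_mul (A : set T) W : measurable A -> L1 W -> L1 (fun w => \1_A w * W w).
Proof.
move=> mA; apply: (@L1_bounded_mul _ _ 1); first exact: measurable_indic.
by move=> w; rewrite indicE; case: (_ \in _); rewrite ?normr1 ?normr0.
Qed.

Lemma L1_indic (A : set T) : measurable A -> L1 (\1_A).
Proof.
move=> mA; apply: (@L1_bounded _ 1); first exact: measurable_indic.
by move=> w; rewrite indicE; case: (_ \in _); rewrite ?normr1 ?normr0.
Qed.

Lemma L1_sum (I : Type) (s : seq I) (h : I -> T -> R) : (forall i, L1 (h i)) ->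
  L1 (fun w => \sum_(i <- s) h i w).
Proof.
move=> ih; elim: s => [|i s IH].
  rewrite (_ : (fun _ => _) = fun=> 0); first exact: L1_cst.
  by apply/funext => w; rewrite big_nil.
rewrite (_ : (fun _ => _) = fun w => h i w + \sum_(i <- s) h i w); first exact: L1_add.
by apply/funext => w; rewrite big_cons.
Qed.

Lemma L1_mul_sq Z W : measurable_fun setT Z -> measurable_fun setT W ->
  L1 (fun w => Z w ^+ 2) -> L1 (fun w => W w ^+ 2) -> L1 (fun w => Z w * W w).
Proof.
move=> mZ mW iZ iW; apply: (@L1_le _ (fun w => Z w ^+ 2 + W w ^+ 2)).
- exact: measurable_funM.
- move=> w; rewrite normrM -(real_normK (num_real (Z w))) -(real_normK (num_real (W w))).
  by have := sqr_ge0 (`|Z w| - `|W w|); have := sqr_ge0 (`|Z w| + `|W w|); nra.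
- exact: L1_add.
Qed.

Lemma L1_of_sq Z : measurable_fun setT Z -> L1 (fun w => Z w ^+ 2) -> L1 Z.
Proof.
move=> mZ iZ; apply: (@L1_le _ (fun w => 1 + Z w ^+ 2)) => //.
- move=> w; rewrite -(real_normK (num_real (Z w))).
  by have := sqr_ge0 (`|Z w| - 1); nra.
- by apply: L1_add => //; exact: L1_cst.
Qed.

Lemma ExE Z : L1 Z -> (\int[P]_w (Z w)%:E = (Ex Z)%:E)%E.
Proof. by move=> iZ; rewrite /Ex /Rintegral fineK//; exact: integrable_fin_num. Qed.

Lemma Ex_cst (r : R) : Ex (fun=> r) = r.
Proof.
transitivity (r * fine (P setT)); first exact: Rintegral_cst.
by rewrite probability_setT mulr1.
Qed.

Lemma Ex_add Z W : L1 Z -> L1 W -> Ex (fun w => Z w + W w) = Ex Z + Ex W.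
Proof. by move=> iZ iW; rewrite /Ex RintegralD. Qed.

Lemma Ex_sub Z W : L1 Z -> L1 W -> Ex (fun w => Z w - W w) = Ex Z - Ex W.
Proof. by move=> iZ iW; rewrite /Ex RintegralB. Qed.

Lemma Ex_scale (r : R) Z : L1 Z -> Ex (fun w => r * Z w) = r * Ex Z.
Proof. by move=> iZ; rewrite /Ex RintegralZl. Qed.

Lemma Ex_le Z W : L1 Z -> L1 W -> (forall w, Z w <= W w) -> Ex Z <= Ex W.
Proof. by move=> iZ iW ZW; apply: le_Rintegral. Qed.

Lemma Ex_ge0 Z : (forall w, 0 <= Z w) -> 0 <= Ex Z.
Proof. by move=> Z0; apply: Rintegral_ge0. Qed.

Lemma eq_Ex Z W : Z =1 W -> Ex Z = Ex W.
Proof. by move=> /funext ->. Qed.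

Lemma Ex_indic (A : set T) : measurable A -> Ex (\1_A) = fine (P A).
Proof. by move=> mA; rewrite /Ex /Rintegral integral_indic// setIT. Qed.

Lemma Ex_sum (I : Type) (s : seq I) (h : I -> T -> R) : (forall i, L1 (h i)) ->
  Ex (fun w => \sum_(i <- s) h i w) = \sum_(i <- s) Ex (h i).
Proof.
move=> ih; elim: s => [|i s IH].
  rewrite big_nil; transitivity (Ex (fun=> 0)); last exact: Ex_cst.
  by apply: eq_Ex => w; rewrite big_nil.
rewrite big_cons -IH -Ex_add//; last exact: L1_sum.
by apply: eq_Ex => w; rewrite big_cons.
Qed.

Lemma Ex_norm Z : L1 Z -> `|Ex Z| <= Ex (fun w => `|Z w|).
Proof. by move=> iZ; apply: le_normr_Rintegral. Qed.

(** From [E (|Z| - m)^2 >= 0] with [m = E |Z|]. *)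
Lemma Ex_sq_le Z : measurable_fun setT Z -> L1 (fun w => Z w ^+ 2) ->
  Ex (fun w => `|Z w|) <= Num.sqrt (Ex (fun w => Z w ^+ 2)).
Proof.
move=> mZ iZ; have iZ1 := L1_norm (L1_of_sq mZ iZ).
set m := Ex (fun w => `|Z w|).
have m0 : 0 <= m by exact: Ex_ge0.
rewrite -(ger0_norm m0) -sqrtr_sqr ler_wsqrtr//.
have : 0 <= Ex (fun w => Z w ^+ 2 - (2 * m) * `|Z w| + m ^+ 2).
  apply: Ex_ge0 => w; have := sqr_ge0 (`|Z w| - m).
  by rewrite sqrrB real_normK ?num_real//; lra.
rewrite Ex_add; [|by apply: L1_sub => //; exact: L1_scale|exact: L1_cst].
rewrite Ex_sub//; last exact: L1_scale.
rewrite Ex_scale// Ex_cst -/m; lra.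
Qed.

(** Independence says that the joint law is the product of the marginal laws; Fubini's theorem
    concludes. *)
Lemma indep_Ex_mul Z W :
  (forall C D, measurable C -> measurable D ->
    P (Z @^-1` C `&` W @^-1` D) = (P (Z @^-1` C) * P (W @^-1` D))%E) ->
  L1 Z -> L1 W -> L1 (fun w => Z w * W w) /\ Ex (fun w => Z w * W w) = Ex Z * Ex W.
Proof.
move=> ind iZ iW.
have mZ := L1_measurable iZ; have mW := L1_measurable iW.
have mZW : measurable_fun setT (fun w => (Z w, W w)) by exact: measurable_fun_pair.
pose Zm : {mfun T >-> R} := HB.pack Z (isMeasurableFun.Build _ _ _ _ _ mZ).
pose Wm : {mfun T >-> R} := HB.pack W (isMeasurableFun.Build _ _ _ _ _ mW).
pose ZWm : {mfun T >-> (R * R)%type} :=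
  HB.pack (fun w => (Z w, W w)) (isMeasurableFun.Build _ _ _ _ _ mZW).
pose mu := distribution P Zm.
pose nu := distribution P Wm.
have E X : measurable X -> (mu \x nu)%E X = distribution P ZWm X.
  apply: product_measure_unique => A B mA mB.
  by rewrite -ind.
have mmul : measurable_fun setT (fun x : R * R => (x.1 * x.2)%:E).
  by apply/measurable_EFinP; exact: measurable_funM.
have mid : measurable_fun [set: R] (fun x : R => x%:E).
  by apply/measurable_EFinP; exact: measurable_id.
have mabs : measurable_fun [set: R] (fun x : R => `|x%:E|%E) by exact: measurableT_comp.
have nZ : (\int[mu]_x `|x%:E| = \int[P]_w `|(Z w)%:E|)%E.
  by rewrite ge0_integral_distribution.
have nW : (\int[nu]_x `|x%:E| = \int[P]_w `|(W w)%:E|)%E.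
  by rewrite ge0_integral_distribution.
have imul : (mu \x nu)%E.-integrable setT (fun x : R * R => (x.1 * x.2)%:E).
  apply/integrable12ltyP => //=.
  under eq_integral.
    move=> x _; under eq_integral do rewrite /= normrM EFinM.
    rewrite ge0_integralZl//.
    over.
  rewrite ge0_integralZr//; last exact: integral_ge0.
  rewrite nZ nW.
  move: iZ iW => /integrableP[_ iZ] /integrableP[_ iW].
  by apply: lte_mul_pinfty; rewrite ?ge0_fin_numE// ?integral_ge0.
have iZW : L1 (fun w => Z w * W w).
  apply/integrableP; split; first by apply/measurable_EFinP; exact: measurable_funM.
  move: (imul) => /integrableP[_]; rewrite (eq_measure_integral (distribution P ZWm)).
    rewrite ge0_integral_distribution//; exact: measurableT_comp.
  by move=> A mA _; exact: E.
split=> //; apply: EFin_inj; rewrite EFinM -!ExE//.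
have <- : (\int[distribution P ZWm]_x (x.1 * x.2)%:E = \int[P]_w (Z w * W w)%:E)%E.
  by rewrite integral_distribution.
rewrite (eq_measure_integral (mu \x nu)%E); last by move=> A mA _; exact/esym/E.
rewrite -integral12_prod_meas1//= /fubini_F.
have iWnu : nu.-integrable setT (fun x : R => x%:E).
  apply/integrableP; split; first by apply/measurable_EFinP; exact: measurable_id.
  by rewrite nW; move: iW => /integrableP[].
have iZmu : mu.-integrable setT (fun x : R => x%:E).
  apply/integrableP; split; first by apply/measurable_EFinP; exact: measurable_id.
  by rewrite nZ; move: iZ => /integrableP[].
have EW : (\int[nu]_x x%:E = (Ex W)%:E)%E.
  by rewrite -ExE// integral_distribution.
under eq_integral.
  move=> x _; under eq_integral do rewrite /= EFinM.
  rewrite integralZl//= EW muleC.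
  over.
rewrite integralZl//= (ExE iW) muleC; congr (_ * _)%E.
by rewrite integral_distribution.
Qed.

Lemma ge0_integral_pushforward_mrestr (Z : T -> R) (A : set T) (mA : measurable A)
  (mZ : measurable_fun setT Z) :
  (\int[P]_(w in A) `|(Z w)%:E| = \int[pushforward (mrestr P mA) Z]_x `|x%:E|)%E.
Proof.
pose Zm : {mfun T >-> R} := HB.pack Z (isMeasurableFun.Build _ _ _ _ _ mZ).
have mid : measurable_fun [set: R] (fun x : R => x%:E).
  by apply/measurable_EFinP; exact: measurable_id.
have mabs : measurable_fun [set: R] (fun x : R => `|x%:E|%E) by exact: measurableT_comp.
have mabsZ : measurable_fun setT (fun w => `|(Z w)%:E|%E).
  by apply: measurableT_comp => //; exact/measurable_EFinP.
rewrite (ge0_integral_pushforward (phi := Z))//.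
rewrite preimage_setT.
rewrite (@ge0_negligible_integral _ _ _ _ _ (~` A))//=; last 2 first.
  exact: measurableC.
  by rewrite /mrestr setICl measure0.
rewrite setTD setCK; apply: eq_measure_integral => B mB BA.
by rewrite /= /mrestr setIidl.
Qed.

(** The laws of [Z] restricted to [D] and to [D'] are proportional measures. *)
Lemma ge0_cond_integral Z (D D' : set T) (k : R) : 0 <= k -> measurable D -> measurable D' ->
  measurable_fun setT Z ->
  (forall C, measurable C -> P (Z @^-1` C `&` D) = (k%:E * P (Z @^-1` C `&` D'))%E) ->
  (\int[P]_(w in D) `|(Z w)%:E| = k%:E * \int[P]_(w in D') `|(Z w)%:E|)%E.
Proof.
move=> k0 mD mD' mZ h.
pose Zm : {mfun T >-> R} := HB.pack Z (isMeasurableFun.Build _ _ _ _ _ mZ).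
rewrite (ge0_integral_pushforward_mrestr mD mZ) (ge0_integral_pushforward_mrestr mD' mZ).
have mid : measurable_fun [set: R] (fun x : R => x%:E).
  by apply/measurable_EFinP; exact: measurable_id.
have mabs : measurable_fun [set: R] (fun x : R => `|x%:E|%E) by exact: measurableT_comp.
rewrite -(@ge0_integral_mscale _ _ _ (pushforward (mrestr P mD') Zm) _ _ (NngNum k0))//.
by apply: eq_measure_integral => C mC _; rewrite /= /mscale /pushforward /mrestr /= h.
Qed.

(** Replaces conditional expectation: for [D = {eps_s = i, eps_t = j}], [D' = {eps_s = i}] and [k]
    the transition probability, it is the Markov property for functions of the past. Adding [M]
    reduces it to nonnegative [Z]. *)
Lemma cond_Ex_mul Z (D D' : set T) (k M : R) : 0 <= k -> measurable D -> measurable D' ->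
  measurable_fun setT Z -> (forall w, `|Z w| <= M) ->
  (forall C, measurable C -> P (Z @^-1` C `&` D) = (k%:E * P (Z @^-1` C `&` D'))%E) ->
  Ex (fun w => \1_D w * Z w) = k * Ex (fun w => \1_D' w * Z w).
Proof.
move=> k0 mD mD' mZ ZM h.
have pos (W : T -> R) : measurable_fun setT W -> (forall w, 0 <= W w) -> L1 W ->
    (forall C, measurable C -> P (W @^-1` C `&` D) = (k%:E * P (W @^-1` C `&` D'))%E) ->
    Ex (fun w => \1_D w * W w) = k * Ex (fun w => \1_D' w * W w).
  move=> mW W0 iW hW; apply: EFin_inj; rewrite EFinM -!ExE; [|exact: L1_indic_mul..].
  have E (A : set T) : measurable A ->
      (\int[P]_w (\1_A w * W w)%:E = \int[P]_(w in A) `|(W w)%:E|)%E.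
    move=> mA; rewrite [RHS]integral_mkcond; apply: eq_integral => w _.
    rewrite patchE indicE; case: ifP => _; rewrite ?mul0r// mul1r gee0_abs//.
    by rewrite lee_fin.
  by rewrite (E D)// (E D')//; exact: ge0_cond_integral.
have iZ : L1 Z by exact: L1_bounded ZM.
have M0 w : 0 <= Z w + M by have := ZM w; rewrite ler_norml; lra.
have mZM : measurable_fun setT (fun w => Z w + M) by exact: measurable_funD.
have h1 := pos _ mZM M0 (L1_add iZ (L1_cst M)).
have h2 : Ex (fun w => \1_D w * M) = k * Ex (fun w => \1_D' w * M).
  have E (A : set T) : measurable A -> Ex (fun w => \1_A w * M) = M * fine (P A).
    by move=> mA; rewrite -Ex_indic// -Ex_scale ?L1_indic//; apply: eq_Ex => w; rewrite mulrC.
  rewrite !E//; have := h setT measurableT; rewrite preimage_setT !setTI => ->.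
  by rewrite fineM ?fin_num_measure//= mulrCA.
have split (A : set T) : measurable A ->
    Ex (fun w => \1_A w * (Z w + M)) = Ex (fun w => \1_A w * Z w) + Ex (fun w => \1_A w * M).
  move=> mA; rewrite -Ex_add; [|exact: L1_indic_mul|exact/L1_indic_mul/L1_cst].
  by apply: eq_Ex => w; rewrite mulrDr.
move: h1; rewrite !split// mulrDr h2 => H; apply: (addIr _ (H _)) => C mC.
rewrite (_ : (fun w => Z w + M) @^-1` C = Z @^-1` ((fun x => x + M) @^-1` C))//.
apply: h; rewrite -[X in measurable X]setTI.
have mf : measurable_fun [set: R] (fun x : R => x + M) by exact: measurable_funD.
exact: mf.
Qed.

(* A pi-lambda argument. *)
Lemma dynkin_proportional (G : set_system T) (D D' : set T) (k : R) :
  setI_closed G -> G `<=` measurable -> 0 <= k ->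
  measurable D -> measurable D' -> P D = (k%:E * P D')%E ->
  (forall A, G A -> P (A `&` D) = (k%:E * P (A `&` D'))%E) ->
  forall A, <<s G >> A -> P (A `&` D) = (k%:E * P (A `&` D'))%E.
Proof.
move=> GI Gm k0 mD mD' kD kG.
have fin A : measurable A -> P A \is a fin_num by exact: fin_num_measure.
rewrite -(setI_closed_g_dynkin_g_sigma_algebra GI).
pose H := [set A | measurable A /\ P (A `&` D) = (k%:E * P (A `&` D'))%E].
suff : <<d G >> `<=` H by move=> h A /h[].
apply: smallest_sub; last by move=> A GA; split; [exact: Gm|exact: kG].
split.
- by split; rewrite ?setTI.
- move=> A [mA kA]; split; first exact: measurableC.
  have E (C : set T) : measurable C -> P (~` A `&` C) = (P C - P (A `&` C))%E.
    move=> mC; rewrite setIC -setDE measureD//; first by rewrite setIC.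
    by rewrite ltey_eq fin.
  rewrite !E// kD kA muleBr//; apply: fin_num_adde_defl; rewrite fin_numN fin//.
  exact: measurableI.
- move=> F tF HF; split; first by apply: bigcupT_measurable => n; have [] := HF n.
  have mF n : measurable (F n) by have [] := HF n.
  have E (C : set T) : measurable C ->
      P (\bigcup_n F n `&` C) = (\sum_(n <oo) P (F n `&` C))%E.
    move=> mC; rewrite setI_bigcupl measure_semi_bigcup//.
    - by move=> n; exact: measurableI.
    - exact: trivIset_setIr.
    - by apply: bigcupT_measurable => n; exact: measurableI.
  rewrite !E// -nneseriesZl//.
  by apply: eq_eseriesr => n _; have [] := HF n.
Qed.

End expectation.

Section generated.
Context {T : pointedType}.
Implicit Types (G : set_system T).

Lemma sigmaI G (A C : set T) : <<s G >> A -> <<s G >> C -> <<s G >> (A `&` C).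
Proof.
by have /sigma_algebraP[//|_ _ _] := smallest_sigma_algebra setT G; apply.
Qed.

Lemma sigmaT G : <<s G >> [set: T].
Proof. by have /sigma_algebraP[//|] := smallest_sigma_algebra setT G. Qed.

Lemma sigmaC G (A : set T) : <<s G >> A -> <<s G >> (~` A).
Proof. by move=> GA; rewrite -setTD; exact: sigma_algebraCD. Qed.

Lemma sigmaD G (A C : set T) : <<s G >> A -> <<s G >> C -> <<s G >> (A `\` C).
Proof. by move=> GA GC; rewrite setDE; exact: (sigmaI GA (sigmaC GC)). Qed.

End generated.

(** * Events of the Brownian motion and of the chain, up to null sets *)

Section augmented.
Context {d : measure_display} {T : measurableType d} {R : realType}.
Variable P : probability T R.
Hypothesis P_complete : measure_is_complete P.

Lemma sub_measurable_sigma (G : set_system T) : G `<=` measurable -> <<s G >> `<=` measurable.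
Proof. by apply: smallest_sub; exact: sigma_algebra_measurable. Qed.

Lemma eq_mod_negligible (A C D : set T) : measurable A -> measurable C -> measurable D ->
  P.-negligible (A `\` C) -> P.-negligible (C `\` A) -> P (A `&` D) = P (C `&` D).
Proof.
have H (A' C' : set T) : measurable A' -> measurable C' -> measurable D ->
    P.-negligible (A' `\` C') -> (P (A' `&` D) <= P (C' `&` D))%E.
  move=> mA mC mD N; have mN : measurable (A' `\` C') by exact: measurableD.
  have N0 : P (A' `\` C') = 0%E by apply/negligibleP.
  rewrite (@le_trans _ _ (P ((C' `&` D) `|` (A' `\` C')))%E)//.
    apply: le_measure; rewrite ?inE; [exact: measurableI| |].
      by apply: measurableU => //; exact: measurableI.
    move=> w [Aw Dw]; have [Cw|Cw] := pselect (C' w); first by left.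
    by right.
  apply: le_trans (measureU2 _ (measurableI _ _ mC mD) mN) _.
  by rewrite -[leRHS]adde0; apply: leeD => //; rewrite le_eqVlt; apply/orP; left; exact/eqP.
move=> mA mC mD N1 N2; apply/eqP; rewrite eq_le.
by rewrite (H A C)// (H C A).
Qed.

(** The sets that agree, up to a null set, with an intersection of an event of [B] and an event of
    [E] are closed under intersection and generate the sigma-algebra, so the pi-lambda argument
    applies to them. *)
Lemma joint_proportional (B E : set_system T) (D D' : set T) (k : R) :
  <<s B >> `<=` measurable -> <<s E >> `<=` measurable -> 0 <= k ->
  measurable D -> measurable D' ->
  (forall b e, <<s B >> b -> <<s E >> e ->
    P (b `&` e `&` D) = (k%:E * P (b `&` e `&` D'))%E) ->
  forall A, <<s <<s B >> `|` <<s E >> `|` P.-negligible >> A ->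
    measurable A /\ P (A `&` D) = (k%:E * P (A `&` D'))%E.
Proof.
move=> mB mE k0 mD mD' h A GA.
split.
  apply: sub_measurable_sigma GA => X [[BX|EX]|NX]; [exact: mB|exact: mE|exact: P_complete].
pose G := [set A | measurable A /\ exists b e, [/\ <<s B >> b, <<s E >> e,
  P.-negligible (A `\` (b `&` e)) & P.-negligible ((b `&` e) `\` A)]].
have N0 : P.-negligible (set0 : set T) by exact: negligible_set0.
have sub : <<s <<s B >> `|` <<s E >> `|` P.-negligible >> `<=` <<s G >>.
  apply: sub_sigma_algebra2 => X [[BX|EX]|NX].
  - split; first exact: mB.
    by exists X, setT; split => //; [exact: sigmaT|rewrite setIT setDv|rewrite setIT setDv].
  - split; first exact: mE.
    by exists setT, X; split => //; [exact: sigmaT|rewrite setTI setDv|rewrite setTI setDv].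
  - split; first exact: P_complete.
    exists set0, setT; split; [exact: sigma_algebra0|exact: sigmaT| |].
      by rewrite set0I setD0.
    by rewrite set0I set0D.
apply: (dynkin_proportional (G := G)) => //.
- move=> X Y [mX [b [e [Bb Ee N1 N2]]]] [mY [b' [e' [Bb' Ee' N1' N2']]]].
  split; first exact: measurableI.
  exists (b `&` b'), (e `&` e'); split; [exact: sigmaI|exact: sigmaI| |].
    apply: negligibleS (negligibleU N1 N1') => w [[Xw Yw] nw].
    have [bw|bw] := pselect ((b `&` e) w); last by left.
    by right; split=> // -[b'w e'w]; apply: nw; case: bw.
  apply: negligibleS (negligibleU N2 N2') => w [[[bw b'w] [ew e'w]] nw].
  have [Xw|Xw] := pselect (X w); last by left.
  by right; split=> // Yw; apply: nw.
- by move=> X [].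
- by have := h setT setT (@sigmaT _ _) (@sigmaT _ _); rewrite !setTI.
- move=> X [mX [b [e [Bb Ee N1 N2]]]].
  have mbe : measurable (b `&` e) by apply: measurableI; [exact: mB|exact: mE].
  by rewrite (eq_mod_negligible mX mbe mD N1 N2) (eq_mod_negligible mX mbe mD' N1 N2) h.
- exact: sub.
Qed.

End augmented.

Section brownian_and_chain.
Context {d : measure_display} {T : measurableType d} {R : realType}.
Variables (P : probability T R) (B : R -> T -> R) (eps : R -> T -> 'I_2) (lambda : 'I_2 -> R).
Hypotheses (P_complete : measure_is_complete P) (lambda_gt0 : forall i, 0 < lambda i)
  (B_bm : brownian_motion P B)
  (eps_mc : markov_chain P (generator_matrix lambda) eps)
  (B_eps_indep : independent_systems P
     (process_sigma measurable B `[0, +oo[) (process_sigma setT eps `[0, +oo[)).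

Local Notation Bev s := (process_events measurable B `[0, s]).
Local Notation Eev s := (process_events setT eps `[0, s]).
Local Notation Einf := (process_events setT eps `[0, +oo[).

(** The Brownian past together with the whole path of the chain, future included: increments of [B]
    after [s] are still independent of it. *)
Definition enlarged (s : R) : set_system T :=
  <<s Bev s >> `|` <<s Einf >> `|` P.-negligible.
(** The augmented filtration with its generators grouped into two sigma-algebras, the form in which
    [joint_proportional] takes them. *)
Definition past (s : R) : set_system T :=
  <<s Bev s >> `|` <<s Eev s >> `|` P.-negligible.

Lemma process_events_sub {U : Type} (G : set_system U) (Y : R -> T -> U) (I J : set R) :
  I `<=` J -> <<s process_events G Y I >> `<=` <<s process_events G Y J >>.
Proof.
move=> IJ; apply: sub_sigma_algebra2 => A [s Is [C GC ->]].
by exists s; [exact: IJ|exists C].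
Qed.

Lemma itv0_sub (s t : R) : s <= t -> `[0, s] `<=` `[0, t].
Proof. by move=> st x /=; rewrite !in_itv/= => /andP[-> /le_trans->]. Qed.

Lemma itv0_suby (s : R) : `[0, s] `<=` `[0, +oo[.
Proof. by move=> x /=; rewrite !in_itv/= => /andP[->]. Qed.

Lemma augmented_past s : augmented_filtration P B eps s `<=` <<s past s >>.
Proof.
apply: sub_sigma_algebra2 => A [[BA|EA]|NA].
- by left; left; exact: sub_sigma_algebra.
- by left; right; exact: sub_sigma_algebra.
- by right.
Qed.

Lemma past_enlarged s : <<s past s >> `<=` <<s enlarged s >>.
Proof.
apply: sub_sigma_algebra2 => A [[BA|EA]|NA]; [by left; left| |by right].
by left; right; apply: process_events_sub EA; exact: itv0_suby.
Qed.

Lemma augmented_enlarged s : augmented_filtration P B eps s `<=` <<s enlarged s >>.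
Proof. by apply: subset_trans (@augmented_past s) _; exact: past_enlarged. Qed.

Lemma augmented_mono s t : s <= t ->
  augmented_filtration P B eps s `<=` augmented_filtration P B eps t.
Proof.
move=> st; apply: sub_sigma_algebra2 => A [[[r Ir [C GC ->]]|[r Ir [C GC ->]]]|NA].
- by left; left; exists r; [exact: itv0_sub Ir|exists C].
- by left; right; exists r; [exact: itv0_sub Ir|exists C].
- by right.
Qed.

Lemma enlarged_mono s t : s <= t -> <<s enlarged s >> `<=` <<s enlarged t >>.
Proof.
move=> st; apply: sub_sigma_algebra2 => A [[BA|EA]|NA]; [|by left; right|by right].
by left; left; apply: process_events_sub BA; exact: itv0_sub.
Qed.

Lemma Bev_measurable (I : set R) : I `<=` `[0, +oo[ ->
  <<s process_events measurable B I >> `<=` measurable.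
Proof.
move=> I0; apply: sub_measurable_sigma => A [s /I0 + [C mC ->]].
rewrite /= in_itv/= andbT => s0; rewrite -[X in measurable X]setTI.
exact: (bm_measurable B_bm s0).
Qed.

Lemma eps_preimage_measurable s (C : set 'I_2) : 0 <= s -> measurable (eps s @^-1` C).
Proof.
move=> s0.
have -> : eps s @^-1` C = \bigcup_(j in C) (eps s @^-1` [set j]).
  apply/seteqP; split=> [w Cw|w [j Cj /= ej]]; first by exists (eps s w).
  by rewrite /preimage /= ej.
apply: fin_bigcup_measurable; first exact: finite_finset.
by move=> j _; exact: mc_measurable eps_mc s j s0.
Qed.

Lemma Eev_measurable (I : set R) : I `<=` `[0, +oo[ ->
  <<s process_events setT eps I >> `<=` measurable.
Proof.
move=> I0; apply: sub_measurable_sigma => A [s /I0 + [C _ ->]].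
by rewrite /= in_itv/= andbT; exact: eps_preimage_measurable.
Qed.

Lemma enlarged_measurable s : <<s enlarged s >> `<=` measurable.
Proof.
apply: sub_measurable_sigma => X [[BX|EX]|NX]; last exact: P_complete.
- by apply: Bev_measurable BX; exact: itv0_suby.
- by apply: Eev_measurable EX.
Qed.

Lemma past_measurable s : <<s past s >> `<=` measurable.
Proof. by apply: subset_trans (@past_enlarged s) _; exact: enlarged_measurable. Qed.

Lemma eps_event s t (C : set 'I_2) : 0 <= t -> <<s enlarged s >> (eps t @^-1` C).
Proof.
move=> t0; apply: sub_sigma_algebra; left; right; apply: sub_sigma_algebra.
by exists t; [rewrite /= in_itv/= t0|exists C].
Qed.

Lemma eps_past s t (C : set 'I_2) : 0 <= s -> s <= t ->
  augmented_filtration P B eps t (eps s @^-1` C).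
Proof.
move=> s0 st; apply: sub_sigma_algebra; left; right.
by exists s; [rewrite /= in_itv/= s0|exists C].
Qed.

Lemma B_past s t (C : set R) : 0 <= s -> s <= t -> measurable C ->
  augmented_filtration P B eps t (B s @^-1` C).
Proof.
move=> s0 st mC; apply: sub_sigma_algebra; left; left.
by exists s; [rewrite /= in_itv/= s0|exists C].
Qed.

Definition increment (s t : R) (w : T) : R := B t w - B s w.

Lemma increment_measurable s t : 0 <= s -> 0 <= t ->
  measurable_fun setT (increment s t).
Proof. by move=> s0 t0; apply: measurable_funB; apply: (bm_measurable B_bm). Qed.

(** On the generating intersections of [b] and [e], independence of [B] and the chain splits off
    [e], and independence of Brownian increments splits off [b]. *)
Lemma increment_indep s t (A : set T) (C : set R) : 0 <= s -> s < t -> measurable C ->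
  <<s enlarged s >> A ->
  P (A `&` (increment s t) @^-1` C) =
  (P A * P ((increment s t) @^-1` C))%E.
Proof.
move=> s0 st mC GA; have t0 : 0 <= t by rewrite (le_trans s0)// ltW.
pose D := (increment s t) @^-1` C.
have mD : measurable D by have := increment_measurable s0 t0 measurableT mC; rewrite setTI.
have finD : P D \is a fin_num by exact: fin_num_measure.
have sD : sig_measurable (process_events measurable B `[0, +oo[) (increment s t).
  apply: sig_measurable_sub => C' mC'; apply: sub_sigma_algebra.
    by exists t; [rewrite /= in_itv/= t0|exists C'].
  by exists s; [rewrite /= in_itv/= s0|exists C'].
have [|_ ->] := joint_proportional P_complete (B := Bev s) (E := Einf) (D := D) (D' := setT)
  (k := fine (P D)) (Bev_measurable (@itv0_suby s)) (Eev_measurable (@subset_refl _ _))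
  (fine_ge0 (measure_ge0 _ _)) mD measurableT _ GA; last by rewrite setIT fineK// muleC.
move=> b e Bb Ee.
have Bb' : <<s process_events measurable B `[0, +oo[ >> b.
  by apply: process_events_sub Bb; exact: itv0_suby.
rewrite setIT fineK// setIAC.
rewrite (B_eps_indep (sigmaI Bb' (sD C mC)) Ee) (B_eps_indep Bb' Ee) setIC muleA.
congr (_ * _)%E; apply: (bm_increments B_bm s0 st) => //.
by apply: sub_sigma_algebra; exists 0 => //; exists C.
Qed.

(** The Markov property is given for the chain's own past; independence from [B] extends it to the
    past of both processes. *)
Lemma eps_conditional s t i (A : set T) : 0 <= s -> s <= t -> <<s past s >> A ->
  P (A `&` (eps s @^-1` [set i] `&` eps t @^-1` [set rev_ord i])) =
  ((transition (generator_matrix lambda) (t - s) i (rev_ord i))%:E *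
   P (A `&` eps s @^-1` [set i]))%E.
Proof.
move=> s0 st GA; have t0 : 0 <= t by rewrite (le_trans s0).
have ms := eps_preimage_measurable [set i] s0.
have mt := eps_preimage_measurable [set rev_ord i] t0.
have p0 := @transition_rev_ge0 _ _ lambda_gt0 (t - s) i ltac:(by rewrite subr_ge0).
have [|_ ->//] := joint_proportional P_complete (B := Bev s) (E := Eev s)
  (D := eps s @^-1` [set i] `&` eps t @^-1` [set rev_ord i]) (D' := eps s @^-1` [set i])
  (Bev_measurable (@itv0_suby s)) (Eev_measurable (@itv0_suby s))
  p0 (measurableI _ _ ms mt) ms _ GA.
move=> b e Bb Ee.
have Bb' : <<s process_events measurable B `[0, +oo[ >> b.
  by apply: process_events_sub Bb; exact: itv0_suby.
have Ee' : <<s Einf >> e by apply: process_events_sub Ee; exact: itv0_suby.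
have Es r j : 0 <= r -> <<s Einf >> (eps r @^-1` [set j]).
  by move=> r0; apply: sub_sigma_algebra; exists r; [rewrite /= in_itv/= r0|exists [set j]].
rewrite -!setIA (B_eps_indep Bb' (sigmaI Ee' (sigmaI (Es _ _ s0) (Es _ _ t0)))).
rewrite (B_eps_indep Bb' (sigmaI Ee' (Es _ _ s0))).
by rewrite setIA (mc_markov eps_mc i (rev_ord i) s0 st Ee) muleA [LHS]muleC.
Qed.

End brownian_and_chain.

(** * The Euler scheme *)

Section increments.
Context {d : measure_display} {T : measurableType d} {R : realType}.
Variables (P : probability T R) (B : R -> T -> R) (eps : R -> T -> 'I_2) (lambda : 'I_2 -> R).
Hypotheses (P_complete : measure_is_complete P) (lambda_gt0 : forall i, 0 < lambda i)
  (B_bm : brownian_motion P B)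
  (eps_mc : markov_chain P (generator_matrix lambda) eps)
  (B_eps_indep : independent_systems P
     (process_sigma measurable B `[0, +oo[) (process_sigma setT eps `[0, +oo[)).
Local Notation Delta := (increment B).
Local Notation enl := (enlarged P B eps).

Lemma ge0_integral_increment s t (q : R -> R) : 0 <= s -> s < t -> measurable_fun setT q ->
  (forall x, 0 <= q x) ->
  (\int[P]_w (q (Delta s t w))%:E =
   \int[normal_prob 0 (Num.sqrt (t - s))]_x (q x)%:E)%E.
Proof.
move=> s0 st mq q0; have t0 : 0 <= t by rewrite (le_trans s0)// ltW.
have mD := increment_measurable B_bm s0 t0.
pose borel := g_sigma_algebraType R.-ocitv.-measurable.
have mD' : measurable_fun [set: T] (Delta s t : T -> borel) by move=> mT C mC; exact: mD.
pose Dm : {mfun T >-> borel} := HB.pack (Delta s t : T -> borel)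
  (isMeasurableFun.Build _ _ _ _ _ mD').
transitivity (\int[distribution P Dm]_x (q x)%:E)%E.
  rewrite ge0_integral_distribution//; first exact/measurable_EFinP.
have E C : measurable C -> C `<=` setT ->
    distribution P Dm C = normal_prob 0 (Num.sqrt (t - s)) C.
  by move=> mC _; exact: (bm_gaussian B_bm s0 st).
exact: (@eq_measure_integral _ _ _ _ (normal_prob 0 (Num.sqrt (t - s))) (distribution P Dm)
  (fun x => (q x)%:E) E).
Qed.

Lemma increment_sq s t : 0 <= s -> s < t ->
  L1 P (fun w => Delta s t w ^+ 2) /\ Ex P (fun w => Delta s t w ^+ 2) = t - s.
Proof.
move=> s0 st; have t0 : 0 <= t by rewrite (le_trans s0)// ltW.
have mD := increment_measurable B_bm s0 t0.
have ts : 0 < Num.sqrt (t - s) by rewrite sqrtr_gt0 subr_gt0.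
have E : (\int[P]_w (Delta s t w ^+ 2)%:E = (t - s)%:E)%E.
  rewrite (ge0_integral_increment (q := fun x => x ^+ 2))//.
  - by rewrite normal_moment2// sqr_sqrtr// subr_ge0 ltW.
  - by move=> x; rewrite sqr_ge0.
have I : L1 P (fun w => Delta s t w ^+ 2).
  apply/integrableP; split; first by apply/measurable_EFinP; exact: measurable_funX.
  under eq_integral do rewrite gee0_abs ?lee_fin ?sqr_ge0//=.
  by rewrite [ltLHS]E ltry.
by split=> //; apply: EFin_inj; rewrite -ExE.
Qed.

Lemma increment_pow4 s t : 0 <= s -> s < t ->
  L1 P (fun w => Delta s t w ^+ 4) /\ Ex P (fun w => Delta s t w ^+ 4) <= 3 * (t - s) ^+ 2.
Proof.
move=> s0 st; have t0 : 0 <= t by rewrite (le_trans s0)// ltW.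
have mD := increment_measurable B_bm s0 t0.
have ts : 0 < Num.sqrt (t - s) by rewrite sqrtr_gt0 subr_gt0.
have E : (\int[P]_w (Delta s t w ^+ 4)%:E <= (3 * (t - s) ^+ 2)%:E)%E.
  rewrite (ge0_integral_increment (q := fun x => x ^+ 4))//.
  - rewrite (le_trans (normal_moment4 ts))// lee_fin.
    by rewrite (_ : 4 = 2 * 2)%N// exprM sqr_sqrtr// subr_ge0 ltW.
  - by move=> x; rewrite exprn_even_ge0.
have I : L1 P (fun w => Delta s t w ^+ 4).
  apply/integrableP; split; first by apply/measurable_EFinP; exact: measurable_funX.
  under eq_integral do rewrite gee0_abs ?lee_fin ?exprn_even_ge0//=.
  by rewrite (le_lt_trans E)// ltry.
by split=> //; rewrite -lee_fin -ExE.
Qed.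

Lemma increment_mean s t : 0 <= s -> s < t ->
  L1 P (Delta s t) /\ Ex P (Delta s t) = 0.
Proof.
move=> s0 st; have t0 : 0 <= t by rewrite (le_trans s0)// ltW.
have mD := increment_measurable B_bm s0 t0.
have ts : 0 < Num.sqrt (t - s) by rewrite sqrtr_gt0 subr_gt0.
have [I _] := increment_sq s0 st; have I1 := L1_of_sq mD I.
split=> //; apply: EFin_inj; rewrite -ExE//.
pose borel := g_sigma_algebraType R.-ocitv.-measurable.
have mD' : measurable_fun [set: T] (Delta s t : T -> borel) by move=> mT C mC; exact: mD.
pose Dm : {mfun T >-> borel} := HB.pack (Delta s t : T -> borel)
  (isMeasurableFun.Build _ _ _ _ _ mD').
have mid : measurable_fun [set: R] (fun x : R => x%:E).
  by apply/measurable_EFinP; exact: measurable_id.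
have [_ E] := normal_moment1 ts; apply: etrans _ E.
transitivity (\int[distribution P Dm]_x x%:E)%E.
  by rewrite integral_distribution.
have H C : measurable C -> C `<=` setT ->
    distribution P Dm C = normal_prob 0 (Num.sqrt (t - s)) C.
  by move=> mC _; exact: (bm_gaussian B_bm s0 st).
exact: (@eq_measure_integral _ _ _ _ (normal_prob 0 (Num.sqrt (t - s))) (distribution P Dm)
  (fun x => x%:E) H).
Qed.

Lemma increment_mul s t (Z : T -> R) (q : R -> R) : 0 <= s -> s < t ->
  sig_measurable (enl s) Z -> L1 P Z -> measurable_fun setT q ->
  L1 P (fun w => q (Delta s t w)) ->
  L1 P (fun w => Z w * q (Delta s t w)) /\
  Ex P (fun w => Z w * q (Delta s t w)) = Ex P Z * Ex P (fun w => q (Delta s t w)).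
Proof.
move=> s0 st sZ iZ mq iq; apply: indep_Ex_mul => // C D mC mD.
apply: (increment_indep P_complete B_bm eps_mc B_eps_indep s0 st (C := q @^-1` D)).
  by rewrite -[X in measurable X]setTI; exact: mq.
exact: sZ.
Qed.

End increments.

Section one_step.
Context {d : measure_display} {T : measurableType d} {R : realType}.
Variables (P : probability T R) (B : R -> T -> R) (eps : R -> T -> 'I_2)
  (lambda sigma : 'I_2 -> R) (rho : R).
Hypotheses (P_complete : measure_is_complete P) (lambda_gt0 : forall i, 0 < lambda i)
  (sigma_gt0 : forall i, 0 < sigma i)
  (B_bm : brownian_motion P B)
  (eps_mc : markov_chain P (generator_matrix lambda) eps)
  (B_eps_indep : independent_systems P
     (process_sigma measurable B `[0, +oo[) (process_sigma setT eps `[0, +oo[)).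
Variables (k mu : 'I_2 -> R) (v p : 'I_2 -> R -> R) (b : 'I_2 -> R) (C : R).
Hypotheses (kE : forall i, k i ^+ 2 = 2 * (rho + lambda i) / sigma i ^+ 2)
  (muE : forall i, mu i = 2 * lambda i / sigma i ^+ 2)
  (rs : regime_solution k mu v p b C).
Local Notation Delta := (increment B).
Local Notation enl := (enlarged P B eps).
Local Notation g := (regime_curvature k mu v).

Lemma rs_continuous i : continuous (v i).
Proof. by move=> z; exact: is_derive_continuous (rs_derive rs i z). Qed.

Lemma curvature_continuous i : continuous (g i).
Proof.
move=> z; apply: cvgB; apply: cvgM; first exact: cvg_cst; first exact: rs_continuous.
  exact: cvg_cst.
exact: rs_continuous.
Qed.

Lemma rs_ge0 i z : 0 <= v i z.
Proof. by have := rs_ge rs i z; rewrite ge_max => /andP[]. Qed.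

Lemma rs_norm_le i z : `|v i z| <= C + `|z|.
Proof.
rewrite ger0_norm ?rs_ge0// (le_trans (rs_le rs i z))// lerD2l ge_max normr_ge0.
exact: ler_norm.
Qed.

Lemma rs_diff_le i j z : `|v j z - v i z| <= C.
Proof.
have := (rs_ge rs i z, rs_le rs i z, rs_ge rs j z, rs_le rs j z).
by move=> [[[h1 h2] h3] h4]; rewrite ler_norml; apply/andP; split; lra.
Qed.

Lemma curvatureE i z :
  sigma i ^+ 2 / 2 * g i z = (rho + lambda i) * v i z - lambda i * v (rev_ord i) z.
Proof. by rewrite /regime_curvature kE muE; field; rewrite gt_eqF. Qed.

(** In order: the Taylor remainder, the change of [v_j - v_i] over a step that ends in the other
    regime, and the second-order error of the transition probability. *)
Definition step_const (L : R) i : R :=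
  2 * L * sigma i ^+ 3 + 2 * sigma i * lambda i +
  lambda i * (lambda ord0 + lambda ord_max) * C.

(* [c = 1] gives the supermartingale bound, valid everywhere; [c = -1] the reverse bound,
   valid only at a distance below the free boundary. *)
Lemma one_step (c L s h : R) (i : 'I_2) (A : set T) (Y : T -> R) :
  c = 1 \/ c = -1 -> 0 <= L -> 0 <= s -> 0 < h -> h <= 1 ->
  <<s past P B eps s >> A -> A `<=` eps s @^-1` [set i] ->
  sig_measurable (past P B eps s) Y -> L1 P Y ->
  (forall w xi, A w ->
    c * (v i (Y w + xi) - v i (Y w) - p i (Y w) * xi - g i (Y w) / 2 * xi ^+ 2) <=
      L * `|xi| ^+ 3) ->
  let Y' w := Y w + sigma i * Delta s (s + h) w in
  L1 P (fun w => \1_A w * v (eps (s + h) w) (Y' w)) /\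
  c * (Ex P (fun w => \1_A w * v (eps (s + h) w) (Y' w)) -
       (1 + rho * h) * Ex P (fun w => \1_A w * v i (Y w))) <=
    step_const L i * (h * Num.sqrt h).
Proof.
move=> c1 L0 s0 h0 h1 sA Ai sY iY taylor Y'.
set t := s + h.
have st : s < t by rewrite ltrDl.
have t0 : 0 <= t by rewrite addr_ge0// ltW.
have ts : t - s = h by rewrite /t addrAC subrr add0r.
set r := Num.sqrt h.
have r0 : 0 < r by rewrite sqrtr_gt0.
have r2 : r ^+ 2 = h by rewrite sqr_sqrtr// ltW.
have r1 : r <= 1 by rewrite -sqrtr1 ler_wsqrtr.
have mA : measurable A by exact: (past_measurable P_complete B_bm eps_mc sA).
have sAe : <<s enl s >> A by exact: past_enlarged.
have sYe : sig_measurable (enl s) Y by apply: sub_sig_measurable sY; exact: past_enlarged.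
have mY := L1_measurable iY.
have mD := increment_measurable B_bm s0 t0.
pose j := rev_ord i.
pose J := eps t @^-1` [set j].
have mJ : measurable J by exact: (eps_preimage_measurable eps_mc).
have sJ : <<s enl s >> J by exact: eps_event.
have mv l : measurable_fun setT (v l).
  by apply: continuous_measurable_fun; exact: rs_continuous.
have mg : measurable_fun setT (g i).
  by apply: continuous_measurable_fun; exact: curvature_continuous.
have mp : measurable_fun setT (p i).
  by apply: continuous_measurable_fun; exact: rs_deriv_continuous rs i.
have [iD ED] := increment_mean B_bm s0 st.
have [iD2 ED2] := increment_sq B_bm s0 st; rewrite ts in ED2.
have [iD4 ED4] := increment_pow4 B_bm s0 st; rewrite ts in ED4.
have imul := increment_mul P_complete B_bm eps_mc B_eps_indep s0 st.
have sg0 : 0 < sigma i by [].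
have L1v l (Z : T -> R) : L1 P Z -> L1 P (fun w => v l (Z w)).
  move=> iZ; apply: (@L1_le _ _ _ _ _ (fun w => C + `|Z w|)).
  - by apply: measurableT_comp (mv l) (L1_measurable iZ).
  - by move=> w; exact: rs_norm_le.
  - by apply: L1_add; [exact: L1_cst|exact: L1_norm].
have ig : L1 P (fun w => g i (Y w)).
  by apply: L1_sub; apply: L1_scale; exact: L1v.
have iY' : L1 P Y' by apply: L1_add => //; exact: L1_scale.
have JE w : v (eps t w) (Y' w) = v i (Y' w) + \1_J w * (v j (Y' w) - v i (Y' w)).
  rewrite indicE; case: (boolP (w \in J)); rewrite ?mul1r ?mul0r ?addr0.
    by rewrite inE /J /preimage /= => ->; rewrite addrC subrK.
  by rewrite notin_setE /J /preimage /= => /eqP/ord2_neq ->; rewrite /j rev_ordK.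
(* The gain [Z1' - Z1] is split into [Z2 Delta] of mean zero, [Z3 Delta^2] of mean [h E Z3], the
   jump term [Z5] of mean [q E Z5'], and a remainder [LHS] that is bounded pointwise. *)
pose Z1 w := \1_A w * v i (Y w).
pose Z1' w := \1_A w * v (eps t w) (Y' w).
have iZ1 : L1 P Z1 by apply: L1_indic_mul => //; exact: L1v.
have iZ1' : L1 P Z1'.
  apply: L1_indic_mul => //; rewrite (funext JE); apply: L1_add; first exact: L1v.
  by apply: L1_indic_mul => //; apply: L1_sub; exact: L1v.
split=> //.
pose Z2 w := sigma i * (\1_A w * p i (Y w)).
have sA1 : sig_measurable (enl s) (\1_A : T -> R) by exact: sig_measurable_indic.
have sZ2 : sig_measurable (enl s) Z2.
  apply: sig_measurable_mul; first exact: sig_measurable_cst.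
  by apply: sig_measurable_mul => //; exact: sig_measurable_comp.
have iZ2 : L1 P Z2.
  apply: L1_scale; apply: L1_indic_mul => //; apply: (@L1_bounded _ _ _ _ _ 1).
    exact: measurableT_comp.
  by move=> w; have /andP[p0 p1] := rs_deriv_itv rs i (Y w); rewrite ger0_norm.
have [i2 E2] := imul Z2 (fun x => x) sZ2 iZ2 (@measurable_id _ _ _) iD.
rewrite ED mulr0 in E2.
pose Z3 w := \1_A w * (sigma i ^+ 2 / 2 * g i (Y w)).
have sZ3 : sig_measurable (enl s) Z3.
  apply: sig_measurable_mul => //; apply: sig_measurable_mul; first exact: sig_measurable_cst.
  exact: sig_measurable_comp.
have iZ3 : L1 P Z3 by apply: L1_indic_mul => //; exact: L1_scale.
have m2 : measurable_fun setT (fun x : R => x ^+ 2) by exact: measurable_funX.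
have [i3 E3] := imul Z3 (fun x => x ^+ 2) sZ3 iZ3 m2 iD2.
rewrite ED2 in E3.
pose D5 w := v j (Y w) - v i (Y w).
have iD5 : L1 P D5 by apply: L1_sub; exact: L1v.
pose Z5' w := \1_A w * D5 w.
have iZ5' : L1 P Z5' by exact: L1_indic_mul.
pose Z5 w := \1_J w * Z5' w.
have iZ5 : L1 P Z5 by exact: L1_indic_mul.
pose q := transition (generator_matrix lambda) h i j.
have q0 : 0 <= q by apply: transition_rev_ge0 => //; exact: ltW.
have ms : measurable (eps s @^-1` [set i]) by exact: (eps_preimage_measurable eps_mc).
have condq (A' : set T) : <<s past P B eps s >> A' ->
    P (A' `&` (eps s @^-1` [set i] `&` J)) = (q%:E * P (A' `&` eps s @^-1` [set i]))%E.
  move=> sA'; rewrite /q -ts.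
  exact: (eps_conditional P_complete lambda_gt0 B_bm eps_mc B_eps_indep i s0 (ltW st) sA').
have E5 : Ex P Z5 = q * Ex P Z5'.
  have sZ5' : sig_measurable (past P B eps s) Z5'.
    apply: sig_measurable_mul; first exact: sig_measurable_indic.
    by apply: sig_measurable_sub; exact: sig_measurable_comp.
  have bZ5' w : `|Z5' w| <= C.
    rewrite normrM indicE; case: (_ \in _); rewrite ?normr1 ?normr0 ?mul1r ?mul0r.
      exact: rs_diff_le.
    exact: rs_C_ge0 rs.
  have := @cond_Ex_mul _ _ _ P Z5' (eps s @^-1` [set i] `&` J) (eps s @^-1` [set i]) q C q0
    (measurableI _ _ ms mJ) ms (L1_measurable iZ5') bZ5' (fun C' mC' => condq _ (sZ5' C' mC')).
  have EA w : \1_(eps s @^-1` [set i]) w * Z5' w = Z5' w.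
    rewrite /Z5' mulrA; congr (_ * _); rewrite !indicE.
    case: (boolP (w \in A)); rewrite ?mulr0// inE => /Ai; rewrite /preimage /= => Aw.
    by rewrite mem_set ?mulr1.
  rewrite (eq_Ex _ EA) => <-; apply: eq_Ex => w.
  by rewrite /Z5 -[in LHS](EA w) mulrA indicI [\1_J w * _]mulrC.
(* On a switch the error is of size [|Delta|], and the switch has probability [O(h)]; since [enl s]
   contains the future of the chain, [N] is independent of the increment. *)
pose N w : R := \1_(A `&` J) w.
have sN : sig_measurable (enl s) N by apply: sig_measurable_indic; exact: sigmaI.
have mAJ : measurable (A `&` J) by exact: measurableI.
have iN : L1 P N by exact: L1_indic.
have EN : 0 <= Ex P N <= lambda i * h.
  apply/andP; split; first by apply: Ex_ge0 => w; rewrite /N indicE; case: (_ \in _).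
  apply: (@le_trans _ _ q); last exact: transition_rev_le.
  rewrite /N Ex_indic//; have := condq A sA.
  have As : A `&` eps s @^-1` [set i] = A by exact/setIidPl.
  rewrite setIA As => ->; rewrite fineM ?fin_num_measure//=.
  by rewrite ler_piMr// -[leRHS]/(fine 1%E) fine_le ?fin_num_measure// probability_le1.
have [i6 E6] := imul N (fun x => x ^+ 2) sN iN m2 iD2.
rewrite ED2 in E6.
(* [Q4] and [Q6] dominate the terms in [|Delta|^3] and [|Delta|] by even powers, through
   [2 a b <= a^2 + b^2] weighted by [r = sqrt h], which makes all summands of order [h^(3/2)] in
   mean. *)
pose Q4 w := L * sigma i ^+ 3 / 2 * (r * Delta s t w ^+ 2 + r^-1 * Delta s t w ^+ 4).
have iq4 : L1 P (fun w => r * Delta s t w ^+ 2 + r^-1 * Delta s t w ^+ 4).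
  by apply: L1_add; exact: L1_scale.
have iQ4 : L1 P Q4 by exact: L1_scale.
pose Q6 w := sigma i * (r * N w + r^-1 * (N w * Delta s t w ^+ 2)).
have iq6 : L1 P (fun w => r * N w + r^-1 * (N w * Delta s t w ^+ 2)).
  by apply: L1_add; exact: L1_scale.
have iQ6 : L1 P Q6 by exact: L1_scale.
pose LHS w := Z1' w - Z1 w - Z2 w * Delta s t w - Z3 w * Delta s t w ^+ 2 - Z5 w.
have iLHS : L1 P LHS by do 4 (apply: L1_sub => //).
have pointwise w : c * LHS w <= Q4 w + Q6 w.
  set D := Delta s t w.
  have rn0 : r != 0 by rewrite gt_eqF.
  have ri0 : 0 < r^-1 by rewrite invr_gt0.
  have D2E : D ^+ 2 = `|D| ^+ 2 by rewrite real_normK ?num_real.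
  have D4E : D ^+ 4 = `|D| ^+ 4 by rewrite (exprM D 2 2) D2E -exprM.
  have D3 : `|D| ^+ 3 <= (r * D ^+ 2 + r^-1 * D ^+ 4) / 2.
    rewrite -subr_ge0 D2E D4E.
    have -> : (r * `|D| ^+ 2 + r^-1 * `|D| ^+ 4) / 2 - `|D| ^+ 3 =
      r^-1 * (`|D| ^+ 2 * (r - `|D|) ^+ 2) / 2 by field.
    by rewrite divr_ge0// mulr_ge0 ?(ltW ri0)// mulr_ge0 ?sqr_ge0.
  have D1 : `|D| <= (r + r^-1 * D ^+ 2) / 2.
    rewrite -subr_ge0 D2E.
    have -> : (r + r^-1 * `|D| ^+ 2) / 2 - `|D| = r^-1 * (r - `|D|) ^+ 2 / 2 by field.
    by rewrite divr_ge0// mulr_ge0 ?(ltW ri0)// ?sqr_ge0.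
  have Q40 : 0 <= Q4 w.
    rewrite /Q4 -/D mulr_ge0//; first by rewrite divr_ge0// mulr_ge0// exprn_ge0// ltW.
    by have := normr_ge0 D; have := exprn_ge0 3 (normr_ge0 D); lra.
  have N0 : 0 <= N w by rewrite /N indicE; case: (_ \in _).
  have Q60 : 0 <= Q6 w.
    apply: mulr_ge0; first exact: ltW.
    apply: addr_ge0; apply: mulr_ge0; rewrite ?(ltW r0) ?(ltW ri0)//.
    by apply: mulr_ge0 => //; exact: sqr_ge0.
  have [Aw|nAw] := pselect (A w); last first.
    have A0 : \1_A w = 0 :> R by rewrite indicE memNset.
    rewrite /LHS /Z1' /Z1 /Z2 /Z3 /Z5 /Z5' A0 !mul0r !mulr0 !mul0r !subr0 mulr0.
    exact: addr_ge0.
  have A1 : \1_A w = 1 :> R by rewrite indicE mem_set.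
  have NE : N w = \1_J w by rewrite /N indicI /= A1 mul1r.
  have Je : 0 <= (\1_J w : R) by rewrite -NE.
  have := taylor w (sigma i * D) Aw.
  rewrite normrM (gtr0_norm sg0) !exprMn.
  have -> : Y w + sigma i * D = Y' w by [].
  move=> tay.
  pose dv := v j (Y' w) - v i (Y' w) - D5 w.
  have dv1 : c * dv <= 2 * sigma i * `|D|.
    have YY : `|Y' w - Y w| = sigma i * `|D| by rewrite /Y' addrC addKr normrM gtr0_norm.
    have hj := rs_dist rs j (Y' w) (Y w); have hi := rs_dist rs i (Y' w) (Y w).
    rewrite !YY !ler_norml in hi hj.
    move: hi hj => /andP[hi1 hi2] /andP[hj1 hj2].
    by case: c1 => ->; rewrite /dv /D5; lra.
  have {}dv1 : \1_J w * (c * dv) <= \1_J w * (2 * sigma i * `|D|) by rewrite ler_wpM2l.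
  have {}D1 : sigma i * \1_J w * `|D| <= sigma i * \1_J w * ((r + r^-1 * D ^+ 2) / 2).
    by rewrite ler_wpM2l// mulr_ge0// ltW.
  have {}D3 : L * sigma i ^+ 3 * `|D| ^+ 3 <=
      L * sigma i ^+ 3 * ((r * D ^+ 2 + r^-1 * D ^+ 4) / 2).
    by rewrite ler_wpM2l// mulr_ge0// exprn_ge0// ltW.
  have LE : c * LHS w = c * (v i (Y' w) - v i (Y w) - p i (Y w) * (sigma i * D) -
      g i (Y w) / 2 * (sigma i ^+ 2 * D ^+ 2)) + \1_J w * (c * dv).
    by rewrite /LHS /Z1' /Z1 /Z2 /Z3 /Z5 /Z5' /dv A1 JE -/D; ring.
  rewrite LE /Q4 /Q6 NE -/D.
  lra.
have := Ex_le (L1_scale c iLHS) (L1_add iQ4 iQ6) pointwise.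
rewrite Ex_scale// Ex_add// /LHS !Ex_sub//; try by do 3 (try apply: L1_sub => //).
rewrite E2 E3 E5 /Q4 /Q6 !Ex_scale// !Ex_add//; try exact: L1_scale.
rewrite !Ex_scale// E6 ED2.
(* The equation for [v_i]: half of [sigma_i^2] times the curvature is
   [rho v_i - lambda_i (v_j - v_i)]. Its last term cancels the jump term up to the factor
   [q - lambda_i h]. *)
have E3' : Ex P Z3 = rho * Ex P Z1 - lambda i * Ex P Z5'.
  rewrite -!Ex_scale// -Ex_sub//; try exact: L1_scale.
  by apply: eq_Ex => w; rewrite /Z3 curvatureE /Z1 /Z5' /D5 -/j; ring.
rewrite E3'.
have B5 : `|Ex P Z5'| <= C.
  rewrite (le_trans (Ex_norm iZ5'))// -[leRHS](Ex_cst P) Ex_le//; [exact: L1_norm|exact: L1_cst|].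
  move=> w; rewrite normrM indicE; case: (_ \in _); rewrite ?normr1 ?normr0 ?mul1r ?mul0r.
    exact: rs_diff_le.
  exact: rs_C_ge0 rs.
have q1 := transition_rev_le lambda_gt0 h i.
have q2 := transition_rev_ge lambda_gt0 i (ltW h0).
rewrite -/j -/q in q1 q2.
set Lam := lambda ord0 + lambda ord_max in q2 *.
have Lam0 : 0 <= lambda i * Lam by rewrite mulr_ge0 ?addr_ge0 ?ltW.
have hr : h <= r by rewrite -r2 expr2 ler_piMl// ltW.
have corr : c * ((q - lambda i * h) * Ex P Z5') <= lambda i * Lam * C * (h * r).
  have qq : `|q - lambda i * h| <= lambda i * Lam * h ^+ 2.
    by rewrite ler_norml; apply/andP; split; [lra|rewrite (@le_trans _ _ 0)//; [lra|rewrite mulr_ge0 ?sqr_ge0]].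
  rewrite (@le_trans _ _ `|c * ((q - lambda i * h) * Ex P Z5')|)// ?ler_norm//.
  rewrite !normrM (_ : `|c| = 1) ?mul1r; last by case: c1 => ->; rewrite ?normrN normr1.
  rewrite (@le_trans _ _ (lambda i * Lam * h ^+ 2 * C))//.
    by rewrite ler_pM.
  rewrite [leRHS]mulrAC ler_wpM2r ?(rs_C_ge0 rs)// ler_wpM2l// expr2 ler_wpM2l//.
  exact: ltW.
have rh : r^-1 * h = r by rewrite -r2 expr2 mulKf// gt_eqF.
have ED4' : r^-1 * Ex P (fun w => Delta s t w ^+ 4) <= 3 * (h * r).
  rewrite (@le_trans _ _ (r^-1 * (3 * h ^+ 2)))// ?ler_wpM2l ?invr_ge0 ?(ltW r0)//.
  by rewrite le_eqVlt; apply/predU1P; left; rewrite -{2}rh; ring.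
have b4 : L * sigma i ^+ 3 / 2 * (r * h + r^-1 * Ex P (fun w => Delta s t w ^+ 4)) <=
    2 * L * sigma i ^+ 3 * (h * r).
  have Ls : 0 <= L * sigma i ^+ 3 / 2 by rewrite divr_ge0// mulr_ge0// exprn_ge0// ltW.
  have -> : 2 * L * sigma i ^+ 3 * (h * r) = L * sigma i ^+ 3 / 2 * (4 * (h * r)) by field.
  by rewrite ler_wpM2l//; lra.
have b6 : sigma i * (r * Ex P N + r^-1 * (Ex P N * h)) <= 2 * sigma i * lambda i * (h * r).
  have -> : r^-1 * (Ex P N * h) = r * Ex P N by rewrite mulrCA rh mulrC.
  move: EN => /andP[_ EN].
  rewrite (@le_trans _ _ (sigma i * (r * (lambda i * h) + r * (lambda i * h))))//.
    by rewrite ler_wpM2l ?(ltW sg0)// lerD// ler_wpM2l// ltW.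
  by rewrite le_eqVlt; apply/predU1P; left; ring.
rewrite /step_const -/Lam -/Z1 -/Z1' => H.
have -> : c * (Ex P Z1' - (1 + rho * h) * Ex P Z1) =
  c * (Ex P Z1' - Ex P Z1 - 0 - (rho * Ex P Z1 - lambda i * Ex P Z5') * h - q * Ex P Z5') +
  c * ((q - lambda i * h) * Ex P Z5') by ring.
rewrite 2!(mulrDl _ _ (h * r)).
lra.
Qed.

End one_step.

Section euler.
Context {d : measure_display} {T : measurableType d} {R : realType}.
Variables (P : probability T R) (B : R -> T -> R) (eps : R -> T -> 'I_2)
  (lambda sigma : 'I_2 -> R).
Hypotheses (P_complete : measure_is_complete P)
  (B_bm : brownian_motion P B)
  (eps_mc : markov_chain P (generator_matrix lambda) eps).
Variables (x h : R).
Hypothesis h_gt0 : 0 < h.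
Local Notation Fil := (augmented_filtration P B eps).

Definition grid (n : nat) : R := n%:R * h.

Lemma gridS n : grid n.+1 = grid n + h.
Proof. by rewrite /grid -natr1 mulrDl mul1r. Qed.

Lemma grid_ge0 n : 0 <= grid n.
Proof. by rewrite mulr_ge0// ltW. Qed.

Lemma grid_le m n : (m <= n)%N -> grid m <= grid n.
Proof. by move=> mn; rewrite ler_wpM2r ?ler_nat// ltW. Qed.

Lemma grid_lt n : grid n < grid n.+1.
Proof. by rewrite gridS ltrDl. Qed.

Definition euler (n : nat) (w : T) : R :=
  x + \sum_(j < n) sigma (eps (grid j) w) * increment B (grid j) (grid j.+1) w.

Lemma euler0 w : euler 0 w = x.
Proof. by rewrite /euler big_ord0 addr0. Qed.

Lemma eulerS n w : euler n.+1 w =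
  euler n w + sigma (eps (grid n) w) * increment B (grid n) (grid n.+1) w.
Proof. by rewrite /euler big_ord_recr addrA. Qed.

Lemma sig_measurable_eps (phi : 'I_2 -> R) s t : 0 <= s -> s <= t ->
  forall C : set R, Fil t ((fun w => phi (eps s w)) @^-1` C).
Proof.
move=> s0 st C.
rewrite (_ : _ @^-1` C = eps s @^-1` (phi @^-1` C))//.
exact: eps_past.
Qed.

Lemma sig_past (Z : T -> R) t : (forall C, measurable C -> Fil t (Z @^-1` C)) ->
  sig_measurable (past P B eps t) Z.
Proof. by move=> h' C mC; apply: augmented_past; exact: h'. Qed.

Lemma euler_filtration n (C : set R) : measurable C -> Fil (grid n) (euler n @^-1` C).
Proof.
move: C; rewrite -/(sig_measurable _ (euler n)).
have H m : (m <= n)%N -> sig_measurable (process_events measurable B `[0, grid n] `|`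
    process_events setT eps `[0, grid n] `|` P.-negligible) (euler m).
  elim: m => [|m IH] mn.
    by rewrite (funext euler0); exact: sig_measurable_cst.
  rewrite (funext (eulerS m)); apply: sig_measurable_add; first by apply: IH; exact: ltnW.
  apply: sig_measurable_mul.
    move=> C _; apply: sig_measurable_eps; first exact: grid_ge0.
    exact/grid_le/ltnW.
  apply: sig_measurable_sub => C mC; apply: B_past => //; try exact: grid_ge0.
    exact: grid_le.
  exact/grid_le/ltnW.
exact: H.
Qed.

Lemma euler_past n : sig_measurable (past P B eps (grid n)) (euler n).
Proof. by apply: sig_past => C; exact: euler_filtration. Qed.

Lemma sigma_eps_measurable (phi : 'I_2 -> R) s : 0 <= s ->
  measurable_fun setT (fun w => phi (eps s w)).
Proof.
move=> s0 _ C mC; rewrite setTI (_ : _ @^-1` C = eps s @^-1` (phi @^-1` C))//.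
exact: (eps_preimage_measurable eps_mc).
Qed.

Lemma ord2_bound (phi : 'I_2 -> R) i : `|phi i| <= `|phi ord0| + `|phi ord_max|.
Proof. by have [->|->] := ord2P i; rewrite ?lerDl ?lerDr. Qed.

Lemma euler_L1 n : L1 P (euler n).
Proof.
elim: n => [|n IH]; first by rewrite (funext euler0); exact: L1_cst.
rewrite (funext (eulerS n)); apply: L1_add => //.
apply: (L1_bounded_mul (M := `|sigma ord0| + `|sigma ord_max|)).
- exact: (sigma_eps_measurable sigma (grid_ge0 n)).
- by move=> w; exact: ord2_bound.
- by have [] := increment_mean B_bm (grid_ge0 n) (grid_lt n).
Qed.

End euler.

Section stopped_value.
Context {d : measure_display} {T : measurableType d} {R : realType}.
Variables (P : probability T R) (B : R -> T -> R) (eps : R -> T -> 'I_2)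
  (lambda sigma : 'I_2 -> R) (rho : R).
Hypotheses (P_complete : measure_is_complete P) (lambda_gt0 : forall i, 0 < lambda i)
  (sigma_gt0 : forall i, 0 < sigma i) (rho_gt0 : 0 < rho)
  (B_bm : brownian_motion P B)
  (eps_mc : markov_chain P (generator_matrix lambda) eps)
  (B_eps_indep : independent_systems P
     (process_sigma measurable B `[0, +oo[) (process_sigma setT eps `[0, +oo[)).
Variables (k mu : 'I_2 -> R) (v p : 'I_2 -> R -> R) (b : 'I_2 -> R) (C : R).
Hypotheses (k_gt0 : forall i, 0 < k i) (mu_gt0 : forall i, 0 < mu i)
  (kE : forall i, k i ^+ 2 = 2 * (rho + lambda i) / sigma i ^+ 2)
  (muE : forall i, mu i = 2 * lambda i / sigma i ^+ 2)
  (rs : regime_solution k mu v p b C).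
Variables (x h : R).
Hypotheses (h_gt0 : 0 < h) (h_le1 : h <= 1).
Local Notation Y := (euler B eps sigma x h).
Local Notation t := (grid h).
Local Notation Past n := (<<s past P B eps (t n) >>).
Local Notation g := (regime_curvature k mu v).

Definition discounted n w : R := expR (- (rho * t n)) * v (eps (t n) w) (Y n w).

Lemma step_const_ge0 L i : 0 <= L -> 0 <= step_const lambda sigma C L i.
Proof.
move=> L0; rewrite /step_const !addr_ge0// !mulr_ge0// ?exprn_ge0 ?addr_ge0 ?(rs_C_ge0 rs) ?ltW//.
Qed.

Lemma grid_step n i (A : set T) (c L : R) :
  c = 1 \/ c = -1 -> 0 <= L -> Past n A -> A `<=` eps (t n) @^-1` [set i] ->
  (forall w xi, A w ->
    c * (v i (Y n w + xi) - v i (Y n w) - p i (Y n w) * xi - g i (Y n w) / 2 * xi ^+ 2) <=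
      L * `|xi| ^+ 3) ->
  [/\ L1 P (fun w => \1_A w * v (eps (t n.+1) w) (Y n.+1 w)),
      L1 P (fun w => \1_A w * v (eps (t n) w) (Y n w)) &
      c * (Ex P (fun w => \1_A w * v (eps (t n.+1) w) (Y n.+1 w)) -
         (1 + rho * h) * Ex P (fun w => \1_A w * v (eps (t n) w) (Y n w))) <=
      step_const lambda sigma C L i * (h * Num.sqrt h)].
Proof.
move=> c1 L0 sA Ai taylor.
have sY := @euler_past _ _ _ P B eps sigma x h h_gt0 n.
have iY := euler_L1 sigma B_bm eps_mc x h_gt0 n.
have [I H] := one_step P_complete lambda_gt0 sigma_gt0 B_bm eps_mc B_eps_indep
  kE muE rs c1 L0 (grid_ge0 h_gt0 n) h_gt0 h_le1 sA Ai sY iY taylor.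
have E1 w : \1_A w * v (eps (t n.+1) w) (Y n.+1 w) =
    \1_A w * v (eps (t n + h) w) (Y n w + sigma i * increment B (t n) (t n + h) w).
  rewrite indicE; case: (boolP (w \in A)) => Aw; rewrite ?mul0r//.
  by rewrite eulerS -gridS; move: Aw; rewrite inE => /Ai; rewrite /preimage /= => ->.
have E0 w : \1_A w * v (eps (t n) w) (Y n w) = \1_A w * v i (Y n w).
  rewrite indicE; case: (boolP (w \in A)) => Aw; rewrite ?mul0r//.
  by move: Aw; rewrite inE => /Ai; rewrite /preimage /= => ->.
rewrite (funext E1) (funext E0); split => //.
apply: L1_indic_mul; first exact: (past_measurable P_complete B_bm eps_mc sA).
apply: (@L1_le _ _ _ _ _ (fun w => C + `|Y n w|)).
- apply: measurableT_comp (L1_measurable iY).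
  by apply: continuous_measurable_fun => z; exact: is_derive_continuous (rs_derive rs i z).
- by move=> w; exact: (rs_norm_le rs).
- by apply: L1_add; [exact: L1_cst|exact: L1_norm].
Qed.

(** The one-step bounds contain the factor [1 + rho h]; the discount cancels it up to [rho^2 h^2],
    and the product never exceeds 1, as the upper bound wants. *)
Lemma exp_discount : expR (- (rho * h)) * (1 + rho * h) <= 1 /\
  1 - rho ^+ 2 * h ^+ 2 <= expR (- (rho * h)) * (1 + rho * h).
Proof.
have r0 : 0 <= rho * h by rewrite mulr_ge0// ltW.
split.
  by rewrite expRN ler_pdivrMl ?expR_gt0// mulr1; exact: expR_ge1Dx.
have := expR_ge1Dx (- (rho * h)) => H.
have := ler_wpM2r (_ : 0 <= 1 + rho * h) H.
by rewrite addr_ge0// => /(_ isT); apply: le_trans; rewrite le_eqVlt; apply/predU1P; left; ring.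
Qed.

(** [one_step] fixes the regime at the start of the step, so every event is cut along the current
    regime. *)
Lemma split_regime (A : set T) (W : T -> R) n w :
  \1_A w * W w = \1_(A `&` eps (t n) @^-1` [set ord0]) w * W w +
                 \1_(A `&` eps (t n) @^-1` [set ord_max]) w * W w.
Proof.
rewrite !indicI /= !indicE -mulrDl; congr (_ * _).
have E i : (w \in eps (t n) @^-1` [set i]) = (eps (t n) w == i).
  by apply/idP/eqP => [|e]; [rewrite inE|rewrite inE /preimage /= e].
by rewrite !E -mulrDr; have [->|->] := ord2P (eps (t n) w); rewrite /= ?addr0 ?add0r mulr1.
Qed.

Lemma discounted_L1 n (A : set T) : Past n A ->
  L1 P (fun w => \1_A w * discounted n w) /\ L1 P (fun w => \1_A w * discounted n.+1 w).
Proof.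
move=> sA.
have sAi i : Past n (A `&` eps (t n) @^-1` [set i]).
  by apply: sigmaI => //; apply: augmented_past; apply: eps_past; rewrite ?grid_ge0.
have H i : L1 P (fun w => \1_(A `&` eps (t n) @^-1` [set i]) w * discounted n w) /\
    L1 P (fun w => \1_(A `&` eps (t n) @^-1` [set i]) w * discounted n.+1 w).
  have [||I1 I0 _] := @grid_step n i _ 1 (curvature_lip k mu i) (or_introl erefl)
    (curvature_lip_ge0 k_gt0 mu_gt0 i) (sAi i).
  - by move=> w [].
  - by move=> w xi _; rewrite mul1r; have := taylor_upper k_gt0 mu_gt0 rs i (Y n w) xi; lra.
  split.
    have := L1_scale (expR (- (rho * t n))) I0.
    by under eq_fun do rewrite mulrCA.
  have := L1_scale (expR (- (rho * t n.+1))) I1.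
  by under eq_fun do rewrite mulrCA.
split.
  by rewrite (funext (split_regime A (discounted n) n)); apply: L1_add; case: (H ord0); case: (H ord_max).
by rewrite (funext (split_regime A (discounted n.+1) n)); apply: L1_add; case: (H ord0); case: (H ord_max).
Qed.

Definition upper_const : R := \sum_i step_const lambda sigma C (curvature_lip k mu i) i.

Lemma grid_step_upper n (A : set T) : Past n A ->
  Ex P (fun w => \1_A w * discounted n.+1 w) <=
  Ex P (fun w => \1_A w * discounted n w) + upper_const * (h * Num.sqrt h).
Proof.
move=> sA.
have sAi i : Past n (A `&` eps (t n) @^-1` [set i]).
  by apply: sigmaI => //; apply: augmented_past; apply: eps_past; rewrite ?grid_ge0.
have H i : Ex P (fun w => \1_(A `&` eps (t n) @^-1` [set i]) w * discounted n.+1 w) <=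
    Ex P (fun w => \1_(A `&` eps (t n) @^-1` [set i]) w * discounted n w) +
    step_const lambda sigma C (curvature_lip k mu i) i * (h * Num.sqrt h).
  have [||I1 I0] := @grid_step n i _ 1 (curvature_lip k mu i) (or_introl erefl)
    (curvature_lip_ge0 k_gt0 mu_gt0 i) (sAi i).
  - by move=> w [].
  - by move=> w xi _; rewrite mul1r; have := taylor_upper k_gt0 mu_gt0 rs i (Y n w) xi; lra.
  rewrite mul1r => H.
  set e1 := Ex P _ in H; set e0 := Ex P _ in H.
  have -> : Ex P (fun w => \1_(A `&` eps (t n) @^-1` [set i]) w * discounted n.+1 w) =
      expR (- (rho * t n.+1)) * e1.
    by rewrite -Ex_scale//; apply: eq_Ex => w; rewrite mulrCA.
  have -> : Ex P (fun w => \1_(A `&` eps (t n) @^-1` [set i]) w * discounted n w) =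
      expR (- (rho * t n)) * e0.
    by rewrite -Ex_scale//; apply: eq_Ex => w; rewrite mulrCA.
  have e00 : 0 <= e0.
    by apply: Ex_ge0 => w; apply: mulr_ge0 => //; exact: (rs_ge0 rs).
  have K0 := step_const_ge0 i (curvature_lip_ge0 k_gt0 mu_gt0 i).
  have hr0 : 0 <= h * Num.sqrt h by rewrite mulr_ge0 ?sqrtr_ge0// ltW.
  have [ed _] := exp_discount.
  rewrite gridS mulrDr opprD expRD -mulrA.
  have et1 : expR (- (rho * t n)) <= 1.
    by rewrite -[leRHS]expR0 ler_expR oppr_le0 mulr_ge0 ?grid_ge0// ltW.
  have eh1 : expR (- (rho * h)) <= 1.
    by rewrite -[leRHS]expR0 ler_expR oppr_le0 mulr_ge0// ltW.
  have Kh0 := mulr_ge0 K0 hr0.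
  have : expR (- (rho * h)) * e1 <= e0 + step_const lambda sigma C (curvature_lip k mu i) i * (h * Num.sqrt h).
    rewrite (@le_trans _ _ (expR (- (rho * h)) * ((1 + rho * h) * e0 +
      step_const lambda sigma C (curvature_lip k mu i) i * (h * Num.sqrt h))))//.
      by rewrite ler_wpM2l ?expR_ge0//; lra.
    rewrite mulrDr mulrA lerD//; first by rewrite ler_piMl.
    by rewrite ler_piMl.
  move=> /(ler_wpM2l (expR_ge0 (- (rho * t n)))) /le_trans; apply.
  by rewrite mulrDr lerD2l ler_piMl.
have [iA0 iA1] := discounted_L1 sA.
have [i00 i01] := discounted_L1 (sAi ord0); have [i10 i11] := discounted_L1 (sAi ord_max).
rewrite (eq_Ex P (split_regime A (discounted n.+1) n)) (eq_Ex P (split_regime A (discounted n) n)).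
rewrite !Ex_add// /upper_const big_ord_recr big_ord1/= mulrDl.
rewrite (_ : widen_ord _ ord0 = ord0); last exact: val_inj.
have := H ord0; have := H ord_max; lra.
Qed.

(** The second summand pays for [exp (- rho h) (1 + rho h)] falling short of 1; [C + max 0 b_i]
    bounds [v_i] below the boundary. *)
Definition lower_const (Lw : 'I_2 -> R) : R :=
  \sum_i (step_const lambda sigma C (Lw i) i + rho ^+ 2 * (C + Num.max 0 (b i))).

Lemma grid_step_lower (Lw : 'I_2 -> R) dl n (A : set T) :
  (forall i, 0 <= Lw i) ->
  (forall i y xi, y <= b i - dl -> v i y + p i y * xi + g i y / 2 * xi ^+ 2 -
    Lw i * `|xi| ^+ 3 <= v i (y + xi)) ->
  0 <= dl -> Past n A -> (forall w, A w -> Y n w <= b (eps (t n) w) - dl) ->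
  Ex P (fun w => \1_A w * discounted n w) - lower_const Lw * (h * Num.sqrt h) <=
  Ex P (fun w => \1_A w * discounted n.+1 w).
Proof.
move=> L0 taylor dl0 sA Ay.
have sAi i : Past n (A `&` eps (t n) @^-1` [set i]).
  by apply: sigmaI => //; apply: augmented_past; apply: eps_past; rewrite ?grid_ge0.
have H i : Ex P (fun w => \1_(A `&` eps (t n) @^-1` [set i]) w * discounted n w) -
    (step_const lambda sigma C (Lw i) i + rho ^+ 2 * (C + Num.max 0 (b i))) * (h * Num.sqrt h) <=
    Ex P (fun w => \1_(A `&` eps (t n) @^-1` [set i]) w * discounted n.+1 w).
  have Aiy w : (A `&` eps (t n) @^-1` [set i]) w -> Y n w <= b i - dl.
    by move=> [Aw]; rewrite /preimage /= => e; have := Ay w Aw; rewrite e.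
  have [||I1 I0] := @grid_step n i _ (-1) (Lw i) (or_intror erefl) (L0 i) (sAi i).
  - by move=> w [].
  - by move=> w xi Aw; rewrite mulN1r; have := taylor i (Y n w) xi (Aiy w Aw); lra.
  rewrite mulN1r => H.
  set e1 := Ex P _ in H; set e0 := Ex P _ in H.
  have -> : Ex P (fun w => \1_(A `&` eps (t n) @^-1` [set i]) w * discounted n.+1 w) =
      expR (- (rho * t n.+1)) * e1.
    by rewrite -Ex_scale//; apply: eq_Ex => w; rewrite mulrCA.
  have -> : Ex P (fun w => \1_(A `&` eps (t n) @^-1` [set i]) w * discounted n w) =
      expR (- (rho * t n)) * e0.
    by rewrite -Ex_scale//; apply: eq_Ex => w; rewrite mulrCA.
  pose M := C + Num.max 0 (b i).
  have e0M : e0 <= M.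
    rewrite -[leRHS](Ex_cst P); apply: Ex_le => //; first exact: L1_cst.
    have M0 : 0 <= M by rewrite addr_ge0 ?(rs_C_ge0 rs)// le_max lexx.
    move=> w; rewrite indicE; case: (boolP (w \in _)); rewrite ?mul0r// inE => Aw.
    have [_ e] := Aw; rewrite /preimage /= in e; rewrite mul1r e.
    rewrite (le_trans (rs_le rs i _))// lerD2l ge_max !le_max lexx/=.
    have Yb : Y n w <= b i by rewrite (le_trans (Aiy w Aw))// gerBl.
    by rewrite Yb orbT.
  have K0 := step_const_ge0 i (L0 i).
  have s0 : 0 <= Num.sqrt h by exact: sqrtr_ge0.
  have hr0 : 0 <= h * Num.sqrt h by rewrite mulr_ge0// ltW.
  have [_ ed] := exp_discount.
  have s1 : Num.sqrt h <= 1 by rewrite -sqrtr1 ler_wsqrtr.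
  have hh : h ^+ 2 <= h * Num.sqrt h.
    rewrite expr2 ler_wpM2l ?(ltW h_gt0)//.
    by rewrite -{1}(sqr_sqrtr (ltW h_gt0)) expr2 ler_piMl.
  rewrite gridS (mulrDr rho (t n)) opprD expRD -[X in _ <= X]mulrA.
  have et1 : expR (- (rho * t n)) <= 1.
    by rewrite -[leRHS]expR0 ler_expR oppr_le0 mulr_ge0 ?grid_ge0// ltW.
  have eh1 : expR (- (rho * h)) <= 1.
    by rewrite -[leRHS]expR0 ler_expR oppr_le0 mulr_ge0// ltW.
  have Kh0 := mulr_ge0 K0 hr0.
  have e00 : 0 <= e0.
    by apply: Ex_ge0 => w; apply: mulr_ge0 => //; exact: (rs_ge0 rs).
  have M0 : 0 <= M by exact: le_trans e0M.
  set kk := step_const lambda sigma C (Lw i) i in H K0 Kh0 *.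
  have rM : rho ^+ 2 * h ^+ 2 * e0 <= rho ^+ 2 * M * (h * Num.sqrt h).
    rewrite [leRHS]mulrAC; apply: ler_pM => //.
      by apply: mulr_ge0; exact: sqr_ge0.
    by apply: ler_wpM2l => //; exact: sqr_ge0.
  have E : e0 - (kk + rho ^+ 2 * M) * (h * Num.sqrt h) <= expR (- (rho * h)) * e1.
    have h1 : expR (- (rho * h)) * ((1 + rho * h) * e0 - kk * (h * Num.sqrt h)) <=
        expR (- (rho * h)) * e1 by rewrite ler_wpM2l ?expR_ge0//; lra.
    have h2 : (1 - rho ^+ 2 * h ^+ 2) * e0 <= expR (- (rho * h)) * (1 + rho * h) * e0.
      by rewrite ler_wpM2r.
    have h3 : expR (- (rho * h)) * (kk * (h * Num.sqrt h)) <= kk * (h * Num.sqrt h).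
      by rewrite ler_piMl.
    rewrite mulrBr mulrA in h1; rewrite mulrBl mul1r in h2; rewrite mulrDl; lra.
  have := ler_wpM2l (expR_ge0 (- (rho * t n))) E.
  rewrite mulrBr -/M.
  have : expR (- (rho * t n)) * ((kk + rho ^+ 2 * M) * (h * Num.sqrt h)) <=
    (kk + rho ^+ 2 * M) * (h * Num.sqrt h).
    by rewrite ler_piMl// mulr_ge0// addr_ge0// mulr_ge0// sqr_ge0.
  lra.
have [iA0 iA1] := discounted_L1 sA.
have [i00 i01] := discounted_L1 (sAi ord0); have [i10 i11] := discounted_L1 (sAi ord_max).
rewrite (eq_Ex P (split_regime A (discounted n.+1) n)) (eq_Ex P (split_regime A (discounted n) n)).
rewrite !Ex_add// /lower_const big_ord_recr big_ord1/=.
rewrite (_ : widen_ord _ ord0 = ord0); last exact: val_inj.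
have := H ord0; have := H ord_max.
move: (step_const _ _ _ _ _ + _) (step_const _ _ _ _ _ + _) => a1 a2; rewrite mulrDl; lra.
Qed.

Lemma telescope_stopped (f : nat -> R) (kap K : nat) : (kap <= K)%N ->
  f kap = f 0%N + \sum_(n < K) (n < kap)%N%:R * (f n.+1 - f n).
Proof.
move=> kK; rewrite -{1}(minn_idPl kK); elim: K {kK} => [|K IH].
  by rewrite minn0 big_ord0 addr0.
rewrite big_ord_recr/= addrA -IH; case: (ltnP K kap) => h'.
  by rewrite ?(minn_idPr h') ?(minn_idPr (ltnW h')) mul1r addrC subrK.
by rewrite ?(minn_idPl h') ?(minn_idPl (leqW h')) mul0r addr0.
Qed.

Variables (kap : T -> nat) (K : nat) (D0 : set T).
Hypotheses (kapK : forall w, (kap w <= K)%N)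
  (kap_stop : forall n, augmented_filtration P B eps (t n) [set w | (n < kap w)%N])
  (D0_past : augmented_filtration P B eps 0 D0).

Let A n := D0 `&` [set w | (n < kap w)%N].

Let sA n : Past n (A n).
Proof.
apply: sigmaI; apply: augmented_past => //.
by apply: (augmented_mono _ D0_past); exact: grid_ge0.
Qed.

Let grid0 : t 0%N = 0. Proof. by rewrite /grid mul0r. Qed.

Let sD0 : Past 0%N D0.
Proof. by rewrite grid0; exact: augmented_past. Qed.

(** Optional stopping by hand: the stopped value is a sum of one-step gains on the events [A n],
    which are known at time [t n], so the one-step bounds apply to each of them. *)
Lemma stopped_sum w : \1_D0 w * discounted (kap w) w = \1_D0 w * discounted 0%N w +
  \sum_(n < K) (\1_(A n) w * discounted n.+1 w - \1_(A n) w * discounted n w).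
Proof.
rewrite (telescope_stopped (fun n => discounted n w) (kapK w)) mulrDr; congr (_ + _).
rewrite mulr_sumr; apply: eq_bigr => n _; rewrite -mulrBr mulrA; congr (_ * _).
rewrite /A indicI /= !indicE; congr (_ * _).
by case: (ltnP n (kap w)) => h'; [rewrite mem_set|rewrite memNset//= ltnNge h'].
Qed.

Let isum n : L1 P (fun w => \1_(A n) w * discounted n.+1 w - \1_(A n) w * discounted n w).
Proof. by have [i0 i1] := discounted_L1 (@sA n); exact: L1_sub. Qed.

Lemma stopped_L1 : L1 P (fun w => \1_D0 w * discounted (kap w) w).
Proof.
rewrite (funext stopped_sum); apply: L1_add; first by have [] := discounted_L1 sD0.
exact: L1_sum.
Qed.

Lemma Ex_stopped : Ex P (fun w => \1_D0 w * discounted (kap w) w) =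
  Ex P (fun w => \1_D0 w * discounted 0%N w) +
  \sum_(n < K) (Ex P (fun w => \1_(A n) w * discounted n.+1 w) -
                Ex P (fun w => \1_(A n) w * discounted n w)).
Proof.
rewrite (eq_Ex P stopped_sum) Ex_add; [|by have [] := discounted_L1 sD0|exact: L1_sum].
rewrite Ex_sum//; congr (_ + _); apply: eq_bigr => n _.
by have [i0 i1] := discounted_L1 (@sA n); rewrite Ex_sub.
Qed.

Lemma stopped_upper : Ex P (fun w => \1_D0 w * discounted (kap w) w) <=
  Ex P (fun w => \1_D0 w * discounted 0%N w) + K%:R * (upper_const * (h * Num.sqrt h)).
Proof.
rewrite Ex_stopped lerD2l mulr_natl -[K in leRHS]card_ord -sumr_const; apply: ler_sum => n _.
by have := grid_step_upper (@sA n); lra.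
Qed.

Lemma stopped_lower (Lw : 'I_2 -> R) dl :
  (forall i, 0 <= Lw i) ->
  (forall i y xi, y <= b i - dl -> v i y + p i y * xi + g i y / 2 * xi ^+ 2 -
    Lw i * `|xi| ^+ 3 <= v i (y + xi)) ->
  0 <= dl -> (forall w n, (n < kap w)%N -> Y n w <= b (eps (t n) w) - dl) ->
  Ex P (fun w => \1_D0 w * discounted 0%N w) - K%:R * (lower_const Lw * (h * Num.sqrt h)) <=
  Ex P (fun w => \1_D0 w * discounted (kap w) w).
Proof.
move=> L0 taylor dl0 kY.
rewrite Ex_stopped lerD2l mulr_natl -[K in leLHS]card_ord -sumr_const -sumrN.
apply: ler_sum => n _.
have := grid_step_lower L0 taylor dl0 (@sA n) (fun w Aw => kY w n (proj2 Aw)); lra.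
Qed.

Lemma discounted0 i : D0 `<=` eps 0 @^-1` [set i] ->
  Ex P (fun w => \1_D0 w * discounted 0%N w) = v i x * fine (P D0).
Proof.
move=> Di; have mD0 : measurable D0.
  exact: (past_measurable P_complete B_bm eps_mc (augmented_past D0_past)).
rewrite -Ex_indic// -Ex_scale; last exact: L1_indic.
apply: eq_Ex => w; rewrite /discounted grid0 mulr0 oppr0 expR0 mul1r euler0 mulrC indicE.
case: (boolP (w \in D0)); rewrite ?mulr0// inE => /Di; rewrite /preimage /= => ->.
by rewrite mulr1.
Qed.

End stopped_value.

(** * Comparison of the diffusion with its Euler scheme *)

Section isometry.
Context {d : measure_display} {T : measurableType d} {R : realType}.
Variables (P : probability T R) (B : R -> T -> R) (eps : R -> T -> 'I_2) (lambda : 'I_2 -> R).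
Hypotheses (P_complete : measure_is_complete P)
  (B_bm : brownian_motion P B)
  (eps_mc : markov_chain P (generator_matrix lambda) eps)
  (B_eps_indep : independent_systems P
     (process_sigma measurable B `[0, +oo[) (process_sigma setT eps `[0, +oo[)).
Local Notation Delta := (increment B).
Local Notation enl := (enlarged P B eps).

(** The length of the intersection of []p, q]] and []r, s]]. *)
Definition overlap (p q r s : R) : R := Num.max 0 (Num.min q s - Num.max p r).

Lemma overlapC p q r s : overlap p q r s = overlap r s p q.
Proof. by rewrite /overlap minC maxC [Num.max p r]maxC [RHS]maxC. Qed.

(* An integrand [a 1_{]p, q]}]. *)
Record elementary (a : T -> R) (p q : R) : Prop := Elementary {
  el_ge0 : 0 <= p ;
  el_le : p <= q ;
  el_measurable : measurable_fun setT a ;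
  el_bounded : exists M : R, forall w, `|a w| <= M ;
  el_adapted : p < q -> sig_measurable (enl p) a }.

Lemma increment_cat p q r w : Delta p r w = Delta p q w + Delta q r w.
Proof. by rewrite /increment; ring. Qed.

Lemma incrementxx p w : Delta p p w = 0.
Proof. by rewrite /increment subrr. Qed.

Lemma increment_sig p q r : 0 <= p -> p <= q -> q <= r -> sig_measurable (enl r) (Delta p q).
Proof.
move=> p0 pq qr; apply: sig_measurable_sub => C mC; apply: augmented_enlarged.
  by apply: B_past => //; exact: le_trans pq.
by apply: B_past => //; exact: le_trans qr.
Qed.

Lemma increment_sq_L1 p q : 0 <= p -> p <= q -> L1 P (fun w => Delta p q w ^+ 2).
Proof.
move=> p0; rewrite le_eqVlt => /predU1P[->|pq]; last by have [] := increment_sq B_bm p0 pq.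
rewrite (_ : (fun _ => _) = fun=> 0); first exact: L1_cst.
by apply/funext => w; rewrite incrementxx expr0n.
Qed.

Lemma increment2_L1 p q r s : 0 <= p -> p <= q -> 0 <= r -> r <= s ->
  L1 P (fun w => Delta p q w * Delta r s w).
Proof.
move=> p0 pq r0 rs; apply: L1_mul_sq; try exact: increment_sq_L1.
  by apply: (increment_measurable B_bm) => //; exact: le_trans pq.
by apply: (increment_measurable B_bm) => //; exact: le_trans rs.
Qed.

Lemma martingale_mul Z r s : 0 <= r -> r <= s -> L1 P Z ->
  (r < s -> sig_measurable (enl r) Z) ->
  L1 P (fun w => Z w * Delta r s w) /\ Ex P (fun w => Z w * Delta r s w) = 0.
Proof.
move=> r0; rewrite le_eqVlt => /predU1P[-> iZ _|rs iZ /(_ rs) sZ].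
  rewrite (_ : (fun _ => _) = fun=> 0); last by apply/funext => w; rewrite incrementxx mulr0.
  by split; [exact: L1_cst|exact: Ex_cst].
have [iD ED] := increment_mean B_bm r0 rs.
have [i e] := increment_mul P_complete B_bm eps_mc B_eps_indep (q := fun x => x) r0 rs
  sZ iZ (@measurable_id _ _ _) iD.
by rewrite e ED mulr0.
Qed.

Lemma quadratic_mul Z r s : 0 <= r -> r <= s -> L1 P Z ->
  (r < s -> sig_measurable (enl r) Z) ->
  L1 P (fun w => Z w * Delta r s w ^+ 2) /\
  Ex P (fun w => Z w * Delta r s w ^+ 2) = Ex P Z * (s - r).
Proof.
move=> r0; rewrite le_eqVlt => /predU1P[-> iZ _|rs iZ /(_ rs) sZ].
  rewrite (_ : (fun _ => _) = fun=> 0).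
    by rewrite subrr mulr0; split; [exact: L1_cst|exact: Ex_cst].
  by apply/funext => w; rewrite incrementxx expr0n mulr0.
have [iD ED] := increment_sq B_bm r0 rs.
have m2 : measurable_fun setT (fun x : R => x ^+ 2) by exact: measurable_funX.
have [i e] := increment_mul P_complete B_bm eps_mc B_eps_indep (q := fun x => x ^+ 2) r0 rs
  sZ iZ m2 iD.
by rewrite e ED.
Qed.

Lemma el_mul_L1 a b p q r s W : elementary a p q -> elementary b r s -> L1 P W ->
  L1 P (fun w => a w * b w * W w).
Proof.
move=> ea eb iW; have [M aM] := el_bounded ea; have [N bN] := el_bounded eb.
apply: (@L1_bounded_mul _ _ _ _ _ _ (M * N)) => //.
  by apply: measurable_funM; [exact: (el_measurable ea)|exact: (el_measurable eb)].
by move=> w; rewrite normrM ler_pM.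
Qed.

Lemma el_prod_L1 a b p q r s : elementary a p q -> elementary b r s ->
  L1 P (fun w => a w * b w).
Proof.
move=> ea eb; have := el_mul_L1 ea eb (L1_cst P 1).
by under eq_fun do rewrite mulr1.
Qed.

Lemma elementary_pair_L1 a b p q r s : elementary a p q -> elementary b r s ->
  L1 P (fun w => a w * Delta p q w * (b w * Delta r s w)).
Proof.
move=> ea eb; under eq_fun do rewrite mulrACA.
apply: (el_mul_L1 ea eb); apply: increment2_L1.
- exact: el_ge0 ea. - exact: el_le ea. - exact: el_ge0 eb. - exact: el_le eb.
Qed.

(** The increments are cut at one another's endpoints. A product over different pieces has mean
    zero, since the later increment is independent of the other factors; only the square over the
    common piece remains and contributes its length. *)
Lemma elementary_pair a b p q r s : elementary a p q -> elementary b r s -> p <= r ->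
  Ex P (fun w => a w * Delta p q w * (b w * Delta r s w)) =
  Ex P (fun w => a w * b w) * overlap p q r s.
Proof.
move=> ea eb pr.
have p0 := el_ge0 ea; have pq := el_le ea; have r0 := el_ge0 eb; have rs := el_le eb.
have iab := el_prod_L1 ea eb.
have [rs'|rs'] := eqVneq r s.
  rewrite /overlap -rs' (max_idPr pr) (max_idPl _) ?mulr0; last first.
    by rewrite subr_le0 ge_min lexx orbT.
  rewrite (eq_Ex P (W := fun=> 0)) ?Ex_cst// => w.
  by rewrite incrementxx !mulr0.
have {}rs' : r < s by rewrite lt_neqAle rs'.
have [pq'|pq'] := eqVneq p q.
  rewrite /overlap -pq' (max_idPr pr) (max_idPl _) ?mulr0; last first.
    by rewrite subr_le0 ge_min pr.
  rewrite (eq_Ex P (W := fun=> 0)) ?Ex_cst// => w.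
  by rewrite incrementxx mulr0 mul0r.
have {}pq' : p < q by rewrite lt_neqAle pq'.
have sa u : p <= u -> sig_measurable (enl u) a.
  move=> pu; apply: sub_sig_measurable (el_adapted ea pq'); exact: enlarged_mono.
have sb u : r <= u -> sig_measurable (enl u) b.
  move=> ru; apply: sub_sig_measurable (el_adapted eb rs'); exact: enlarged_mono.
have sab u : p <= u -> r <= u -> sig_measurable (enl u) (fun w => a w * b w).
  by move=> pu ru; apply: sig_measurable_mul; [exact: sa|exact: sb].
have i1 u u' : 0 <= u -> u <= u' -> L1 P (fun w => a w * b w * Delta u u' w).
  move=> u0 uu'; apply: (el_mul_L1 ea eb); apply: L1_of_sq; last exact: increment_sq_L1.
  by apply: (increment_measurable B_bm) => //; exact: le_trans uu'.
have [qr|rq] := leP q r.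
  rewrite /overlap (max_idPr pr) (max_idPl _) ?mulr0; last first.
    by rewrite subr_le0 ge_min qr.
  have [_ E] := martingale_mul r0 rs (i1 _ _ p0 pq)
    (fun _ => sig_measurable_mul (sab r pr (lexx r)) (increment_sig p0 pq qr)).
  by rewrite -[RHS]E; apply: eq_Ex => w; rewrite mulrACA mulrA.
have rq' := ltW rq.
have [j1 E1] := martingale_mul r0 rs (i1 _ _ p0 pr)
    (fun _ => sig_measurable_mul (sab r pr (lexx r)) (increment_sig p0 pr (lexx r))).
rewrite /overlap (max_idPr pr).
have [qs|sq] := leP q s.
  have [j2 E2] := quadratic_mul r0 rq' iab (fun _ => sab r pr (lexx r)).
  have [j3 E3] := martingale_mul (le_trans r0 rq') qs (i1 _ _ r0 rq')
    (fun _ => sig_measurable_mul (sab q pq rq') (increment_sig r0 rq' (lexx q))).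
  rewrite (max_idPr _) ?subr_ge0// -E2 -[RHS]add0r -E1 -[RHS]addr0 -E3.
  rewrite -Ex_add// -Ex_add//; last exact: L1_add.
  by apply: eq_Ex => w; rewrite (increment_cat p r q) (increment_cat r q s); ring.
have sq' := ltW sq.
have [j2 E2] := quadratic_mul r0 rs iab (fun _ => sab r pr (lexx r)).
have [j3 E3] := martingale_mul (le_trans r0 rs) sq' (i1 _ _ r0 rs)
  (fun _ => sig_measurable_mul (sab s (le_trans pr rs) rs) (increment_sig r0 rs (lexx s))).
rewrite (max_idPr _) ?subr_ge0// -E2 -[RHS]add0r -E1 -[RHS]addr0 -E3.
rewrite -Ex_add// -Ex_add//; last exact: L1_add.
by apply: eq_Ex => w; rewrite (increment_cat p r q) (increment_cat r s q); ring.
Qed.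

Variables (I : finType) (a : I -> T -> R) (p q : I -> R).
Hypothesis el : forall l, elementary (a l) (p l) (q l).

Definition elementary_integral w : R := \sum_l a l w * Delta (p l) (q l) w.

Definition quadratic_variation w : R :=
  \sum_l \sum_m a l w * a m w * overlap (p l) (q l) (p m) (q m).

Lemma elementary_integral_sq_E w : elementary_integral w ^+ 2 =
  \sum_l \sum_m a l w * Delta (p l) (q l) w * (a m w * Delta (p m) (q m) w).
Proof. by rewrite /elementary_integral expr2 mulr_suml; apply: eq_bigr => l _; rewrite mulr_sumr. Qed.

Lemma elementary_integral_sq_L1 : L1 P (fun w => elementary_integral w ^+ 2).
Proof.
rewrite (funext elementary_integral_sq_E).
by apply: L1_sum => l; apply: L1_sum => m; exact: elementary_pair_L1.
Qed.

Lemma elementary_integral_measurable : measurable_fun setT elementary_integral.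
Proof.
apply: measurable_sum => l; apply: measurable_funM; first exact: el_measurable (el l).
apply: (increment_measurable B_bm); first exact: el_ge0 (el l).
by apply: le_trans (el_le (el l)); exact: el_ge0 (el l).
Qed.

Lemma quadratic_variation_L1 : L1 P quadratic_variation.
Proof.
apply: L1_sum => l; apply: L1_sum => m.
by have := L1_scale (overlap (p l) (q l) (p m) (q m)) (el_prod_L1 (el l) (el m));
  under eq_fun do rewrite mulrC.
Qed.

(** The intervals may overlap: [quadratic_variation] runs over all pairs, so integrands on different
    subdivisions can be subtracted without a common refinement. *)
Lemma ito_isometry :
  Ex P (fun w => elementary_integral w ^+ 2) = Ex P quadratic_variation.
Proof.
have iov l m : L1 P (fun w => a l w * a m w * overlap (p l) (q l) (p m) (q m)).
  by have := L1_scale (overlap (p l) (q l) (p m) (q m)) (el_prod_L1 (el l) (el m));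
    under eq_fun do rewrite mulrC.
rewrite (eq_Ex P elementary_integral_sq_E) Ex_sum; last first.
  by move=> l; apply: L1_sum => m; exact: elementary_pair_L1.
rewrite /quadratic_variation Ex_sum; last by move=> l; exact: L1_sum.
apply: eq_bigr => l _; rewrite !Ex_sum//; last by move=> m; exact: elementary_pair_L1.
apply: eq_bigr => m _.
have -> : Ex P (fun w => a l w * a m w * overlap (p l) (q l) (p m) (q m)) =
    Ex P (fun w => a l w * a m w) * overlap (p l) (q l) (p m) (q m).
  rewrite mulrC -Ex_scale; last exact: el_prod_L1 (el l) (el m).
  by apply: eq_Ex => w; rewrite mulrC.
have [pp|/ltW pp] := leP (p l) (p m); first exact: elementary_pair.
rewrite overlapC (eq_Ex P (W := fun w => a m w * Delta (p m) (q m) w * (a l w * Delta (p l) (q l) w))).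
  rewrite elementary_pair//; congr (_ * _); apply: eq_Ex => w; exact: mulrC.
by move=> w; exact: mulrC.
Qed.

End isometry.

(** The integral of a nonnegative function is a supremum over the simple functions below it, hence
    monotone also for functions not known to be measurable, such as the integrands in
    [is_ito_integral]. *)
Lemma ge0_le_lower_integral {d} {T : measurableType d} {R : realType}
    (mu : {measure set T -> \bar R}) (D : set T) (f g : T -> \bar R) : measurable D ->
  (forall x, D x -> (0 <= f x)%E) -> (forall x, D x -> (f x <= g x)%E) ->
  (\int[mu]_(x in D) f x <= \int[mu]_(x in D) g x)%E.
Proof.
move=> mD f0 fg.
rewrite ge0_integralE// ge0_integralE; last first.
  by move=> x Dx; apply: le_trans (fg x Dx); exact: f0.
apply: le_ereal_sup => _ [h hf <-]; exists h => //= x.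
apply: le_trans (hf x) _; rewrite !patchE; case: ifP => // xD.
by apply: fg; move: xD; rewrite inE.
Qed.

(** * Regime changes inside a grid cell *)

Section jumps.
Context {d : measure_display} {T : measurableType d} {R : realType}.
Variables (P : probability T R) (B : R -> T -> R) (eps : R -> T -> 'I_2) (lambda : 'I_2 -> R).
Hypotheses (P_complete : measure_is_complete P) (lambda_gt0 : forall i, 0 < lambda i)
  (B_bm : brownian_motion P B)
  (eps_mc : markov_chain P (generator_matrix lambda) eps)
  (B_eps_indep : independent_systems P
     (process_sigma measurable B `[0, +oo[) (process_sigma setT eps `[0, +oo[)).
Local Notation Lam := (lambda ord0 + lambda ord_max).

Let Lam0 : 0 <= Lam. Proof. by rewrite addr_ge0// ltW. Qed.

Lemma eps_change_measurable s t : 0 <= s -> 0 <= t -> measurable [set w | eps s w != eps t w].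
Proof.
move=> s0 t0.
have -> : [set w | eps s w != eps t w] =
    \bigcup_(i in [set: 'I_2]) (eps s @^-1` [set i] `&` eps t @^-1` [set rev_ord i]).
  apply/seteqP; split => [w /= st|w [i _ [/= <- e]]].
    by exists (eps s w) => //; split => //=; rewrite eq_sym in st; exact: ord2_neq.
  by rewrite e eq_sym rev_ord2_neq.
apply: fin_bigcup_measurable; first exact: finite_finset.
by move=> i _; apply: measurableI; exact: (eps_preimage_measurable eps_mc).
Qed.

Lemma eps_change_le s t : 0 <= s -> s <= t ->
  (P [set w | eps s w != eps t w] <= (Lam * (t - s))%:E)%E.
Proof.
move=> s0 st; have t0 : 0 <= t by exact: le_trans st.
pose A (i : 'I_2) := eps s @^-1` [set i] `&` eps t @^-1` [set rev_ord i].
have mA i : measurable (A i).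
  by apply: measurableI; exact: (eps_preimage_measurable eps_mc).
have -> : [set w | eps s w != eps t w] = A ord0 `|` A ord_max.
  apply/seteqP; split => [w /= h'|w [[/= -> ->]|[/= -> ->]]]; rewrite ?[_ != rev_ord _]eq_sym ?rev_ord2_neq//.
  have e : eps t w = rev_ord (eps s w) by apply: ord2_neq; rewrite eq_sym.
  by have [e0|e0] := ord2P (eps s w); [left|right]; split; rewrite /= ?e e0.
apply: le_trans (measureU2 _ (mA _) (mA _)) _.
have PA i : (P (A i) <= (lambda i * (t - s))%:E)%E.
  have := @eps_conditional _ _ _ P B eps lambda P_complete lambda_gt0 B_bm eps_mc B_eps_indep
    s t i setT s0 st (@sigmaT _ _).
  rewrite !setTI => ->.
  have q0 := @transition_rev_ge0 _ _ lambda_gt0 (t - s) i ltac:(by rewrite subr_ge0).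
  apply: (@le_trans _ _ ((transition (generator_matrix lambda) (t - s) i (rev_ord i))%:E * 1)%E).
    apply: lee_pmul => //; apply: probability_le1; exact: (eps_preimage_measurable eps_mc).
  by rewrite mule1 lee_fin transition_rev_le.
by rewrite mulrDl EFinD; apply: leeD; exact: PA.
Qed.

Lemma probability_bigsetU (A : nat -> set T) (c : R) (n : nat) :
  (forall k, measurable (A k)) -> (forall k, (k < n)%N -> (P (A k) <= c%:E)%E) ->
  (P (\big[setU/set0]_(k < n) A k) <= (n%:R * c)%:E)%E.
Proof.
move=> mA; elim: n => [|n IH] PA; first by rewrite big_ord0 measure0 mul0r.
rewrite big_ord_recr/=; apply: le_trans (measureU2 _ _ (mA n)) _.
  exact: bigsetU_measurable.
rewrite -natr1 mulrDl mul1r EFinD; apply: leeD; last exact: PA.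
by apply: IH => k kn; apply: PA; exact: ltnW.
Qed.

Definition right_continuous_path w := forall t : R, 0 <= t ->
  \forall s \near t^'+, eps s w = eps t w.

(* The regime is compared along dyadic subdivisions only; right continuity of the path
   does the rest. *)
Lemma jump_set (s h : R) : 0 <= s -> 0 < h -> exists J : set T,
  [/\ measurable J, (P J <= (Lam * h)%:E)%E &
      forall w r, right_continuous_path w -> ~ J w -> s <= r <= s + h -> eps r w = eps s w].
Proof.
move=> s0 h0.
pose dt n := h / 2 ^+ n.
have dt0 n : 0 < dt n by rewrite divr_gt0// exprn_gt0.
pose u n k := s + k%:R * dt n.
have u0 n k : 0 <= u n k by rewrite addr_ge0// mulr_ge0// ltW.
have uS n k : u n k.+1 - u n k = dt n by rewrite /u -natr1; ring.
(* The switches seen on the dyadic subdivision of level [n]. The union bound over [2 ^ n] cells of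
   length [h / 2 ^ n] gives [Lam h] at every level, and the sets increase with [n]. *)
pose Jn n := \big[setU/set0]_(k < 2 ^ n) [set w | eps (u n k) w != eps (u n k.+1) w].
have JnE n : Jn n = \bigcup_(k < 2 ^ n) [set w | eps (u n k) w != eps (u n k.+1) w].
  by rewrite bigcup_mkord.
have mJn n : measurable (Jn n).
  by apply: bigsetU_measurable => k _; exact: eps_change_measurable.
have PJn n : (P (Jn n) <= (Lam * h)%:E)%E.
  have -> : Lam * h = (2 ^ n)%:R * (Lam * dt n).
    by rewrite /dt natrX mulrCA [_ * (h / _)]mulrCA divff ?mulr1// gt_eqF// exprn_gt0.
  apply: (@probability_bigsetU (fun k => [set w | eps (u n k) w != eps (u n k.+1) w])).
    by move=> k; exact: eps_change_measurable.
  move=> k _.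
  rewrite -(uS n k); apply: eps_change_le => //.
  by rewrite -subr_ge0 uS ltW.
have noJ n w : ~ Jn n w -> forall k, (k <= 2 ^ n)%N -> eps (u n k) w = eps s w.
  move=> nJ; elim=> [|k IH] kn; first by rewrite /u mul0r addr0.
  rewrite -IH; last exact: ltnW.
  apply/esym/eqP/negPn/negP => ne; apply: nJ.
  by rewrite JnE; exists k.
have u_double n k : u n.+1 (2 * k)%N = u n k.
  rewrite /u /dt natrM exprS; congr (_ + _); field.
  by rewrite gt_eqF// exprn_gt0.
have ndJ : nondecreasing_seq Jn.
  apply/nondecreasing_seqP => n; rewrite subsetEset => w Jw.
  apply: contrapT => nJ; move: Jw; rewrite JnE => -[k kn /=].
  have E m : (m <= 2 ^ n)%N -> eps (u n m) w = eps s w.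
    move=> mn; rewrite -u_double; apply: noJ nJ _ _.
    by rewrite expnS leq_mul2l mn.
  by rewrite !E ?eqxx//; exact: ltnW.
exists (\bigcup_n Jn n); split.
- exact: bigcupT_measurable.
- have cvgJ := nondecreasing_cvg_mu mJn (bigcupT_measurable _ mJn) ndJ (mu := P).
  have H : \forall n \near \oo, ((P \o Jn) n <= (Lam * h)%:E)%E by exact: nearW.
  exact: (cvge_to_le cvgJ H).
- move=> w r rc nJ /andP[sr rsh].
  have nJn n : ~ Jn n w by move=> Jw; apply: nJ; exists n.
  (* The endpoint is itself a dyadic point; every other [r] has room for one on its right. *)
  have [->|rh] := eqVneq r (s + h).
    have := noJ 0%N w (nJn 0%N) 1%N (leqnn _).
    by rewrite /u /dt expr0 divr1 mul1r.
  have {}rh : r < s + h by rewrite lt_neqAle rh.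
  have r0 : 0 <= r by exact: le_trans sr.
  have := rc r r0; rewrite /at_right /= => -[e /= e0 He].
  pose m := Num.min e (s + h - r).
  have m0 : 0 < m by rewrite lt_min e0 subr_gt0.
  have [n nm] : exists n, dt n < m.
    exists (Num.truncn (h / m)).+1; rewrite /dt ltr_pdivrMr ?exprn_gt0// mulrC -ltr_pdivrMr//.
    apply: lt_trans (truncnS_gt _) _.
    by rewrite -natrX ltr_nat ltn_expl.
  (* [u n k] is the first subdivision point strictly after [r], at distance at most [dt n]. *)
  pose k := (Num.truncn ((r - s) / dt n)).+1.
  have k1 : (r - s) / dt n < k%:R by exact: truncnS_gt.
  have k2 : k%:R <= (r - s) / dt n + 1.
    rewrite /k -natr1 lerD2r truncn_le.
    by rewrite divr_ge0 ?subr_ge0// ltW.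
  rewrite ltr_pdivrMr// in k1.
  have {}k2 : k%:R * dt n <= r - s + dt n.
    by rewrite (le_trans (ler_wpM2r (ltW (dt0 n)) k2))// mulrDl divfK ?mul1r// gt_eqF.
  have hm : dt n < e /\ dt n < s + h - r.
    by split; apply: (lt_le_trans nm); rewrite /m ge_min lexx ?orbT.
  have kn : (k <= 2 ^ n)%N.
    rewrite -(ler_nat R) natrX -(ler_pM2r (dt0 n)).
    rewrite [leRHS](_ : _ = h); last by rewrite /dt mulrC divfK// gt_eqF// exprn_gt0.
    by case: hm; lra.
  rewrite -(noJ n w (nJn n) k kn); apply/esym/He; rewrite /u /=.
    by rewrite /ball /= ltr_norml; case: hm => *; apply/andP; split; lra.
  by lra.
Qed.

Lemma jump_set_total (s h : R) : 0 <= s -> 0 < h -> exists J : set T,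
  [/\ measurable J, (P J <= (Lam * h)%:E)%E &
      forall w r, ~ J w -> s <= r <= s + h -> eps r w = eps s w].
Proof.
move=> s0 h0; have [J [mJ PJ HJ]] := jump_set s0 h0.
have [N [mN PN HN]] := mc_right_continuous eps_mc.
exists (J `|` N); split; first exact: measurableU.
  by rewrite (measureU0 mJ mN PN).
move=> w r nJN; apply: HJ; last by move=> Jw; apply: nJN; left.
by apply: contrapT => nrc; apply: nJN; right; exact: HN.
Qed.

End jumps.

Section pathwise.
Context {R : realType}.
Notation mu := (@lebesgue_measure R).

Lemma integral_elementary (a p q t : R) : 0 <= p -> q <= t ->
  (\int[mu]_(s in `[0%R, t]) (a * \1_(`]p, q]) s)%:E = (a * Num.max 0 (q - p))%:E)%E /\
  mu.-integrable `[0%R, t] (fun s => (a * \1_(`]p, q]) s)%:E).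
Proof.
move=> p0 qt.
have mI : measurable (`]p, q] : set R) by exact: measurable_itv.
have sub : (`]p, q]%classic `&` `[0, t]%classic = `]p, q]%classic :> set R).
  apply/setIidPl => s /=; rewrite !in_itv/= => /andP[ps sq].
  by rewrite (le_trans sq qt) (le_trans p0 (ltW ps)).
have muE : mu `]p, q]%classic = (Num.max 0 (q - p))%:E.
  rewrite lebesgue_measure_itv/= lte_fin; case: ltP => pq.
    by rewrite -EFinB (max_idPr _)// subr_ge0 ltW.
  by rewrite (max_idPl _)// subr_le0.
have E1 : (\int[mu]_(s in `[0%R, t]) (\1_(`]p, q]) s)%:E = (Num.max 0 (q - p))%:E)%E.
  by rewrite integral_indic//; etransitivity; [exact: (congr1 mu sub)|exact: muE].
have I1 : mu.-integrable `[0%R, t] (fun s => (\1_(`]p, q]) s)%:E).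
  apply/integrableP; split.
    by apply/measurable_EFinP; exact: measurable_indic.
  under eq_integral do rewrite gee0_abs ?lee_fin//.
  by rewrite E1 ltry.
split.
  under eq_integral do rewrite EFinM.
  by rewrite integralZl// E1.
exact: (@integrableZl _ _ _ mu `[0%R, t] (measurable_itv _) a (fun s => (\1_(`]p, q]) s)%:E) I1).
Qed.

Lemma indic_overlap (p q r s z : R) :
  \1_(`]p, q]) z * \1_(`]r, s]) z = \1_(`](Num.max p r), (Num.min q s)]) z :> R.
Proof.
rewrite !indicE !mem_setE !in_itv/= gt_max le_min.
by case: (p < z); case: (r < z); case: (z <= q); case: (z <= s); rewrite /= ?mulr0 ?mul0r ?mulr1.
Qed.

Variables (I : finType) (a p q : I -> R) (t : R).
Hypotheses (p0 : forall l, 0 <= p l) (qt : forall l, q l <= t).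

Definition step_fun (s : R) : R := \sum_l a l * \1_(`](p l), (q l)]) s.

Lemma step_fun_sqE s : step_fun s ^+ 2 = \sum_l \sum_m a l * a m *
  \1_(`](Num.max (p l) (p m)), (Num.min (q l) (q m))]) s.
Proof.
rewrite expr2 mulr_suml; apply: eq_bigr => l _; rewrite mulr_sumr; apply: eq_bigr => m _.
by rewrite mulrACA indic_overlap.
Qed.

Lemma integral_step_sq :
  (\int[mu]_(s in `[0%R, t]) (step_fun s ^+ 2)%:E =
    (\sum_l \sum_m a l * a m * overlap (p l) (q l) (p m) (q m))%:E)%E /\
  mu.-integrable `[0%R, t] (fun s => (step_fun s ^+ 2)%:E).
Proof.
have H l m := @integral_elementary (a l * a m) (Num.max (p l) (p m)) (Num.min (q l) (q m)) t
  ltac:(by rewrite le_max p0) ltac:(by rewrite ge_min qt).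
have E : (fun s => (step_fun s ^+ 2)%:E) = (fun s => \sum_l \sum_m (a l * a m *
    \1_(`](Num.max (p l) (p m)), (Num.min (q l) (q m))]) s)%:E)%E.
  apply/funext => s; rewrite step_fun_sqE -sumEFin; apply: eq_bigr => l _.
  by rewrite -sumEFin.
rewrite E; split.
  rewrite integral_sum//=; last first.
    by move=> l; apply: integrable_sum => // m _; have [] := H l m.
  rewrite -sumEFin; apply: eq_bigr => l _.
  rewrite integral_sum//=; last by move=> m; have [] := H l m.
  by rewrite -sumEFin; apply: eq_bigr => m _; have [] := H l m.
by apply: integrable_sum => // l _; apply: integrable_sum => // m _; have [] := H l m.
Qed.

Lemma integral_step :
  (\int[mu]_(s in `[0%R, t]) (step_fun s)%:E = (\sum_l a l * Num.max 0 (q l - p l))%:E)%E /\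
  mu.-integrable `[0%R, t] (fun s => (step_fun s)%:E).
Proof.
have H l := @integral_elementary (a l) (p l) (q l) t (p0 l) (qt l).
have E : (fun s => (step_fun s)%:E) = (fun s => \sum_l (a l * \1_(`](p l), (q l)]) s)%:E)%E.
  by apply/funext => s; rewrite -sumEFin.
rewrite E; split.
  rewrite integral_sum//=; last by move=> l; have [] := H l.
  by rewrite -sumEFin; apply: eq_bigr => l _; have [] := H l.
by apply: integrable_sum => // l _; have [] := H l.
Qed.

End pathwise.

(* The right-hand integrand need not be measurable: its integral is only a lower
   integral, which is monotone. *)
Lemma integral_le_lower {d} {T : measurableType d} {R : realType}
    (mu : {measure set T -> \bar R}) (D : set T) (f : T -> R) (g : T -> \bar R) :
  measurable D -> mu.-integrable D (EFin \o f) ->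
  (forall x, D x -> (0 <= g x)%E) -> (forall x, D x -> ((f x)%:E <= g x)%E) ->
  (\int[mu]_(x in D) (f x)%:E <= \int[mu]_(x in D) g x)%E.
Proof.
move=> mD intf g0 fg; rewrite integralE.
apply: (@le_trans _ _ (\int[mu]_(x in D) (fun x => (f x)%:E)^\+ x)%E).
  by rewrite leeBlDr ?integrable_neg_fin_num// leeDl// integral_ge0.
apply: ge0_le_lower_integral => // x Dx.
by rewrite funeposE ge_max fg// g0.
Qed.

(** * Mean-square error of the Euler scheme *)

Section ito.
Context {d : measure_display} {T : measurableType d} {R : realType}.
Variables (P : probability T R) (B : R -> T -> R) (eps : R -> T -> 'I_2)
  (lambda sigma : 'I_2 -> R).
Hypotheses (P_complete : measure_is_complete P) (lambda_gt0 : forall i, 0 < lambda i)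
  (B_bm : brownian_motion P B)
  (eps_mc : markov_chain P (generator_matrix lambda) eps)
  (B_eps_indep : independent_systems P
     (process_sigma measurable B `[0, +oo[) (process_sigma setT eps `[0, +oo[)).
Local Notation Fil := (augmented_filtration P B eps).
Local Notation mu := (@lebesgue_measure R).
Variables (x : R) (X : R -> T -> R).
Hypothesis X_sde : regime_switching_diffusion P Fil sigma B eps x X.

Lemma augmented_measurable s : Fil s `<=` measurable.
Proof.
by apply: subset_trans (@augmented_enlarged _ _ _ P B eps s) _;
  exact: (enlarged_measurable P_complete B_bm eps_mc).
Qed.

Lemma diffusion_measurable t : 0 <= t -> measurable_fun setT (X t).
Proof.
move=> t0 _ C mC; rewrite setTI; apply: (@augmented_measurable t).
exact: rsd_adapted X_sde t t0 C mC.
Qed.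

Definition jump_sq : R := (sigma ord0 - sigma ord_max) ^+ 2.
Definition jump_rate : R := lambda ord0 + lambda ord_max.

Lemma sigma_dist i j : (sigma i - sigma j) ^+ 2 <= jump_sq.
Proof.
by have [->|->] := ord2P i; have [->|->] := ord2P j;
  rewrite ?subrr ?expr0n /= ?sqr_ge0// -sqrrN opprB.
Qed.

Section approximation.
Variables (h : R) (N : nat) (phi : simple_process Fil).
Hypothesis h_gt0 : 0 < h.
Local Notation t := (grid h N).
Local Notation I := ('I_(sp_size phi) + 'I_N)%type.

(* The simple process [phi] minus the frozen coefficient of the Euler scheme, as one
   family of elementary integrands. *)
Definition gap_start (l : I) : R := match l with
  | inl k => Num.min (sp_time phi k) t | inr j => grid h j end.
Definition gap_stop (l : I) : R := match l with
  | inl k => Num.min (sp_time phi k.+1) t | inr j => grid h j.+1 end.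
Definition gap_coef (l : I) (w : T) : R := match l with
  | inl k => sp_coef phi k w | inr j => - sigma (eps (grid h j) w) end.

Lemma gap_start_ge0 l : 0 <= gap_start l.
Proof. by case: l => [k|j] /=; rewrite ?le_min ?sp_time_ge0 ?grid_ge0. Qed.

Lemma gap_le l : gap_start l <= gap_stop l.
Proof.
case: l => [k|j] /=; last exact/ltW/grid_lt.
by rewrite le_min !ge_min sp_time_nondecreasing lexx orbT.
Qed.

Lemma gap_stop_le l : gap_stop l <= t.
Proof. by case: l => [k|j] /=; rewrite ?ge_min ?lexx ?orbT//; exact: grid_le. Qed.

Lemma approximation_elementary l : elementary P B eps (gap_coef l) (gap_start l) (gap_stop l).
Proof.
split; [exact: gap_start_ge0|exact: gap_le| | |].
- case: l => [k|j] /=.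
    move=> _ C mC; rewrite setTI; apply: (@augmented_measurable (sp_time phi k)).
    exact: sp_coef_measurable.
  exact: (sigma_eps_measurable eps_mc (fun i => - sigma i) (grid_ge0 h_gt0 j)).
- case: l => [k|j] /=; first exact: sp_coef_bounded.
  exists (`|- sigma ord0| + `|- sigma ord_max|) => w.
  exact: (ord2_bound (fun i => - sigma i)).
(* If [sp_time k] lies beyond the horizon, truncation makes the interval empty and contradicts [pq];
   otherwise the coefficient is known at the start of the interval. *)
- case: l => [k|j] /= pq C mC; apply: augmented_enlarged.
    have kt : sp_time phi k < t.
      rewrite ltNge; apply/negP => tk; move: pq.
      by rewrite (min_idPr tk) (min_idPr (le_trans tk (sp_time_nondecreasing _ _))) ltxx.
    by rewrite (min_idPl (ltW kt)); exact: sp_coef_measurable.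
  move: (@sig_measurable_eps _ _ _ P B eps (fun i => - sigma i) _ _ (grid_ge0 h_gt0 j) (lexx _) C).

  by [].
Qed.

Lemma approximation_integral w : elementary_integral B gap_coef gap_start gap_stop w =
  sp_integral phi B t w - (euler B eps sigma x h N w - x).
Proof.
rewrite /elementary_integral big_sumType/= /euler [x + _]addrC addrK -sumrN; congr (_ + _).
by apply: eq_bigr => j _; rewrite mulNr.
Qed.

Lemma approximation_step w s : 0 <= s <= t ->
  step_fun (gap_coef ^~ w) gap_start gap_stop s = sp_value phi s w -
    \sum_(j < N) sigma (eps (grid h j) w) * \1_(`](grid h j), (grid h j.+1)]) s.
Proof.
move=> /andP[s0 st]; rewrite /step_fun big_sumType/= -sumrN; congr (_ + _).
  apply: eq_bigr => k _; congr (_ * _); rewrite !indicE !mem_setE !in_itv/=.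
  rewrite gt_min le_min st andbT; congr (_%:R); congr (nat_of_bool _); congr (_ && _).
  by case: (ltP (sp_time phi k) s) => //= _; rewrite ltNge st.
by apply: eq_bigr => j _; rewrite mulNr.
Qed.

Lemma grid_locate (s : R) : 0 < s <= t -> exists j : 'I_N, grid h j < s <= grid h j.+1.
Proof.
move=> /andP[s0]; elim: N => [|n IH] st.
  by move: st; rewrite /grid mul0r leNgt s0.
have [sn|ns] := leP s (grid h n).
  by have [j hj] := IH sn; exists (widen_ord (leqnSn n) j).
by exists ord_max; rewrite /= ns st.
Qed.

Lemma grid_indic (s : R) (c : nat -> R) (j : 'I_N) : grid h j < s <= grid h j.+1 ->
  \sum_(i < N) c i * \1_(`](grid h i), (grid h i.+1)]) s = c j.
Proof.
move=> /andP[js sj]; rewrite (bigD1 j)//= big1 ?addr0; last first.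
  move=> i ij; rewrite indicE mem_setE in_itv/=.
  have [ji|ji|/val_inj ji] := ltngtP (j : nat) i.
  - by rewrite ltNge (le_trans sj) ?mulr0//; exact: grid_le.
  - rewrite andbC leNgt (le_lt_trans _ js) ?mulr0//; exact: grid_le.
  - by rewrite ji eqxx in ij.
by rewrite indicE mem_setE in_itv/= js sj mulr1.
Qed.

Lemma approximation_le w (J : nat -> set T) :
  (forall j w r, ~ J j w -> grid h j <= r <= grid h j + h -> eps r w = eps (grid h j) w) ->
  ((2^-1 * quadratic_variation gap_coef gap_start gap_stop w - jump_sq * h * \sum_(j < N) \1_(J j) w)%:E <=
   \int[mu]_(s in `[0%R, t]) ((sigma (eps s w) - sp_value phi s w) ^+ 2)%:E)%E.
Proof.
move=> HJ.
pose F1 s := step_fun (gap_coef ^~ w) gap_start gap_stop s ^+ 2.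
pose c (j : 'I_N) := jump_sq * \1_(J j) w.
pose F2 := step_fun c (fun j => grid h j) (fun j => grid h j.+1).
have [E1 i1] := integral_step_sq (gap_coef ^~ w) gap_start_ge0 gap_stop_le.
have [E2 i2] := @integral_step _ _ c (fun j => grid h j) (fun j => grid h j.+1) t
  (fun j => grid_ge0 h_gt0 j) (fun j => grid_le h_gt0 (ltn_ord j)).
have [i1' i2'] : mu.-integrable `[0%R, t] (fun s => (2^-1 * F1 s)%:E) /\
    mu.-integrable `[0%R, t] (fun s => (F2 s)%:E).
  split=> //.
  exact: (@integrableZl _ _ _ mu `[0%R, t] (measurable_itv _) 2^-1 (fun s => (F1 s)%:E) i1).
have <- : (\int[mu]_(s in `[0%R, t]) (2^-1 * F1 s - F2 s)%:E =
    (2^-1 * quadratic_variation gap_coef gap_start gap_stop w - jump_sq * h * \sum_(j < N) \1_(J j) w)%:E)%E.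
  under eq_integral do rewrite EFinB.
  rewrite integralB_EFin// E2 EFinB; congr (_ - _)%E.
    under eq_integral do rewrite EFinM.
    by rewrite integralZl// E1.
  congr EFin; rewrite mulr_sumr; apply: eq_bigr => j _.
  rewrite gridS [_ + h]addrC addrK (max_idPr (ltW h_gt0)) /c; ring.
apply: integral_le_lower => //.
- exact: (@integrableB _ _ _ mu `[0%R, t] (measurable_itv _) (fun s => (2^-1 * F1 s)%:E) (fun s => (F2 s)%:E)).
- by move=> s _; rewrite lee_fin sqr_ge0.
move=> s /=; rewrite in_itv/= => sint; rewrite lee_fin /F1 approximation_step//.
(* 0 belongs to none of the half-open intervals, so all the step functions vanish there. *)
have [s0|s0] := eqVneq s 0.
  have z (p' q' : R) : 0 <= p' -> \1_(`]p', q']) s = 0 :> R.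
    by move=> p'0; rewrite indicE mem_setE in_itv/= s0 ltNge p'0.
  rewrite /F2 /step_fun /sp_value !big1 ?subr0 ?expr0n/= ?mulr0 ?sub0r ?sqrrN ?sqr_ge0//.
  - by move=> j _; rewrite z ?mulr0// grid_ge0.
  - by move=> j _; rewrite z ?mulr0// grid_ge0.
  - by move=> j _; rewrite z ?mulr0// sp_time_ge0.
have {}s0 : 0 < s <= t.
  by move: sint => /andP[s1 ->]; rewrite lt_neqAle eq_sym s0 s1.
have [j js] := grid_locate s0.
rewrite (grid_indic (fun i => sigma (eps (grid h i) w)) js).
rewrite /F2 /step_fun (grid_indic (fun i => jump_sq * \1_(J i) w) js).
set S := sigma (eps s w); set s' := sp_value phi s w; set G := sigma (eps (grid h j) w).
have SG : (S - G) ^+ 2 <= jump_sq * \1_(J j) w.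
  rewrite indicE; case: (boolP (w \in J j)); first by rewrite mulr1 sigma_dist.
  rewrite notin_setE mulr0 => nJ; rewrite /S /G (HJ j w s nJ) ?subrr ?expr0n//.
  by rewrite -gridS; move: js => /andP[/ltW -> ->].
have := sqr_ge0 ((S - s') - (S - G)); have := sqr_ge0 ((S - s') + (S - G)).
move: SG; rewrite !expr2; lra.
Qed.

End approximation.

End ito.

Section ito_euler.
Context {d : measure_display} {T : measurableType d} {R : realType}.
Variables (P : probability T R) (B : R -> T -> R) (eps : R -> T -> 'I_2)
  (lambda sigma : 'I_2 -> R).
Hypotheses (P_complete : measure_is_complete P) (lambda_gt0 : forall i, 0 < lambda i)
  (B_bm : brownian_motion P B)
  (eps_mc : markov_chain P (generator_matrix lambda) eps)
  (B_eps_indep : independent_systems P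
     (process_sigma measurable B `[0, +oo[) (process_sigma setT eps `[0, +oo[)).
Local Notation Fil := (augmented_filtration P B eps).
Local Notation mu := (@lebesgue_measure R).
Variables (x : R) (X : R -> T -> R).
Hypothesis X_sde : regime_switching_diffusion P Fil sigma B eps x X.
Local Notation jump_cost := (jump_sq sigma * jump_rate lambda).

Lemma jump_cost_ge0 : 0 <= jump_cost.
Proof. by rewrite mulr_ge0 ?sqr_ge0// addr_ge0// ltW. Qed.

Variable (h : R).
Hypothesis h_gt0 : 0 < h.


Section gap.
Variables (N : nat) (phi : simple_process Fil).
Local Notation t := (grid h N).
Local Notation coef := (@gap_coef _ _ _ P B eps sigma h N phi).
Local Notation gstart := (@gap_start _ _ _ P B eps h N phi).
Local Notation gstop := (@gap_stop _ _ _ P B eps h N phi).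
Local Notation Y := (euler B eps sigma x h N).
Local Notation el := (approximation_elementary sigma P_complete B_bm eps_mc h_gt0 (N := N) (phi := phi)).

Lemma approximation_Ex :
  ((Ex P (quadratic_variation coef gstart gstop))%:E <=
   2%:E * (\int[P]_w \int[mu]_(s in `[0%R, t]) ((sigma (eps s w) - sp_value phi s w) ^+ 2)%:E) +
   (2 * (jump_cost * h * t))%:E)%E.
Proof.
have /choice[J HJ] j := jump_set_total P_complete lambda_gt0 B_bm eps_mc B_eps_indep
  (grid_ge0 h_gt0 j) h_gt0.
have mJ j : measurable (J j) by have [] := HJ j.
have iQ := quadratic_variation_L1 el.
have iS : L1 P (fun w => \sum_(j < N) \1_(J j) w) by apply: L1_sum => j; exact: L1_indic.
have iQ2 := L1_scale 2^-1 iQ.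
have iS2 := L1_scale (jump_sq sigma * h) iS.
set EG := (\int[P]_w _)%E.
have le1 : ((2^-1 * Ex P (quadratic_variation coef gstart gstop) -
    jump_sq sigma * h * Ex P (fun w => \sum_(j < N) \1_(J j) w))%:E <= EG)%E.
  rewrite -Ex_scale// -Ex_scale// -Ex_sub// -ExE; last exact: L1_sub.
  apply: integral_le_lower => //; first exact: L1_sub.
    by move=> w _; apply: integral_ge0 => s _; rewrite lee_fin sqr_ge0.
  move=> w _; apply: approximation_le => // j w' r; have [_ _] := HJ j; exact.
have le2 : Ex P (fun w => \sum_(j < N) \1_(J j) w) <= jump_rate lambda * t.
  rewrite Ex_sum; last by move=> j; exact: L1_indic.
  apply: (@le_trans _ _ (\sum_(j < N) (jump_rate lambda * h))).
    apply: ler_sum => j _; rewrite Ex_indic// -lee_fin fineK ?fin_num_measure//.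
    by have [] := HJ j.
  by rewrite sumr_const card_ord /grid -[leLHS]mulr_natl mulrCA.
have jh : 0 <= jump_sq sigma * h by rewrite mulr_ge0 ?sqr_ge0// ltW.
have le3 := ler_wpM2l jh le2.
have EG0 : (0 <= EG)%E by apply: integral_ge0 => w _; apply: integral_ge0 => s _; rewrite lee_fin sqr_ge0.
move: le1; case: EG EG0 => [r| |]//; last by move=> _ _; rewrite gt0_muley ?lte_fin// addye// leey.
rewrite !lee_fin => _ le1.
set q := Ex P _ in le1 *; set s := Ex P _ in le1 le2 le3.
have : jump_cost * h * t = jump_sq sigma * h * (jump_rate lambda * t) by ring.
move: le1 le3; lra.
Qed.

Lemma ito_gap_le :
  (\int[P]_w ((X t w - Y w) ^+ 2)%:E <=
   2%:E * (\int[P]_w ((X t w - x - sp_integral phi B t w) ^+ 2)%:E) +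
   2%:E * (2%:E * (\int[P]_w \int[mu]_(s in `[0%R, t]) ((sigma (eps s w) - sp_value phi s w) ^+ 2)%:E) +
   (2 * (jump_cost * h * t))%:E))%E.
Proof.
have iE := elementary_integral_sq_L1 B_bm el.
have mE := elementary_integral_measurable B_bm el.
have mX := diffusion_measurable P_complete B_bm eps_mc X_sde (grid_ge0 h_gt0 N).
have mY : measurable_fun setT Y := L1_measurable (euler_L1 sigma B_bm eps_mc x h_gt0 N).
have mS : measurable_fun setT (sp_integral phi B t).
  rewrite (_ : sp_integral phi B t = fun w => elementary_integral B coef gstart gstop w + (Y w - x)).
    by apply: measurable_funD => //; exact: measurable_funB.
  by apply/funext => w; rewrite (@approximation_integral _ _ _ P B eps sigma x h N phi) subrK.
have m2 (Z : T -> R) : measurable_fun setT Z -> measurable_fun setT (fun w : T => (Z w ^+ 2)%:E).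
  by move=> mZ; apply/measurable_EFinP; exact: measurable_funX.
have mD : measurable_fun setT (fun w => X t w - x - sp_integral phi B t w).
  by apply: measurable_funB => //; exact: measurable_funB.
apply: (@le_trans _ _ (\int[P]_w (2%:E * ((X t w - x - sp_integral phi B t w) ^+ 2)%:E +
   2%:E * (elementary_integral B coef gstart gstop w ^+ 2)%:E))%E).
  apply: ge0_le_integral => //.
  - by move=> w _; rewrite lee_fin sqr_ge0.
  - by apply: m2; exact: measurable_funB.
  - apply: emeasurable_funD; apply: measurable_funeM; exact: m2.
  - move=> w _; rewrite -!EFinM -EFinD lee_fin (@approximation_integral _ _ _ P B eps sigma x h N phi).
    set a := sp_integral _ _ _ _; have := sqr_ge0 (X t w - x - a - (a - (Y w - x))).
    by rewrite !expr2; lra.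
rewrite ge0_integralD//; last 4 first.
- by move=> w _; rewrite -EFinM lee_fin mulr_ge0// sqr_ge0.
- by apply: measurable_funeM; exact: m2.
- by move=> w _; rewrite -EFinM lee_fin mulr_ge0// sqr_ge0.
- by apply: measurable_funeM; exact: m2.
rewrite !ge0_integralZl//; last 4 first.
- exact: m2.
- by move=> w _; rewrite lee_fin sqr_ge0.
- exact: m2.
- by move=> w _; rewrite lee_fin sqr_ge0.
apply: leeD => //; apply: lee_wpmul2l => //.
rewrite ExE// (ito_isometry P_complete B_bm eps_mc B_eps_indep el).
exact: approximation_Ex.
Qed.

End gap.

(** Along the simple processes that define the Ito integral both approximation errors tend to 0, and
    only the cost of the jumps inside cells remains. *)
Lemma ito_euler (N : nat) :
  L1 P (fun w => (X (grid h N) w - euler B eps sigma x h N w) ^+ 2) /\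
  Ex P (fun w => (X (grid h N) w - euler B eps sigma x h N w) ^+ 2) <=
    4 * (jump_cost * h * grid h N).
Proof.
have mD : measurable_fun setT (fun w => (X (grid h N) w - euler B eps sigma x h N w) ^+ 2).
  apply: measurable_funX; apply: measurable_funB.
    exact: (diffusion_measurable P_complete B_bm eps_mc X_sde (grid_ge0 h_gt0 N)).
  exact: L1_measurable (euler_L1 sigma B_bm eps_mc x h_gt0 N).
suff H : (\int[P]_w ((X (grid h N) w - euler B eps sigma x h N w) ^+ 2)%:E <=
    (4 * (jump_cost * h * grid h N))%:E)%E.
  have iD : L1 P (fun w => (X (grid h N) w - euler B eps sigma x h N w) ^+ 2).
    apply/integrableP; split; first exact/measurable_EFinP.
    under eq_integral do rewrite /= ger0_norm ?sqr_ge0//.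
    by apply: le_lt_trans H _; rewrite ltry.
  by split=> //; rewrite -lee_fin -ExE.
have [phi [cG cS]] := rsd_ito X_sde (grid_ge0 h_gt0 N).
pose g (n : nat) : \bar R := (2%:E * (\int[P]_w ((X (grid h N) w - x - sp_integral (phi n) B (grid h N) w) ^+ 2)%:E) +
   2%:E * (2%:E * (\int[P]_w \int[mu]_(s in `[0%R, grid h N])
      ((sigma (eps s w) - sp_value (phi n) s w) ^+ 2)%:E) +
   (2 * (jump_cost * h * grid h N))%:E))%E.
have cg : g n @[n --> \oo] --> (4 * (jump_cost * h * grid h N))%:E.
  rewrite (_ : (4 * _)%:E = 2%:E * 0 + 2%:E * (2%:E * 0 + (2 * (jump_cost * h * grid h N))%:E))%E.
    apply: cvgeD; first by rewrite mule0 fin_num_adde_defr.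
      by apply: cvgeZl => //; exact: cS.
    apply: cvgeZl => //; apply: cvgeD; first by rewrite mule0 fin_num_adde_defr.
      by apply: cvgeZl => //; exact: cG.
    exact: cvg_cst.
  by rewrite !mule0 !add0e -EFinM; congr EFin; ring.
apply: (cvge_to_ge cg); apply: nearW => n; exact: ito_gap_le.
Qed.

End ito_euler.

(** * The gap between diffusion and scheme as a martingale *)

Section gap_martingale.
Context {d : measure_display} {T : measurableType d} {R : realType}.
Variables (P : probability T R) (B : R -> T -> R) (eps : R -> T -> 'I_2)
  (lambda sigma : 'I_2 -> R).
Hypotheses (P_complete : measure_is_complete P) (lambda_gt0 : forall i, 0 < lambda i)
  (B_bm : brownian_motion P B)
  (eps_mc : markov_chain P (generator_matrix lambda) eps)
  (B_eps_indep : independent_systems P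
     (process_sigma measurable B `[0, +oo[) (process_sigma setT eps `[0, +oo[)).
Local Notation Fil := (augmented_filtration P B eps).
Variables (x : R) (X : R -> T -> R).
Hypothesis X_sde : regime_switching_diffusion P Fil sigma B eps x X.
Local Notation jump_cost := (jump_sq sigma * jump_rate lambda).

Lemma filtration_measurable s : Fil s `<=` measurable.
Proof. exact: (augmented_measurable P_complete B_bm eps_mc). Qed.

Lemma euler_martingale h i n (A : set T) : 0 < h -> (i <= n)%N -> Fil (grid h i) A ->
  Ex P (fun w => \1_A w * (euler B eps sigma x h n w - euler B eps sigma x h i w)) = 0.
Proof.
move=> h0 + FA; have mA := filtration_measurable FA.
have iY m := euler_L1 sigma B_bm eps_mc x h0 m.
elim: n => [|n IH]; first by rewrite leqn0 => /eqP ->; by rewrite (eq_Ex P (W := fun=> 0)) ?Ex_cst// => w; rewrite subrr mulr0.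
rewrite leq_eqVlt => /predU1P[->|].
  by rewrite (eq_Ex P (W := fun=> 0)) ?Ex_cst// => w; rewrite subrr mulr0.
rewrite ltnS => i_n; rewrite -[RHS](IH i_n).
have iZ : L1 P (fun w => \1_A w * sigma (eps (grid h n) w)).
  apply: L1_indic_mul => //; apply: (@L1_bounded _ _ _ _ _ (`|sigma ord0| + `|sigma ord_max|)).
    exact: (sigma_eps_measurable eps_mc sigma (grid_ge0 h0 n)).
  by move=> w; exact: ord2_bound.
have sZ : sig_measurable (enlarged P B eps (grid h n)) (fun w => \1_A w * sigma (eps (grid h n) w)).
  apply: sig_measurable_mul.
    apply: sig_measurable_indic; apply: augmented_enlarged.
    exact: (augmented_mono (grid_le h0 i_n) FA).
  move=> C _; apply: augmented_enlarged.
  by move: (@sig_measurable_eps _ _ _ P B eps sigma _ _ (grid_ge0 h0 n) (lexx _) C).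
have [iD ED] := martingale_mul P_complete B_bm eps_mc B_eps_indep (grid_ge0 h0 n)
  (ltW (grid_lt h0 n)) iZ (fun _ => sZ).
rewrite -[RHS]addr0 -ED -Ex_add//; last by apply: L1_indic_mul => //; exact: L1_sub.
by apply: eq_Ex => w; rewrite eulerS; ring.
Qed.

Section mesh.
Variable h : R.
Hypothesis h_gt0 : 0 < h.
Local Notation t := (grid h).
Local Notation D n := (fun w => X (t n) w - euler B eps sigma x h n w).

Lemma gap_measurable n : measurable_fun setT (D n).
Proof.
apply: measurable_funB; first exact: (diffusion_measurable P_complete B_bm eps_mc X_sde (grid_ge0 h_gt0 n)).
exact: L1_measurable (euler_L1 sigma B_bm eps_mc x h_gt0 n).
Qed.

Lemma gap_L1 n : L1 P (D n).
Proof.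
apply: L1_of_sq (gap_measurable n) _.
by have [] := ito_euler P_complete lambda_gt0 B_bm eps_mc B_eps_indep X_sde h_gt0 n.
Qed.

Lemma gap_norm_le n : Ex P (fun w => `|D n w|) <= Num.sqrt (4 * (jump_cost * h * t n)).
Proof.
have [i le] := ito_euler P_complete lambda_gt0 B_bm eps_mc B_eps_indep X_sde h_gt0 n.
exact: le_trans (Ex_sq_le (gap_measurable n) i) (ler_wsqrtr le).
Qed.

Lemma diffusion_L1 n : L1 P (X (t n)).
Proof.
rewrite (_ : X (t n) = fun w => D n w + euler B eps sigma x h n w).
  by apply: L1_add; [exact: gap_L1|exact: (euler_L1 sigma B_bm eps_mc x h_gt0 n)].
by apply/funext => w; rewrite subrK.
Qed.

End mesh.

(* [X] inherits the martingale property from Euler schemes whose meshes refine [h]. *)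
Lemma diffusion_martingale h i n (A : set T) : 0 < h -> (i <= n)%N -> Fil (grid h i) A ->
  Ex P (fun w => \1_A w * (X (grid h n) w - X (grid h i) w)) = 0.
Proof.
move=> h0 i_n FA; have mA := filtration_measurable FA.
set e := Ex P _.
have jc0 : 0 <= jump_cost := jump_cost_ge0 sigma lambda_gt0.
(* The grid of mesh [h / m] contains that of mesh [h], and on it the Euler scheme is a martingale at
   mean distance [O(sqrt (h / m))] from [X]. *)
have H (m : nat) : (0 < m)%N -> `|e| <= 2 * Num.sqrt (4 * (jump_cost * (h / m%:R) * grid h n)).
  move=> m0; have mR : 0 < m%:R :> R by rewrite ltr0n.
  have h'0 : 0 < h / m%:R by rewrite divr_gt0.
  have gE k : grid h k = grid (h / m%:R) (k * m).
    by rewrite /grid natrM; field; rewrite gt_eqF.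
  pose D k w := X (grid (h / m%:R) k) w - euler B eps sigma x (h / m%:R) k w.
  have iD k : L1 P (D k) by exact: gap_L1.
  have le k : (k <= n)%N -> Ex P (fun w => `|D (k * m)%N w|) <=
      Num.sqrt (4 * (jump_cost * (h / m%:R) * grid h n)).
    move=> kn; apply: le_trans (gap_norm_le h'0 (k * m)) _; apply: ler_wsqrtr.
    rewrite -gE ler_wpM2l// ler_wpM2l//; last exact: grid_le.
    by rewrite mulr_ge0// ltW.
  have iY k := euler_L1 sigma B_bm eps_mc x h'0 k.
  have FA' : Fil (grid (h / m%:R) (i * m)) A by rewrite -gE.
  have im : (i * m <= n * m)%N by rewrite leq_mul2r i_n orbT.
  have -> : e = Ex P (fun w => \1_A w * (D (n * m)%N w - D (i * m)%N w)).
    rewrite -[RHS]addr0 -(euler_martingale h'0 im FA') -Ex_add.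
    - by apply: eq_Ex => w; rewrite /D -!gE; ring.
    - by apply: L1_indic_mul => //; exact: L1_sub.
    - by apply: L1_indic_mul => //; exact: L1_sub.
  apply: le_trans (Ex_norm _) _; first by apply: L1_indic_mul => //; exact: L1_sub.
  apply: (@le_trans _ _ (Ex P (fun w => `|D (n * m)%N w| + `|D (i * m)%N w|))).
    apply: Ex_le => [| |w].
    - by apply: L1_norm; apply: L1_indic_mul => //; exact: L1_sub.
    - by apply: L1_add; exact: L1_norm.
    - rewrite normrM indicE; case: (w \in A); rewrite ?normr1 ?mul1r ?ler_normB//.
      by rewrite normr0 mul0r addr_ge0.
  rewrite Ex_add; [|exact: L1_norm|exact: L1_norm].
  by rewrite mulr_natl mulr2n lerD// le.
apply/eqP; rewrite -normr_eq0; apply/negPn/negP => en0.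
have e0 : 0 < `|e| by rewrite lt_neqAle eq_sym en0 normr_ge0.
(* [a / m] is the square of the bound in [H]; [m] is chosen to bring it below [|e|^2]. *)
pose a := 16 * (jump_cost * h * grid h n).
have a0 : 0 <= a by rewrite mulr_ge0// mulr_ge0 ?grid_ge0// mulr_ge0// ltW.
pose m := (Num.truncn (a / `|e| ^+ 2)).+1.
have mR : 0 < m%:R :> R by rewrite ltr0n.
have am : a < m%:R * `|e| ^+ 2 by rewrite -ltr_pdivrMr ?exprn_gt0//; exact: truncnS_gt.
have := H m isT.
rewrite -(ler_pXn2r (n := 2))// ?nnegrE ?mulr_ge0 ?sqrtr_ge0//.
have am0 : 0 <= 4 * (jump_cost * (h / m%:R) * grid h n).
  by rewrite mulr_ge0// mulr_ge0 ?grid_ge0// mulr_ge0// divr_ge0// ltW.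
rewrite exprMn sqr_sqrtr// (_ : 2 ^+ 2 * _ = a / m%:R); last by rewrite /a; ring.
by rewrite leNgt ltr_pdivrMr// mulrC am.
Qed.

Section stopped_gap.
Variable h : R.
Hypothesis h_gt0 : 0 < h.
Local Notation t := (grid h).
Local Notation D n := (fun w => X (t n) w - euler B eps sigma x h n w).

(* The gap is a martingale, so its absolute value is a submartingale: test the former
   on the two parts of [A] where the gap has a constant sign. *)
Lemma gap_indic_le i n (A : set T) : (i <= n)%N -> Fil (t i) A ->
  Ex P (fun w => \1_A w * `|D i w|) <= Ex P (fun w => \1_A w * `|D n w|).
Proof.
move=> i_n FA; have mA := filtration_measurable FA.
pose Q := [set w | 0 <= D i w].
have FQ : Fil (t i) Q.
  pose G := process_events measurable B `[0, t i] `|`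
      process_events setT eps `[0, t i] `|` P.-negligible.
  have sD : sig_measurable G (D i).
    apply: sig_measurable_sub => C mC; first exact: rsd_adapted X_sde _ (grid_ge0 h_gt0 i) _ mC.
    exact: euler_filtration.
  rewrite (_ : Q = D i @^-1` `[0, +oo[%classic); first by apply: sD; exact: measurable_itv.
  by apply/seteqP; split => w /=; rewrite in_itv/= andbT.
have key (E : set T) : Fil (t i) E ->
    Ex P (fun w => \1_E w * D n w) = Ex P (fun w => \1_E w * D i w).
  move=> FE; have mE := filtration_measurable FE.
  have iX m := diffusion_L1 h_gt0 m; have iY m := euler_L1 sigma B_bm eps_mc x h_gt0 m.
  apply/eqP; rewrite -subr_eq0 -Ex_sub; [|by apply: L1_indic_mul => //; exact: gap_L1..].
  rewrite (eq_Ex P (W := fun w => \1_E w * (X (t n) w - X (t i) w) -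
    \1_E w * (euler B eps sigma x h n w - euler B eps sigma x h i w))).
    rewrite Ex_sub; [|by apply: L1_indic_mul => //; exact: L1_sub..].
    by rewrite diffusion_martingale// euler_martingale// subrr.
  by move=> w; ring.
have FAQ : Fil (t i) (A `&` Q) by exact: sigmaI.
have FAQ' : Fil (t i) (A `\` Q) by exact: sigmaD.
have mAQ := filtration_measurable FAQ; have mAQ' := filtration_measurable FAQ'.
have iD m (E : set T) : measurable E -> L1 P (fun w => \1_E w * D m w).
  by move=> mE; apply: L1_indic_mul => //; exact: gap_L1.
rewrite (eq_Ex P (W := fun w => \1_(A `&` Q) w * D i w - \1_(A `\` Q) w * D i w)); last first.
  move=> w; rewrite !indicE in_setI in_setD /Q.
  case: (w \in A); rewrite /= ?mul0r ?subrr//.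
  case: (boolP (w \in _)) => [/set_mem /= Dw|]; rewrite !mul1r mul0r ?subr0 ?sub0r.
    by rewrite ger0_norm.
  by rewrite notin_setE /= => /negP; rewrite -ltNge => Dw; rewrite ltr0_norm.
rewrite Ex_sub; [|exact: iD..]; rewrite -!key// -Ex_sub; [|exact: iD..].
apply: Ex_le => [| |w]; first by apply: L1_sub; exact: iD.
  by apply: L1_indic_mul => //; apply: L1_norm; exact: gap_L1.
rewrite !indicE in_setI in_setD; case: (w \in A); rewrite /= ?mul0r ?subrr//.
by case: (w \in Q); rewrite !mul1r mul0r ?subr0 ?sub0r ?ler_norm// lerNl; have := ler_norm (- D n w);
  rewrite normrN; lra.
Qed.

Variables (kap : T -> nat) (K : nat).
Hypotheses (kapK : forall w, (kap w <= K)%N)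
  (kap_stop : forall n, Fil (t n) [set w | (n < kap w)%N]).

Lemma stopped_index_filtration k : Fil (t k) [set w | kap w = k].
Proof.
rewrite (_ : [set _ | _] = [set w | (k <= kap w)%N] `\` [set w | (k < kap w)%N]).
  apply: sigmaD; last exact: (@kap_stop k).
  case: k => [|k].
    have -> : [set w | (0 <= kap w)%N] = setT by apply/seteqP; split.
    exact: (@sigmaT T _).
  exact: (augmented_mono (ltW (grid_lt h_gt0 k)) (@kap_stop k)).
apply/seteqP; split => w /=; first by move=> ->; rewrite leqnn ltnn; split.
by move=> [kw /negP]; rewrite -leqNgt => wk; apply/eqP; rewrite eqn_leq wk kw.
Qed.

Lemma stopped_index_sum (F : nat -> T -> R) w :
  F (kap w) w = \sum_(k < K.+1) \1_[set w | kap w = k :> nat] w * F k w.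
Proof.
have kK : (kap w < K.+1)%N by rewrite ltnS.
rewrite (bigD1 (Ordinal kK))//= big1 ?addr0; last first.
  move=> k nk; rewrite indicE memNset ?mul0r//= => e; move/eqP: nk; apply.
  exact/val_inj.
by rewrite indicE mem_set// mul1r.
Qed.

Lemma stopped_index_L1 (F : nat -> T -> R) : (forall n, L1 P (F n)) ->
  L1 P (fun w => F (kap w) w).
Proof.
move=> iF; rewrite (funext (stopped_index_sum F)); apply: L1_sum => k.
apply: L1_indic_mul; last exact: iF.
exact: (filtration_measurable (@stopped_index_filtration k)).
Qed.

(** Optional stopping for the submartingale [|X - Y|]: on each event [kap = k] the gap at [k] is
    replaced by the gap at [K], and these events partition the whole space. *)
Lemma gap_stopped : L1 P (fun w => D (kap w) w) /\
  Ex P (fun w => `|D (kap w) w|) <= Num.sqrt (4 * (jump_cost * h * t K)).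
Proof.
have mk k : measurable [set w | kap w = k :> nat].
  exact: (filtration_measurable (@stopped_index_filtration k)).
split; first by apply: (stopped_index_L1 (F := fun n => D n)) => n; exact: gap_L1.
have iF n k : L1 P (fun w => \1_[set w | kap w = k :> nat] w * `|D n w|).
  by apply: L1_indic_mul => //; apply: L1_norm; exact: gap_L1.
rewrite (eq_Ex P (stopped_index_sum (fun n w => `|D n w|))) Ex_sum//.
apply: le_trans (gap_norm_le h_gt0 K).
rewrite (eq_Ex P (W := fun w => \sum_(k < K.+1) \1_[set w | kap w = k :> nat] w * `|D K w|)); last first.
  by move=> w; rewrite -(stopped_index_sum (fun _ w => `|D K w|)).
rewrite Ex_sum//; apply: ler_sum => k _; apply: gap_indic_le; first by rewrite -ltnS.
exact: stopped_index_filtration.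
Qed.

End stopped_gap.

End gap_martingale.

(** * The value function *)

Section payoff.
Context {d : measure_display} {T : measurableType d} {R : realType}.
Variables (P : probability T R) (B : R -> T -> R) (eps : R -> T -> 'I_2)
  (lambda sigma : 'I_2 -> R) (rho : R).
Hypotheses (P_complete : measure_is_complete P) (lambda_gt0 : forall i, 0 < lambda i)
  (sigma_gt0 : forall i, 0 < sigma i) (rho_gt0 : 0 < rho)
  (B_bm : brownian_motion P B)
  (eps_mc : markov_chain P (generator_matrix lambda) eps)
  (B_eps_indep : independent_systems P
     (process_sigma measurable B `[0, +oo[) (process_sigma setT eps `[0, +oo[)).
Variables (k mu : 'I_2 -> R) (v p : 'I_2 -> R -> R) (b : 'I_2 -> R) (C : R).
Hypotheses (k_gt0 : forall i, 0 < k i) (mu_gt0 : forall i, 0 < mu i)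
  (kE : forall i, k i ^+ 2 = 2 * (rho + lambda i) / sigma i ^+ 2)
  (muE : forall i, mu i = 2 * lambda i / sigma i ^+ 2)
  (rs : regime_solution k mu v p b C).
Local Notation Fil := (augmented_filtration P B eps).
Variables (x : R) (X : R -> T -> R).
Hypothesis X_sde : regime_switching_diffusion P Fil sigma B eps x X.
Local Notation jump_cost := (jump_sq sigma * jump_rate lambda).
Variables (h : R).
Hypotheses (h_gt0 : 0 < h) (h_le1 : h <= 1).
Local Notation Y := (euler B eps sigma x h).
Local Notation t := (grid h).
Local Notation disc n := (expR (- (rho * t n))).
Local Notation D n := (fun w => X (t n) w - euler B eps sigma x h n w).
Variable i : 'I_2.
Local Notation D0 := (eps 0 @^-1` [set i]).

Lemma start_filtration : Fil 0 D0.
Proof. exact: eps_past. Qed.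

Lemma start_measurable : measurable D0.
Proof. exact: (eps_preimage_measurable eps_mc). Qed.

Lemma disc_le1 n : disc n <= 1.
Proof. by rewrite -[leRHS]expR0 ler_expR oppr_le0 mulr_ge0 ?grid_ge0// ltW. Qed.

Lemma disc_norm_le n (y : R) : `|disc n * y| <= `|y|.
Proof. by rewrite normrM ger0_norm ?expR_ge0// ler_piMl// disc_le1. Qed.

Lemma L1_disc n Z : L1 P Z -> L1 P (fun w => \1_D0 w * (disc n * Z w)).
Proof. by move=> iZ; apply: L1_indic_mul; [exact: start_measurable|exact: L1_scale]. Qed.

Lemma indic_disc_le n w (y : R) : \1_D0 w * (disc n * y) <= `|y|.
Proof.
apply: le_trans (ler_norm _) _; rewrite normrM indicE.
by case: (w \in _); rewrite ?normr1 ?normr0 ?mul0r// mul1r disc_norm_le.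
Qed.

Section stopped.
Variables (kap : T -> nat) (K : nat).
Hypotheses (kapK : forall w, (kap w <= K)%N)
  (kap_stop : forall n, Fil (t n) [set w | (n < kap w)%N]).

Let D_stopped := gap_stopped P_complete lambda_gt0 B_bm eps_mc B_eps_indep X_sde h_gt0 kapK kap_stop.

Lemma payoff_L1 : L1 P (fun w => \1_D0 w * (disc (kap w) * X (t (kap w)) w)).
Proof.
apply: (stopped_index_L1 P_complete B_bm eps_mc h_gt0 kapK kap_stop
  (F := fun n w => \1_D0 w * (disc n * X (t n) w))) => n.
by apply: L1_disc; exact: (diffusion_L1 P_complete lambda_gt0 B_bm eps_mc B_eps_indep X_sde).
Qed.

Lemma payoff_pos_L1 : L1 P (fun w => \1_D0 w * (disc (kap w) * Num.max 0 (X (t (kap w)) w))).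
Proof.
apply: (@L1_le _ _ _ _ _ (fun w => `|\1_D0 w * (disc (kap w) * X (t (kap w)) w)|)).
- rewrite (_ : (fun _ => _) = fun w => Num.max 0 (\1_D0 w * (disc (kap w) * X (t (kap w)) w))).
    by apply: measurable_maxr => //; exact: L1_measurable payoff_L1.
  by apply/funext => w; rewrite !maxr_pMr ?expR_ge0 ?mulr0 ?indicE.
- move=> w; rewrite !normrM !ler_wpM2l//.
  by rewrite ger0_norm ?le_max ?lexx// ge_max normr_ge0 ler_norm.
- by apply: L1_norm; exact: payoff_L1.
Qed.

(** [v] dominates 0 as well as the payoff, so [max 0 X <= v(Y) + |X - Y|]. The positive part is kept
    because Fatou's lemma will be applied to it. *)
Lemma payoff_upper :
  Ex P (fun w => \1_D0 w * (disc (kap w) * Num.max 0 (X (t (kap w)) w))) <=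
  v i x * fine (P D0) +
    (K%:R * (upper_const lambda sigma k mu C * (h * Num.sqrt h)) +
     Num.sqrt (4 * (jump_cost * h * t K))).
Proof.
have [iD ED] := D_stopped.
have up := stopped_upper P_complete lambda_gt0 sigma_gt0 rho_gt0 B_bm eps_mc B_eps_indep
  k_gt0 mu_gt0 kE muE rs x h_gt0 h_le1 kapK kap_stop start_filtration.
have d0 := discounted0 sigma rho P_complete B_bm eps_mc v x h start_filtration (i := i) (fun _ => id).
have iS := stopped_L1 P_complete lambda_gt0 sigma_gt0 B_bm eps_mc B_eps_indep
  k_gt0 mu_gt0 kE muE rs x h_gt0 h_le1 kapK kap_stop start_filtration.
rewrite d0 in up.
rewrite addrA; apply: le_trans (lerD up ED).
rewrite -Ex_add//; last exact: L1_norm.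
apply: Ex_le; [exact: payoff_pos_L1|by apply: L1_add => //; exact: L1_norm|move=> w].
rewrite /discounted; set n := kap w.
have le1 : Num.max 0 (X (t n) w) <= v (eps (t n) w) (Y n w) + `|D n w|.
  have := rs_ge rs (eps (t n) w) (Y n w); rewrite !ge_max => /andP[v0 vY].
  by rewrite addr_ge0//=; have := ler_norm (D n w); lra.
have le2 : \1_D0 w * (disc n * Num.max 0 (X (t n) w)) <=
    \1_D0 w * (disc n * (v (eps (t n) w) (Y n w) + `|D n w|)).
  by rewrite !ler_wpM2l ?expR_ge0// indicE.
apply: le_trans le2 _; rewrite !mulrDr lerD2l.
by apply: le_trans (indic_disc_le _ _ _) _; rewrite normr_id.
Qed.

End stopped.

(** A crude bound, linear in [n]; at the horizon it is multiplied by an exponentially small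
    discount. *)
Lemma euler_norm_le n : Ex P (fun w => `|Y n w|) <=
  `|x| + n%:R * ((`|sigma ord0| + `|sigma ord_max|) * Num.sqrt h).
Proof.
set M := `|sigma ord0| + `|sigma ord_max|.
have M0 : 0 <= M by rewrite addr_ge0.
elim: n => [|n IH].
  rewrite mul0r addr0 (eq_Ex P (W := fun=> `|x|)) ?Ex_cst// => w; by rewrite euler0.
have [i2 E2] := increment_sq B_bm (grid_ge0 h_gt0 n) (grid_lt h_gt0 n).
have mI : measurable_fun setT (increment B (t n) (t n.+1)).
  by apply: (increment_measurable B_bm); exact: grid_ge0.
have i1 := L1_of_sq mI i2.
have le1 := Ex_sq_le mI i2.
have Eh : t n.+1 - t n = h by rewrite gridS addrAC subrr add0r.
rewrite E2 Eh in le1.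
have iY m := euler_L1 sigma B_bm eps_mc x h_gt0 m.
have iM := L1_scale M (L1_norm i1).
rewrite -natr1 mulrDl mul1r addrA.
apply: (@le_trans _ _ (Ex P (fun w => `|Y n w| + M * `|increment B (t n) (t n.+1) w|))).
  apply: Ex_le => [| |w]; [exact: L1_norm|by apply: L1_add => //; exact: L1_norm|].
  rewrite eulerS (le_trans (ler_normD _ _))// lerD2l normrM ler_wpM2r//; exact: ord2_bound.
rewrite Ex_add//; last exact: L1_norm.
rewrite Ex_scale; last exact: L1_norm.
by rewrite lerD// ler_wpM2l.
Qed.

Section hitting.
Variables (dl : R) (Lw : 'I_2 -> R) (K : nat).
Hypotheses (dl_gt0 : 0 < dl) (Lw_ge0 : forall i, 0 <= Lw i)
  (Lw_taylor : forall i y xi, y <= b i - dl -> v i y + p i y * xi +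
    regime_curvature k mu v i y / 2 * xi ^+ 2 - Lw i * `|xi| ^+ 3 <= v i (y + xi)).

Let near_barrier w n := b (eps (t n) w) - dl <= Y n w.

(** The first index below [K] at which the scheme is within [dl] of the boundary or beyond it;
    [find] returns the length [K] if there is none, which caps the index at the horizon. *)
Definition hitting_index w : nat := find (near_barrier w) (iota 0 K).

Lemma hitting_le w : (hitting_index w <= K)%N.
Proof. by rewrite -[leqRHS](size_iota 0 K); exact: find_size. Qed.

Lemma near_barrier_filtration m n : (m <= n)%N -> Fil (t n) [set w | near_barrier w m].
Proof.
move=> mn; apply: (augmented_mono (grid_le h_gt0 mn)).
pose G := process_events measurable B `[0, t m] `|`
    process_events setT eps `[0, t m] `|` P.-negligible.
have sD : sig_measurable G (fun w => Y m w - (b (eps (t m) w) - dl)).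
  apply: sig_measurable_sub; first exact: euler_filtration.
  move=> S _; by move: (@sig_measurable_eps _ _ _ P B eps (fun j => b j - dl) _ _ (grid_ge0 h_gt0 m) (lexx _) S).
rewrite (_ : [set w | _] = (fun w => Y m w - (b (eps (t m) w) - dl)) @^-1` `[0, +oo[%classic).
  by apply: sD; exact: measurable_itv.
by apply/seteqP; split => w /=; rewrite in_itv/= andbT subr_ge0.
Qed.

Lemma hitting_filtration n : Fil (t n) [set w | (n < hitting_index w)%N].
Proof.
have [Kn|nK] := leqP K n.
  rewrite (_ : [set w | _] = ~` setT); first exact: sigmaC (@sigmaT T _).
  apply/seteqP; split => w //=; by rewrite ltnNge (leq_trans (hitting_le w) Kn).
rewrite (_ : [set w | _] = [set w | ~~ has (near_barrier w) (iota 0 n.+1)]); last first.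
  have -> : iota 0 n.+1 = take n.+1 (iota 0 K) by rewrite take_iota (minn_idPl nK).
  by apply/seteqP; split => w /=; rewrite has_take_leq ?size_iota// -leqNgt.
have : all (fun m => (m <= n)%N) (iota 0 n.+1).
  by apply/allP => m; rewrite mem_iota add0n ltnS.
elim: (iota _ _) => [_|m s IH /= /andP[mn sn]].
  by rewrite (_ : [set w | _] = setT); [exact: (@sigmaT T _)|apply/seteqP; split].
rewrite (_ : [set w | _] = ~` [set w | near_barrier w m] `&`
    [set w | ~~ has (near_barrier w) s]).
  by apply: sigmaI; [exact: (sigmaC (near_barrier_filtration mn))|exact: IH].
apply/seteqP; split => w /=; rewrite negb_or; first by move=> /andP[/negP].
by move=> [/negP -> ->].
Qed.

Lemma before_hitting w n : (n < hitting_index w)%N -> Y n w <= b (eps (t n) w) - dl.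
Proof.
move=> nk; have := before_find 0%N nk; rewrite nth_iota ?add0n; last first.
  exact: leq_trans nk (hitting_le w).
by rewrite /near_barrier => /negbT; rewrite -ltNge => /ltW.
Qed.

Lemma at_hitting w : (hitting_index w < K)%N ->
  b (eps (t (hitting_index w)) w) - dl <= Y (hitting_index w) w.
Proof.
move=> hK; have : has (near_barrier w) (iota 0 K) by rewrite has_find size_iota.
by move=> /(nth_find 0%N); rewrite nth_iota ?add0n.
Qed.

Lemma value_near_barrier j (y : R) : b j - dl <= y -> v j y <= y + dl.
Proof.
move=> yb; have [by'|/ltW yb'] := leP (b j) y.
  by rewrite (rs_stop rs)// lerDl ltW.
have /andP[h0 _] := rs_lip rs j yb'; have := rs_stop rs (lexx (b j)); lra.
Qed.

Lemma value_minus_le j (y : R) : v j y <= y + (C + `|y|).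
Proof.
have := rs_le rs j y; have := ler_norm y; have := ler_norm (- y); rewrite normrN.
by case: (leP 0 y); lra.
Qed.

(** The four errors: the one-step losses, the gap [X - Y], the excess [v(y) - y <= dl] at the
    barrier, and the paths that reach the horizon first, where the excess is at most [C + |y|] but
    discounted. *)
Lemma payoff_lower :
  v i x * fine (P D0) -
    (K%:R * (lower_const lambda sigma rho b C Lw * (h * Num.sqrt h)) +
     Num.sqrt (4 * (jump_cost * h * t K)) + dl +
     disc K * (C + (`|x| + K%:R * ((`|sigma ord0| + `|sigma ord_max|) * Num.sqrt h)))) <=
  Ex P (fun w => \1_D0 w * (disc (hitting_index w) * X (t (hitting_index w)) w)).
Proof.
have [iD ED] := gap_stopped P_complete lambda_gt0 B_bm eps_mc B_eps_indep X_sde h_gt0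
  hitting_le hitting_filtration.
have lo := stopped_lower P_complete lambda_gt0 sigma_gt0 rho_gt0 B_bm eps_mc B_eps_indep
  k_gt0 mu_gt0 kE muE rs h_gt0 h_le1 hitting_le hitting_filtration start_filtration
  Lw_ge0 Lw_taylor (ltW dl_gt0) before_hitting.
have d0 := discounted0 sigma rho P_complete B_bm eps_mc v x h start_filtration (i := i) (fun _ => id).
have iS := stopped_L1 P_complete lambda_gt0 sigma_gt0 B_bm eps_mc B_eps_indep
  k_gt0 mu_gt0 kE muE rs x h_gt0 h_le1 hitting_le hitting_filtration start_filtration.
have iP := payoff_L1 hitting_le hitting_filtration.
have iY := L1_norm (euler_L1 sigma B_bm eps_mc x h_gt0 K).
rewrite d0 in lo.
have eY : disc K * Ex P (fun w => C + `|Y K w|) <=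
    disc K * (C + (`|x| + K%:R * ((`|sigma ord0| + `|sigma ord_max|) * Num.sqrt h))).
  rewrite ler_wpM2l ?expR_ge0// Ex_add//; last exact: L1_cst.
  by rewrite Ex_cst lerD2l; exact: euler_norm_le.
have iCY : L1 P (fun w => C + `|Y K w|) by apply: L1_add => //; exact: L1_cst.
rewrite -Ex_scale// in eY.
suff : Ex P (fun w => \1_D0 w * discounted B eps sigma rho v x h (hitting_index w) w) <= 
   Ex P (fun w => \1_D0 w * (disc (hitting_index w) * X (t (hitting_index w)) w)) +
   (Ex P (fun w => `|D (hitting_index w) w|) + (dl + Ex P (fun w => disc K * (C + `|Y K w|)))).
  move: eY ED lo; set a := Ex P _; set a1 := Ex P _; set a2 := Ex P _; lra.
have iK := L1_scale (disc K) iCY.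
have iDl : L1 P (fun w => dl + disc K * (C + `|Y K w|)) by apply: L1_add => //; exact: L1_cst.
have -> : dl + Ex P (fun w => disc K * (C + `|Y K w|)) = Ex P (fun w => dl + disc K * (C + `|Y K w|)).
  by rewrite Ex_add ?Ex_cst//; exact: L1_cst.
have iDD : L1 P (fun w => `|D (hitting_index w) w| + (dl + disc K * (C + `|Y K w|))).
  by apply: L1_add => //; exact: L1_norm.
rewrite -Ex_add//; last exact: L1_norm.
rewrite -Ex_add//; apply: Ex_le => //; first exact: L1_add.
move=> w; rewrite /discounted; set n := hitting_index w.
have rest0 : 0 <= disc K * (C + `|Y K w|).
  by rewrite mulr_ge0 ?expR_ge0// addr_ge0// (rs_C_ge0 rs).
have H : disc n * v (eps (t n) w) (Y n w) <=
    disc n * (X (t n) w) + (disc n * `|D n w| + (disc n * dl + disc K * (C + `|Y K w|))).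
  have Dn : Y n w <= X (t n) w + `|D n w| by have := ler_norm (- D n w); rewrite normrN; lra.
  have [nK|] := boolP (n < K)%N.
    have H1 := value_near_barrier (at_hitting nK).
    have H2 : v (eps (t n) w) (Y n w) <= X (t n) w + `|D n w| + dl by rewrite (le_trans H1)// lerD2r.
    by have := ler_wpM2l (expR_ge0 (- (rho * t n))) H2; rewrite !mulrDr; lra.
  rewrite -leqNgt => Kn.
  have -> : n = K by apply/eqP; rewrite eqn_leq hitting_le.
  have H1 := value_minus_le (eps (t K) w) (Y K w).
  have nE : n = K by apply/eqP; rewrite eqn_leq hitting_le.
  rewrite nE in Dn.
  have H2 : v (eps (t K) w) (Y K w) <= X (t K) w + `|D K w| + (C + `|Y K w|) by lra.
  have := ler_wpM2l (expR_ge0 (- (rho * t K))) H2; rewrite !mulrDr.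
  have : 0 <= disc K * dl by rewrite mulr_ge0 ?expR_ge0// ltW.
  lra.
have dD : disc n * `|D n w| <= `|D n w| by rewrite ler_piMl// disc_le1.
have ddl : disc n * dl <= dl by rewrite ler_piMl ?disc_le1// ltW.
rewrite indicE; case: (w \in D0); rewrite ?mul1r ?mul0r; first by lra.
by rewrite !addr_ge0// ltW.
Qed.

End hitting.

End payoff.

Section mesh.
Context {R : realType}.

(* With [M = m + 1], the mesh [h = M^-4] and the number of steps [K = M^5] give a
   horizon [K h = M] while the errors [K h^(3/2)] and [sqrt (h * K h)] are [O(1/M)]. *)
Definition mesh (m : nat) : R := m.+1%:R^-1 ^+ 4.
Definition horizon (m : nat) : nat := (m.+1 ^ 5)%N.

Let succ_neq0 m : m.+1%:R != 0 :> R. Proof. by rewrite pnatr_eq0. Qed.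

Lemma mesh_gt0 m : 0 < mesh m.
Proof. by rewrite exprn_gt0// invr_gt0 ltr0n. Qed.

Lemma inv_succ_le1 m : m.+1%:R^-1 <= 1 :> R.
Proof. by rewrite invf_le1 ?ltr0n// ler1n. Qed.

Lemma mesh_le1 m : mesh m <= 1.
Proof. by rewrite exprn_ile1// ?invr_ge0// inv_succ_le1. Qed.

Lemma sqrt_mesh m : Num.sqrt (mesh m) = m.+1%:R^-1 ^+ 2.
Proof. by rewrite /mesh (exprM _ 2 2) sqrtr_sqr ger0_norm// sqr_ge0. Qed.

Lemma grid_horizon m : grid (mesh m) (horizon m) = m.+1%:R.
Proof. by rewrite /grid /horizon /mesh natrX; have := succ_neq0 m; move: (m.+1%:R) => N N0; field. Qed.

Lemma horizon_mesh_sqrt m : (horizon m)%:R * (mesh m * Num.sqrt (mesh m)) = m.+1%:R^-1.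
Proof. by rewrite sqrt_mesh /horizon /mesh natrX; have := succ_neq0 m; move: (m.+1%:R) => N N0; field. Qed.

Lemma horizon_sqrt m : (horizon m)%:R * Num.sqrt (mesh m) = m.+1%:R ^+ 3.
Proof. by rewrite sqrt_mesh /horizon natrX; have := succ_neq0 m; move: (m.+1%:R) => N N0; field. Qed.

Lemma gap_mesh_le (j : R) m : 0 <= j ->
  Num.sqrt (4 * (j * mesh m * grid (mesh m) (horizon m))) <= Num.sqrt (4 * j) * m.+1%:R^-1.
Proof.
move=> j0; set q : R := m.+1%:R^-1.
have q0 : 0 <= q by rewrite invr_ge0.
have -> : 4 * (j * mesh m * grid (mesh m) (horizon m)) = 4 * j * (q ^+ 2 * q).
  by rewrite grid_horizon /mesh /q; have := succ_neq0 m; move: (m.+1%:R) => N N0; field.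
rewrite sqrtrM ?mulr_ge0// ler_wpM2l ?sqrtr_ge0//.
rewrite -[leRHS](ger0_norm q0) -sqrtr_sqr ler_wsqrtr// ler_piMr ?sqr_ge0//.
exact: inv_succ_le1.
Qed.

(** [exp x >= (x / 4)^4] turns the discount at the horizon [M] into [M^(-4)], against a moment bound
    of order [M^3]. *)
Lemma decay_mesh_le (rho a M : R) m : 0 < rho -> 0 <= a -> 0 <= M ->
  expR (- (rho * grid (mesh m) (horizon m))) * (a + (horizon m)%:R * (M * Num.sqrt (mesh m))) <=
  (4 / rho) ^+ 4 * (a + M) * m.+1%:R^-1.
Proof.
move=> r0 a0 M0; rewrite grid_horizon [(horizon m)%:R * _]mulrCA horizon_sqrt.
set N : R := m.+1%:R; have N1 : 1 <= N by rewrite ler1n.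
have N0 : 0 < N by exact: lt_le_trans N1.
have rN : 0 < rho / 4 * N by rewrite mulr_gt0// divr_gt0.
have eN : (rho / 4 * N) ^+ 4 <= expR (rho * N).
  rewrite (_ : rho * N = 4%:R * (rho / 4 * N)); last by field.
  rewrite expRM_natl lerXn2r ?nnegrE ?expR_ge0//; first exact: ltW.
  by have := expR_ge1Dx (rho / 4 * N); lra.
rewrite expRN.
have -> : (4 / rho) ^+ 4 * (a + M) * N^-1 = ((rho / 4 * N) ^+ 4)^-1 * (N ^+ 3 * (a + M)).
  by field; rewrite !gt_eqF.
apply: ler_pM.
- by rewrite invr_ge0 expR_ge0.
- by rewrite addr_ge0// mulr_ge0// exprn_ge0// ltW.
- by rewrite lef_pV2// ?posrE ?expR_gt0// exprn_gt0.
- rewrite mulrDr [M * _]mulrC lerD2r ler_peMl// exprn_ege1//.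
Qed.

End mesh.

(** * Identification of the stopping value with [v] *)

Section regime_value.
Context {d : measure_display} {T : measurableType d} {R : realType}.
Variables (P : probability T R) (B : R -> T -> R) (eps : R -> T -> 'I_2)
  (lambda sigma : 'I_2 -> R) (rho : R).
Hypotheses (P_complete : measure_is_complete P) (lambda_gt0 : forall i, 0 < lambda i)
  (sigma_gt0 : forall i, 0 < sigma i) (rho_gt0 : 0 < rho)
  (B_bm : brownian_motion P B)
  (eps_mc : markov_chain P (generator_matrix lambda) eps)
  (B_eps_indep : independent_systems P
     (process_sigma measurable B `[0, +oo[) (process_sigma setT eps `[0, +oo[)).
Variables (k mu : 'I_2 -> R) (v p : 'I_2 -> R -> R) (b : 'I_2 -> R) (C : R).
Hypotheses (k_gt0 : forall i, 0 < k i) (mu_gt0 : forall i, 0 < mu i)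
  (kE : forall i, k i ^+ 2 = 2 * (rho + lambda i) / sigma i ^+ 2)
  (muE : forall i, mu i = 2 * lambda i / sigma i ^+ 2)
  (rs : regime_solution k mu v p b C).
Local Notation Fil := (augmented_filtration P B eps).
Variables (x : R) (X : R -> T -> R).
Hypothesis X_sde : regime_switching_diffusion P Fil sigma B eps x X.
Variable i : 'I_2.
Local Notation D0 := (eps 0 @^-1` [set i]).
Hypothesis D0_gt0 : (0 < P D0)%E.
Local Notation jump_cost := (jump_sq sigma * jump_rate lambda).

Let payoff (tau : T -> \bar R) w := expR (- (rho * fine (tau w))) * X (fine (tau w)) w.

Let pD := fine (P D0).

Let mD0 : measurable D0. Proof. exact: (start_measurable eps_mc). Qed.

Let pD_gt0 : 0 < pD.
Proof. by apply: fine_gt0; rewrite D0_gt0/= ltey_eq fin_num_measure. Qed.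

Let integral_start (g : T -> R) : (\int[P]_(w in D0) (g w)%:E = \int[P]_w (\1_D0 w * g w)%:E)%E.
Proof.
rewrite integral_mkcond; apply: eq_integral => w _; rewrite patchE indicE.
by case: (w \in D0); rewrite ?mul1r ?mul0r.
Qed.

Lemma grid_stopping_time h (kap : T -> nat) : 0 < h ->
  (forall n, Fil (grid h n) [set w | (n < kap w)%N]) ->
  stopping_time Fil (fun w => (grid h (kap w))%:E).
Proof.
move=> h0 kap_stop; split=> [w|s s0]; first by rewrite lee_fin grid_ge0.
pose n := Num.truncn (s / h).
have sh0 : 0 <= s / h by rewrite divr_ge0// ltW.
have ns : grid h n <= s by rewrite -ler_pdivlMr// truncn_le.
have -> : [set w | ((grid h (kap w))%:E <= s%:E)%E] = ~` [set w | (n < kap w)%N].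
  apply/seteqP; split => w /=; rewrite lee_fin.
    move=> ks; apply/negP; rewrite -leqNgt -(ler_nat R).
    have sn : s / h < n.+1%:R by exact: truncnS_gt.
    rewrite ler_nat -ltnS -(ltr_nat R); apply: le_lt_trans sn.
    by rewrite ler_pdivlMr.
  move=> /negP; rewrite -leqNgt => kn; apply: le_trans ns; exact: grid_le.
apply: (augmented_mono ns); exact: (sigmaC (@kap_stop n)).
Qed.

Lemma regime_value_ge (S : \bar R) :
  (forall tau, stopping_time Fil tau -> (forall w, (tau w < +oo)%E) ->
     (expectation_given P D0 (payoff tau) <= S)%E) ->
  ((v i x)%:E <= S)%E.
Proof.
move=> HS; apply/lee_addgt0Pr => e e0.
(* [payoff_lower] concerns expectations restricted to [D0], so the tolerance [e] is scaled by the
   probability of [D0]. One half goes to the barrier, the other to the remaining errors, gathered in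
   [E]. *)
pose dl := e * pD / 2.
have dl0 : 0 < dl by rewrite divr_gt0// mulr_gt0.
have /choice[Lw HL] : forall j, exists L, 0 <= L /\ forall y xi, y <= b j - dl ->
    v j y + p j y * xi + regime_curvature k mu v j y / 2 * xi ^+ 2 - L * `|xi| ^+ 3 <= v j (y + xi).
  by move=> j; have [L L0 HL] := taylor_lower k_gt0 mu_gt0 rs j dl0; exists L.
have Lw0 j : 0 <= Lw j by have [] := HL j.
have Lwt j := proj2 (HL j).
pose M := `|sigma ord0| + `|sigma ord_max|.
pose E := `|lower_const lambda sigma rho b C Lw| + Num.sqrt (4 * jump_cost) +
  (4 / rho) ^+ 4 * (C + `|x| + M).
have jc0 : 0 <= jump_cost := jump_cost_ge0 sigma lambda_gt0.
pose m := Num.truncn (E / dl).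
have Em : E * m.+1%:R^-1 <= dl.
  rewrite ler_pdivrMr ?ltr0n// mulrC -ler_pdivrMr//; apply/ltW; exact: truncnS_gt.
pose h : R := mesh m; pose K := horizon m.
have lo := payoff_lower P_complete lambda_gt0 sigma_gt0 rho_gt0 B_bm eps_mc B_eps_indep
  k_gt0 mu_gt0 kE muE rs X_sde (mesh_gt0 m) (mesh_le1 m) i K dl0 Lw0 Lwt.
pose kap := hitting_index B eps sigma b x (mesh m) dl K; rewrite -/kap in lo.
have kapK w : (kap w <= K)%N by exact: hitting_le.
have kap_stop n : Fil (grid h n) [set w | (n < kap w)%N].
  exact: (@hitting_filtration _ _ _ P B eps sigma b x (mesh m) (mesh_gt0 m) dl K n).
pose tau w : \bar R := (grid h (kap w))%:E.
have := HS tau (grid_stopping_time (mesh_gt0 m) kap_stop) (fun w => ltry _).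
rewrite /expectation_given integral_start.
have iP := payoff_L1 rho P_complete lambda_gt0 B_bm eps_mc B_eps_indep X_sde
  (mesh_gt0 m) i kapK kap_stop.
rewrite [(\int[P]_w _)%E](ExE iP) -EFinM.
have Cx0 : 0 <= C + `|x| by rewrite addr_ge0// (rs_C_ge0 rs).
have M0 : 0 <= M by rewrite addr_ge0.
have e1 : K%:R * (lower_const lambda sigma rho b C Lw * (h * Num.sqrt h)) <=
    `|lower_const lambda sigma rho b C Lw| * m.+1%:R^-1.
  rewrite mulrCA horizon_mesh_sqrt ler_wpM2r ?invr_ge0//; exact: ler_norm.
have e2 := gap_mesh_le m jc0.
have e3 := decay_mesh_le m rho_gt0 Cx0 M0.
have lo' : v i x * pD - e * pD <= Ex P (fun w => \1_D0 w * (expR (- (rho * grid h (kap w))) * X (grid h (kap w)) w)).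
  apply: le_trans lo; rewrite lerD2l lerN2.
  apply: (@le_trans _ _ (E * m.+1%:R^-1 + dl)); last first.
    have edl : e * pD = dl + dl by rewrite /dl; field.
    by rewrite edl lerD2r.
  rewrite [leLHS]addrAC lerD2r /E 2!(mulrDl _ _ m.+1%:R^-1) [C + (_ + _)]addrA.
  by apply: lerD; [apply: lerD; [exact: e1|exact: e2]|exact: e3].
move=> H; apply: (@le_trans _ _ ((pD^-1 * Ex P (fun w => \1_D0 w *
    (expR (- (rho * grid h (kap w))) * X (grid h (kap w)) w)))%:E + e%:E)%E).
  rewrite -EFinD lee_fin -lerBlDr -(ler_pM2r pD_gt0) mulrBl.
  by rewrite mulrAC mulVf ?mul1r// gt_eqF.
by rewrite leeD2r.
Qed.

Section upper.
Variable tau : T -> \bar R.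
Hypotheses (tau_stop : stopping_time Fil tau)
  (tau_fin : {ae P, forall w, eps 0 w = i -> (tau w < +oo)%E}).

Let before m w n := (tau w <= (grid (mesh m) n)%:E)%E.

(** The index of the first grid time at or after [tau], capped at the horizon by the default of
    [find]; rounding up, not down, keeps the decision within the filtration. *)
Definition round_up m w : nat := find (before m w) (iota 0 (horizon m)).

Lemma round_up_le m w : (round_up m w <= horizon m)%N.
Proof. by rewrite -[leqRHS](size_iota 0); exact: find_size. Qed.

Lemma round_up_filtration m n : Fil (grid (mesh m) n) [set w | (n < round_up m w)%N].
Proof.
have [Kn|nK] := leqP (horizon m) n.
  rewrite (_ : [set w | _] = ~` setT); first exact: sigmaC (@sigmaT T _).
  apply/seteqP; split => w //=; by rewrite ltnNge (leq_trans (round_up_le m w) Kn).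
rewrite (_ : [set w | _] = ~` [set w | (tau w <= (grid (mesh m) n)%:E)%E]).
  have [_ H] := tau_stop; exact: (sigmaC (H _ (grid_ge0 (mesh_gt0 m) n))).
apply/seteqP; split => w /= => [nk|nt].
  have := before_find 0%N nk; rewrite nth_iota ?add0n; last exact: leq_trans nk (round_up_le m w).
  by rewrite /before => ->.
rewrite ltnNge; apply/negP => kn; apply: nt.
have kK := leq_ltn_trans kn nK.
have hs : has (before m w) (iota 0 (horizon m)) by rewrite has_find size_iota.
have := nth_find 0%N hs; rewrite nth_iota ?add0n// => /le_trans; apply.
by rewrite lee_fin; apply: grid_le => //; exact: mesh_gt0.
Qed.

Lemma round_up_near m w (r : R) : tau w = r%:E -> r <= m.+1%:R ->
  r <= grid (mesh m) (round_up m w) <= r + mesh m.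
Proof.
move=> tr rm; apply/andP; split.
  have [kK|Kk] := ltnP (round_up m w) (horizon m).
    have hs : has (before m w) (iota 0 (horizon m)) by rewrite has_find size_iota.
    have : before m w (round_up m w) by have := nth_find 0%N hs; rewrite nth_iota ?add0n.
    by rewrite /before tr lee_fin.
  have -> : round_up m w = horizon m by apply/eqP; rewrite eqn_leq round_up_le.
  by rewrite grid_horizon.
case E : (round_up m w) => [|n].
  have := (proj1 tau_stop) w; rewrite tr lee_fin /grid mul0r => r0.
  by rewrite addr_ge0// ltW// mesh_gt0.
have nk : (n < round_up m w)%N by rewrite E.
have := before_find 0%N nk; rewrite nth_iota ?add0n; last exact: leq_trans nk (round_up_le m w).
by rewrite /before tr lee_fin gridS lerD2r => /negbT; rewrite -ltNge => /ltW.
Qed.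

Let approx m w := \1_D0 w * (expR (- (rho * grid (mesh m) (round_up m w))) *
  Num.max 0 (X (grid (mesh m) (round_up m w)) w)).

Let goal w := \1_D0 w * (expR (- (rho * fine (tau w))) * Num.max 0 (X (fine (tau w)) w)).

Lemma mesh_cvg : mesh m @[m --> \oo] --> (0 : R).
Proof.
rewrite /mesh (_ : 0 = 0 ^+ 4 :> R); last by rewrite expr0n.
apply: (@cvg_comp _ _ _ (fun m => m.+1%:R^-1) (fun z : R => z ^+ 4) \oo (nbhs (0 : R))).
  exact: cvg_harmonic.
exact: exprn_continuous.
Qed.

Lemma round_up_cvg w (r : R) : tau w = r%:E ->
  grid (mesh m) (round_up m w) @[m --> \oo] --> r.
Proof.
move=> tr; apply: (@squeeze_cvgr _ _ _ _ (fun=> r) (fun m => r + mesh m)).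
- exists (Num.truncn r) => // m /= rm; apply: round_up_near => //.
  apply/ltW/(lt_le_trans (truncnS_gt _)); by rewrite ler_nat ltnS.
- exact: cvg_cst.
- by rewrite -[X in _ --> X]addr0; apply: cvgD; [exact: cvg_cst|exact: mesh_cvg].
Qed.

Lemma approx_cvg : {ae P, forall w, (approx m w)%:E @[m --> \oo] --> (goal w)%:E}.
Proof.
have cX := rsd_continuous X_sde.
apply: filterS2 cX tau_fin => w cw fw.
rewrite /approx /goal indicE; case: (boolP (w \in D0)) => wD; last first.
  rewrite mul0r (_ : (fun m => _) = fun=> 0%:E); first exact: cvg_cst.
  by apply/funext => m; rewrite mul0r.
have {}fw : (tau w < +oo)%E by apply: fw; move: wD; rewrite inE.
have := (proj1 tau_stop) w; case tr : (tau w) fw => [r| |]// _.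
rewrite lee_fin /= => r0.
have ct := round_up_cvg tr.
apply: cvg_EFin; first exact: nearW.
have cXr : X (grid (mesh m) (round_up m w)) w @[m --> \oo] --> X r w.
  (* Continuity within [[0, +oo[] is two-sided only at [r > 0]; for [r = 0] the rounded time is 0 at
     every level. *)
  have [r00|rn0] := eqVneq r 0.
    have E m : round_up m w = 0%N.
      apply/eqP; rewrite -leqn0 leqNgt; apply/negP => nk.
      have := before_find 0%N nk; rewrite nth_iota ?add0n; last exact: leq_trans nk (round_up_le m w).
      by rewrite /before tr r00 /grid mul0r lexx.
    rewrite r00 (_ : (fun m => _) = fun=> X 0 w); first exact: cvg_cst.
    by apply/funext => m; rewrite E /grid mul0r.
  have rp : 0 < r by rewrite lt_neqAle eq_sym rn0.
  move/continuous_within_itvcyP : cw => [cw _].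
  have cr : {for r, continuous (X ^~ w)} by apply: cw; rewrite in_itv/= rp.
  exact: (cvg_comp _ _ ct cr).
apply: cvgM; first exact: cvg_cst.
apply: cvgM.
  apply: (@cvg_comp _ _ _ (fun m => - (rho * grid (mesh m) (round_up m w))) (@expR R) \oo
    (nbhs (- (rho * r)))); last exact: continuous_expR.
  by apply: cvgN; apply: cvgM => //; exact: cvg_cst.
apply: (@cvg_comp _ _ _ (fun m => X (grid (mesh m) (round_up m w)) w) (fun z : R => Num.max 0 z) \oo
    (nbhs (X r w))) => //.
apply: (@lipschitz_continuous R (fun z => Num.max 0 z) 1) => a a' aa'.
rewrite mul1r ger0_norm; case: (leP 0 a); case: (leP 0 a'); lra.
Qed.

Lemma approx_integral_le m : (\int[P]_w (approx m w)%:E <=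
  (v i x * pD + (`|upper_const lambda sigma k mu C| + Num.sqrt (4 * jump_cost)) * m.+1%:R^-1)%:E)%E.
Proof.
have iP := payoff_pos_L1 rho P_complete lambda_gt0 B_bm eps_mc B_eps_indep X_sde
  (mesh_gt0 m) i (round_up_le m) (@round_up_filtration m).
rewrite [(\int[P]_w _)%E](ExE iP) lee_fin.
have up := payoff_upper P_complete lambda_gt0 sigma_gt0 rho_gt0 B_bm eps_mc B_eps_indep
  k_gt0 mu_gt0 kE muE rs X_sde (mesh_gt0 m) (mesh_le1 m) i (round_up_le m) (@round_up_filtration m).
apply: le_trans up _; rewrite lerD2l (mulrDl _ _ m.+1%:R^-1); apply: lerD.
  rewrite mulrCA horizon_mesh_sqrt ler_wpM2r ?invr_ge0//; exact: ler_norm.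
exact: (gap_mesh_le m (jump_cost_ge0 sigma lambda_gt0)).
Qed.

Lemma regime_value_le : (expectation_given P D0 (payoff tau) <= (v i x)%:E)%E.
Proof.
have mA m : measurable_fun setT (EFin \o approx m).
  have iP := payoff_pos_L1 rho P_complete lambda_gt0 B_bm eps_mc B_eps_indep X_sde
    (mesh_gt0 m) i (round_up_le m) (@round_up_filtration m).
  exact: measurable_int iP.
(* Measurability of [X] at a stopping time comes from completeness of [P]: [goal] is almost surely
   the limit of the measurable [approx m]. *)
pose L w := limn_einf (fun m => (approx m w)%:E).
pose Ls w := limn_esup (fun m => (approx m w)%:E).
have mLs : measurable_fun setT Ls by apply: measurable_fun_limn_esup => m; exact: mA.
have goal0 w : 0 <= goal w by rewrite !mulr_ge0 ?expR_ge0 ?le_max ?lexx// indicE.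
have A0 m w : 0 <= approx m w by rewrite !mulr_ge0 ?expR_ge0 ?le_max ?lexx// indicE.
have E1 : ae_eq P setT Ls (EFin \o goal).
  by apply: filterS approx_cvg => w cw _; rewrite /Ls (cvg_limn_einf_sup cw).2.
have E2 : ae_eq P setT (EFin \o goal) L.
  by apply: filterS approx_cvg => w cw _; rewrite /L (cvg_limn_einf_sup cw).1.
have mg := ae_measurable_fun P_complete E1 mLs.
have mL := ae_measurable_fun P_complete E2 mg.
have H : (\int[P]_w (goal w)%:E <= (v i x * pD)%:E)%E.
  have -> : (\int[P]_w (goal w)%:E = \int[P]_w L w)%E.
    apply: ae_eq_integral => //.
  apply: le_trans (@fatou _ _ _ P setT measurableT _ mA (fun m w _ => A0 m w)) _.
  have c0 : ((v i x * pD + (`|upper_const lambda sigma k mu C| + Num.sqrt (4 * jump_cost)) *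
      m.+1%:R^-1)%:E) @[m --> \oo] --> (v i x * pD)%:E.
    apply: cvg_EFin; first exact: nearW.
    rewrite -[X in _ --> X]addr0; apply: cvgD; first exact: cvg_cst.
    rewrite -[X in _ --> X](mulr0 (`|upper_const lambda sigma k mu C| + Num.sqrt (4 * jump_cost))).
    by apply: cvgM; [exact: cvg_cst|exact: cvg_harmonic].
  have [<- _] := cvg_limn_einf_sup c0.
  rewrite !limn_einf_lim; apply: lee_lim; [exact: is_cvg_einfs|exact: is_cvg_einfs|].
  apply: nearW => n; apply: le_ereal_inf_tmp => _ [m nm <-].
  apply: le_trans (approx_integral_le m); apply: ereal_inf_lbound; by exists m.
rewrite /expectation_given integral_start.
(* The integral is that of the positive part minus that of the negative part; dropping the latter
   leaves [goal]. *)
have H2 : (\int[P]_w (\1_D0 w * payoff tau w)%:E <= (v i x * pD)%:E)%E.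
  apply: le_trans H; rewrite integralE -[leRHS]sube0; apply: leeB.
    rewrite le_eqVlt; apply/predU1P; left; apply: eq_integral => w _.
    rewrite funeposE /goal /payoff -EFin_max; congr EFin.
    by rewrite !maxr_pMr ?expR_ge0 ?indicE// !mulr0 maxC.
  by apply: integral_ge0.
apply: (@le_trans _ _ ((pD^-1)%:E * (v i x * pD)%:E)%E).
  by apply: lee_wpmul2l => //; rewrite lee_fin invr_ge0 ltW.
by rewrite -EFinM lee_fin mulrCA mulVf ?mulr1// gt_eqF.
Qed.

End upper.

End regime_value.

(** The payoff [X - theta] is the diffusion started from [x - theta], so one function [v_i] of
    [x - theta y] serves all [y]. *)
Lemma diffusion_shift {d : measure_display} {T : measurableType d} {R : realType}
    (P : probability T R) (B : R -> T -> R) (eps : R -> T -> 'I_2) (sigma : 'I_2 -> R)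
    (x a : R) (X : R -> T -> R) :
  regime_switching_diffusion P (augmented_filtration P B eps) sigma B eps x X ->
  regime_switching_diffusion P (augmented_filtration P B eps) sigma B eps (x - a)
    (fun t w => X t w - a).
Proof.
move=> [aX cX sX iX]; split.
- move=> t t0.
  pose G := process_events measurable B `[0, t] `|` process_events setT eps `[0, t] `|` P.-negligible.
  have sX' : sig_measurable G (X t) by exact: aX.
  have sc : sig_measurable G (fun=> a) by exact: sig_measurable_cst.
  have sXc := sig_measurable_sub sX' sc.
  by move=> C mC; exact: sXc.
- apply: filterS cX => w cw t; apply: cvgB; [exact: cw|exact: cvg_cst].
- by apply: filterS sX => w ->.
- move=> t t0; rewrite (_ : (fun w => _) = fun w => X t w - x); first exact: iX.
  by apply/funext => w; rewrite opprB addrA subrK.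
Qed.

Section value.
Context {d : measure_display} {T : measurableType d} {R : realType}.
Variables (P : probability T R) (B : R -> T -> R) (eps : R -> T -> 'I_2)
  (X : R -> R -> T -> R) (lambda sigma : 'I_2 -> R) (rho : R).
Hypotheses (P_complete : measure_is_complete P) (lambda_gt0 : forall i, 0 < lambda i)
  (sigma_gt0 : forall i, 0 < sigma i) (rho_gt0 : 0 < rho)
  (B_bm : brownian_motion P B)
  (eps_mc : markov_chain P (generator_matrix lambda) eps)
  (B_eps_indep : independent_systems P
     (process_sigma measurable B `[0, +oo[) (process_sigma setT eps `[0, +oo[))
  (eps0_gt0 : forall i, (0 < P (eps 0%R @^-1` [set i]))%E)
  (X_sde : forall x, regime_switching_diffusion P
     (augmented_filtration P B eps) sigma B eps x (X x)).
Variables (k mu : 'I_2 -> R) (v p : 'I_2 -> R -> R) (b : 'I_2 -> R) (C : R).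
Hypotheses (k_gt0 : forall i, 0 < k i) (mu_gt0 : forall i, 0 < mu i)
  (kE : forall i, k i ^+ 2 = 2 * (rho + lambda i) / sigma i ^+ 2)
  (muE : forall i, mu i = 2 * lambda i / sigma i ^+ 2)
  (rs : regime_solution k mu v p b C).

Lemma value_uE c f x i y :
  value_u P B eps X rho c f x i y = (v i (x - theta rho c f y))%:E.
Proof.
have sde := diffusion_shift (theta rho c f y) (X_sde x).
apply/eqP; rewrite eq_le; apply/andP; split.
  apply: ge_ereal_sup => _ [tau [tau_stop tau_fin] <-].
  exact: (regime_value_le P_complete lambda_gt0 sigma_gt0 rho_gt0 B_bm eps_mc B_eps_indep
    k_gt0 mu_gt0 kE muE rs sde (eps0_gt0 i) tau_stop tau_fin).
apply: (regime_value_ge P_complete lambda_gt0 sigma_gt0 rho_gt0 B_bm eps_mc B_eps_indep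
    k_gt0 mu_gt0 kE muE rs sde (eps0_gt0 i)) => tau tau_stop tau_fin.
apply: ereal_sup_ubound; exists tau => //; split=> //.
by apply: aeW => w _.
Qed.

End value.

(** * Regularity and the variational inequality *)

Section cost.
Context {R : realType}.
Variables (f : R -> R).
Hypotheses (f_continuous : {within `[0, 1], continuous f}) (f_0 : f 0 = 0)
  (f_concave : concave_on `[0, 1] f)
  (f_C1 : continuously_differentiable_on `]0, 1] f).
Local Notation df := (derive_within `]0, 1] f).

Lemma within_near {U : topologicalType} (A : set U) (g : U -> R) (a : U) (e : R) :
  {within A, continuous g} -> A a -> 0 < e ->
  \forall z \near a, A z -> `|g a - g z| < e.
Proof.
move=> cg Aa e0; have /cvgrPdist_lt/(_ e e0) := cg a.
by rewrite /prop_near1 /nbhs /= -nbhs_subspace_in.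
Qed.

(* Turns the one-sided derivative at 1 into an ordinary one. *)
Definition linear_extension (y : R) : R := if y <= 1 then f y else f 1 + df 1 * (y - 1).

Lemma linear_extensionE y : y <= 1 -> linear_extension y = f y.
Proof. by rewrite /linear_extension => ->. Qed.

Lemma is_derive_linear_extension (y : R) : 0 < y <= 1 ->
  is_derive y 1 linear_extension (df y).
Proof.
move=> /andP[y0 y1].
have Dy : `]0, 1]%classic y by rewrite /= in_itv/= y0.
have [dif _] := f_C1.
have H : (linear_extension z - linear_extension y) / (z - y) @[z --> y^'] --> df y.
  apply/cvgrPdist_lt => e e0.
  have /cvgrPdist_lt/(_ e e0) cve : (f z - f y) / (z - y) @[z --> within (`]0, 1] `\ y) (nbhs y)] --> df y.
    exact: dif y Dy.
  have {}cve : \forall z \near y, (`]0, 1]%classic `\ y) z -> `|df y - (f z - f y) / (z - y)| < e by exact: cve.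
  have z0 : \forall z \near y, 0 < z by exact: lt_nbhsr.
  have z1 : \forall z \near y, y = 1 \/ z < 1.
    move: y1; rewrite le_eqVlt => /predU1P[y11|yl]; first by exists 1 => //= z _; left.
    by apply: filterS (lt_nbhsl yl) => z; right.
  suff : \forall z \near y, z != y ->
      `|df y - (linear_extension z - linear_extension y) / (z - y)| < e by [].
  apply: filterS3 cve z0 z1 => z cz zp zl zy.
  rewrite (linear_extensionE y1) /linear_extension.
  case: (leP z 1) => z1.
    by apply: cz; split => //=; [rewrite in_itv/= zp|exact/eqP].
  case: zl => [y11|]; last by rewrite ltNge (ltW z1).
  rewrite y11 addrAC subrr add0r mulfK ?subrr ?normr0// subr_eq0.
  by rewrite gt_eqF.
have Hs : forall g (l : R), (g z - g y) / (z - y) @[z --> y^'] --> l -> is_derive y 1 g l.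
  move=> g l gl.
  have E : h^-1 *: (g (h *: 1 + y) - g y) @[h --> 0^'] --> l.
    apply/cvgrPdist_lt => e e0.
    have /cvgrPdist_lt/(_ e e0) : (g z - g y) / (z - y) @[z --> y^'] --> l by [].
    rewrite /prop_near1 /dnbhs /within /= => -[r /= r0 Hr].
    exists r => //= h hr h0.
    have := Hr (h + y); rewrite /ball /= => Hh.
    have : `|l - (g (h + y) - g y) / (h + y - y)| < e.
      apply: Hh; last by rewrite -subr_eq0 addrK.
      by move: hr; rewrite /ball /= sub0r normrN opprD addrCA subrr addr0 normrN.
    by rewrite addrK /GRing.scale /= mulr1 mulrC.
  apply: DeriveDef; first exact: (cvgP _ E).
  by rewrite /derive; apply/cvg_lim.
exact: Hs.
Qed.

Lemma concave_chord (t y : R) : 0 <= t <= 1 -> 0 <= y <= 1 -> t * f y <= f (t * y).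
Proof.
move=> /andP[t0 t1] y01.
pose s : {i01 R} := Itv01 t0 t1.
have Dy : (y : R^o) \in (`[0, 1]%classic : set R^o) by rewrite inE /= in_itv.
have D0 : (0 : R^o) \in (`[0, 1]%classic : set R^o) by rewrite inE /= in_itv/= lexx ler01.
have := f_concave s Dy D0; rewrite !convRE /= f_0 oppr0 !mulr0 !addr0.
rewrite mulrN lerN2.
by have <- : conv s (y : R^o) 0 = t * y by rewrite convRE mulr0 addr0.
Qed.

(** The chord from the origin lies below the graph, so every difference quotient to the left of [y]
    is at most [f y / y]; a larger derivative would be approached by such quotients. *)
Lemma slope_le (y : R) : 0 < y <= 1 -> df y <= f y / y.
Proof.
move=> /[dup] y01 /andP[y0 y1]; rewrite leNgt; apply/negP => lt.
have [dF vF] := is_derive_linear_extension y01.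
pose e := (df y - f y / y) / 2.
have e0 : 0 < e by rewrite divr_gt0// subr_gt0.
move: dF => /cvg_ex[l hl]; have ll : l = df y.
  by rewrite -vF /derive; apply/esym/cvg_lim.
move: hl => /cvgrPdist_lt/(_ e e0) [r /= r0 Hr].
pose h := Num.min (r / 2) (y / 2).
have h0 : 0 < h by rewrite lt_min !divr_gt0.
have hr : h < r by rewrite gt_min; apply/orP; left; lra.
have hy : h < y by rewrite gt_min; apply/orP; right; lra.
have := Hr (- h); rewrite /ball /= sub0r opprK gtr0_norm// => /(_ hr).
rewrite oppr_eq0 gt_eqF// => /(_ isT).
rewrite /GRing.scale /= mulr1 (linear_extensionE y1) linear_extensionE; last by lra.
rewrite ll => H.
pose t := (y - h) / y.
have ty : t * y = y - h by rewrite /t divfK// gt_eqF.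
have t01 : 0 <= t <= 1.
  by rewrite divr_ge0 ?subr_ge0 ?(ltW hy) ?(ltW y0)//= ler_pdivrMr// mul1r gerBl ltW.
have := concave_chord t01 (_ : 0 <= y <= 1); rewrite (ltW y0) y1 => /(_ isT).
rewrite ty => ch.
have q : (- h)^-1 * (f (- h + y) - f y) <= f y / y.
  rewrite invrN mulNr -mulrN opprB [- h + y]addrC ler_pdivrMl//.
  have : t * f y = f y - h * (f y / y) by rewrite /t; field; rewrite gt_eqF.
  by move=> tE; rewrite tE in ch; lra.
have := ler_norm (df y - (- h)^-1 * (f (- h + y) - f y)).
move: H q lt; rewrite /e; lra.
Qed.

Lemma derive_withinE (g h : R -> R) (y l : R) : 0 < y <= 1 ->
  (forall z, 0 < z <= 1 -> h z = g z) -> is_derive y 1 g l ->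
  derivable_within `]0, 1] h y /\ derive_within `]0, 1] h y = l.
Proof.
move=> /[dup] y01 /andP[y0 y1] hg [dg vg].
have cv : (h z - h y) / (z - y) @[z --> within (`]0, 1] `\ y) (nbhs y)] --> l.
  apply/cvgrPdist_lt => e e0.
  move: dg => /cvg_ex[l' hl']; have ll : l' = l by rewrite -vg /derive; apply/esym/cvg_lim.
  move: hl' => /cvgrPdist_lt/(_ e e0) [r /= r0 Hr].
  exists r => //= z zr [/= zD /eqP zy].
  move: zD; rewrite in_itv/= => zD; rewrite !hg//.
  have := Hr (z - y); rewrite /ball /= sub0r normrN => Hz.
  have zr' : `|z - y| < r by rewrite distrC.
  have zy' : z - y != 0 by rewrite subr_eq0.
  have := Hz zr' zy'.
  by rewrite /GRing.scale /= mulr1 subrK ll mulrC.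
(* Identifying [lim] takes a proper filter: points of []0, 1]] just left of [y] lie in every
   neighbourhood of [y]. *)
have pf : ProperFilter (within (`]0, 1] `\ y) (nbhs y)).
  apply: Build_ProperFilter_ex => P0 [r /= r0 Hr].
  pose s := Num.min (r / 2) (y / 2).
  have s0 : 0 < s by rewrite lt_min !divr_gt0.
  have sr : s < r by rewrite gt_min; apply/orP; left; lra.
  have sy : s < y by rewrite gt_min; apply/orP; right; lra.
  exists (y - s); apply: Hr.
    by rewrite /ball /= opprB addrC subrK gtr0_norm.
  split => /=; first by rewrite in_itv/=; apply/andP; split; lra.
  by lra.
by split; [exact: (cvgP _ cv)|exact: cvg_lim].
Qed.

Lemma derivative_continuous (y : R) : 0 < y <= 1 ->
  {for y, continuous (fun z : R => df (Num.min z 1))}.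
Proof.
move=> /[dup] y01 /andP[y0 y1]; apply/cvgrPdist_lt => e e0.
have Dy : `]0, 1]%classic y by rewrite /= in_itv/= y0.
have [_ cdf] := f_C1.
have [r /= r0 Hr] := within_near cdf Dy e0.
have z0 : \forall z \near y, 0 < z by exact: lt_nbhsr.
have z1 : \forall z \near y, ball y r z by exact: nbhsx_ballx.
apply: filterS2 z0 z1 => z z0 zr; rewrite (min_idPl y1).
apply: Hr; last by rewrite /= in_itv/= lt_min z0 ltr01 ge_min lexx orbT.
move: zr; rewrite /ball /=; apply: le_lt_trans.
case: (leP z 1) => // z1.
by rewrite distrC [leRHS]distrC !ger0_norm; lra.
Qed.

End cost.

Section regularity.
Context {R : realType}.
Variables (rho c : R) (f : R -> R).
Hypotheses (rho_gt0 : 0 < rho) (c_gt0 : 0 < c) (f_ge0 : forall y, 0 <= f y)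
  (f_continuous : {within `[0, 1], continuous f}) (f_0 : f 0 = 0)
  (f_C1 : continuously_differentiable_on `]0, 1] f).
Variables (k mu : 'I_2 -> R) (v p : 'I_2 -> R -> R) (b : 'I_2 -> R) (C : R).
Hypothesis rs : regime_solution k mu v p b C.
Local Notation df := (derive_within `]0, 1] f).
Local Notation F := (linear_extension f).
Local Notation g := (regime_curvature k mu v).
Local Notation th := (theta rho c f).
Local Notation th' := (theta rho c F).

Definition regime_W (x y : R) (i : 'I_2) : R :=
  if y == 0 then 0 else y * v i (x - th y) - rho^-1 * f y.

(** Differentiable in [y] from both sides also at [y = 1], so that one-sided derivatives of [W]
    become ordinary ones. *)
Definition regime_W_extended (x y : R) (i : 'I_2) : R :=
  y * v i (x - th' y) - rho^-1 * F y.

Definition regime_W_y (x y : R) (i : 'I_2) : R :=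
  v i (x - th' y) + y * p i (x - th' y) * (rho^-1 * (df (Num.min y 1) / y - F y / y ^+ 2)) -
  rho^-1 * df (Num.min y 1).

Lemma theta_extended y : y <= 1 -> th' y = th y.
Proof. by move=> y1; rewrite /theta linear_extensionE. Qed.

Lemma regime_WE x y i : 0 < y <= 1 -> regime_W x y i = regime_W_extended x y i.
Proof.
move=> /andP[y0 y1]; rewrite /regime_W /regime_W_extended gt_eqF//.
by rewrite theta_extended// linear_extensionE.
Qed.

(** [theta] may blow up at [y = 0], but only through [f y / y], and the factor [y] in front reduces
    this to [f y]. *)
Lemma regime_W_norm_le x y i : 0 < y <= 1 ->
  `|regime_W x y i| <= y * (C + `|x| + c) + 2 * (rho^-1 * f y).
Proof.
move=> /andP[y0 y1]; rewrite /regime_W gt_eqF//.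
have fr0 : 0 <= rho^-1 * f y by rewrite mulr_ge0// invr_ge0 ltW.
have yv0 : 0 <= y * v i (x - th y) by rewrite mulr_ge0 ?(ltW y0)// (rs_ge0 rs).
have le1 : v i (x - th y) <= C + (`|x| + c + rho^-1 * (f y / y)).
  apply: le_trans (ler_norm _) _; apply: le_trans (rs_norm_le rs _ _) _; rewrite lerD2l.
  rewrite /theta opprB addrA -[_ - c]addrA.
  have fy0 : 0 <= rho^-1 * (f y / y) by rewrite mulr_ge0 ?invr_ge0 ?(ltW rho_gt0)// divr_ge0// ltW.
  rewrite (_ : x + _ = x - c + rho^-1 * (f y / y)); last by ring.
  apply: le_trans (ler_normD _ _) _; rewrite (ger0_norm fy0) lerD2r.
  by apply: le_trans (ler_normB _ _) _; rewrite (gtr0_norm c_gt0).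
have le2 := ler_wpM2l (ltW y0) le1.
have E : y * (C + (`|x| + c + rho^-1 * (f y / y))) = y * (C + `|x| + c) + rho^-1 * f y.
  by field; rewrite !gt_eqF.
rewrite E in le2.
by rewrite ler_norml; apply/andP; split; lra.
Qed.

Lemma f_near0 e : 0 < e -> \forall y \near (0 : R), 0 <= y <= 1 -> f y < e.
Proof.
move=> e0; have D0 : `[0, 1]%classic (0 : R) by rewrite /= in_itv/= lexx ler01.
have := within_near f_continuous D0 e0; apply: filterS => y H y01.
have := H _; rewrite /= in_itv/= => /(_ y01).
by rewrite f_0 sub0r normrN ger0_norm.
Qed.

(** Uniform in [x'] near [x], as joint continuity at [y = 0] requires. The radius makes each of the
    two terms of [regime_W_norm_le] smaller than [e / 2]. *)
Lemma regime_W_near0 x (e : R) i : 0 < e -> exists2 r : R, 0 < r & forall x' y,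
  `|x' - x| < r -> 0 <= y < r -> y <= 1 -> `|regime_W x' y i| < e.
Proof.
move=> e0; pose M := C + `|x| + 1 + c + 1.
have C0 := rs_C_ge0 rs.
have M0 : 0 < M by rewrite ltr_wpDl// !addr_ge0// ltW.
have e4 : 0 < rho * e / 4 by rewrite divr_gt0// mulr_gt0.
have [r /= r0 Hr] := f_near0 e4.
pose s := Num.min r (Num.min 1 (e / (2 * M))).
have s0 : 0 < s by rewrite !lt_min r0 ltr01 divr_gt0// mulr_gt0.
exists s => // x' y; rewrite !lt_min => /and3P[_ xx' _] /and4P[y0 yr _ ys] y1.
have [->|yn0] := eqVneq y 0; first by rewrite /regime_W eqxx normr0.
have yp : 0 < y by rewrite lt_neqAle eq_sym yn0.
apply: le_lt_trans (regime_W_norm_le x' i _) _; first by rewrite yp.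
have fy : f y < rho * e / 4.
  by apply: Hr; rewrite ?y0// /ball /= sub0r normrN ger0_norm.
have h1 : rho^-1 * f y < e / 4.
  by rewrite ltr_pdivrMl// (lt_le_trans fy)// mulrA.
have h2 : y * (C + `|x'| + c) <= y * M.
  rewrite ler_wpM2l// /M; have := ler_norm (x' - x); have := ler_normD (x' - x) x.
  by rewrite subrK; lra.
have h3 : y * M < e / 2.
  by move: ys; rewrite ltr_pdivlMr ?mulr_gt0//; lra.
lra.
Qed.

Lemma is_derive_regime_W_x (x y : R) i : y != 0 ->
  is_derive x 1 (fun x => regime_W x y i) (y * p i (x - th y)).
Proof.
move=> y0.
rewrite (_ : (fun x => _) = fun x => y * v i (x - th y) - rho^-1 * f y); last first.
  by apply/funext => z; rewrite /regime_W (negbTE y0).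
have h1 : is_derive x 1 (fun x => x - th y) (1 - 0).
  by apply: is_derive_sub.
have h2 := is_derive_compose h1 (rs_derive rs i (x - th y)).
have h3 := is_derive_scale y h2.
have h4 := is_derive_sub h3 (is_derive_cst (rho^-1 * f y) x 1).
apply: is_derive_val h4 _; ring.
Qed.

Lemma d_x_regime_W i y : y != 0 ->
  d_x (fun x y => regime_W x y i) ^~ y = fun x => y * p i (x - th y).
Proof.
by move=> y0; apply/funext => x; rewrite /d_x derive1E; apply: derive_val;
  exact: is_derive_regime_W_x.
Qed.

Lemma is_derive_inv (y : R) : y != 0 -> is_derive y 1 (fun z : R => z^-1) (- y ^- 2).
Proof.
move=> y0; have h := is_deriveV y0 (is_derive_id1 y).
apply: is_derive_val h _; rewrite /GRing.scale /= mulr1 //.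
Qed.

Lemma is_derive_theta (y : R) : 0 < y <= 1 ->
  is_derive y 1 th' (- (rho^-1 * (df y / y - F y / y ^+ 2))).
Proof.
move=> /[dup] y01 /andP[y0 y1]; have yn0 : y != 0 by rewrite gt_eqF.
have h1 := is_derive_mul (is_derive_linear_extension f_C1 y01) (is_derive_inv yn0).
have h2 := is_derive_sub (is_derive_cst c y 1) (is_derive_scale rho^-1 h1).
apply: is_derive_val h2 _; field; rewrite yn0 gt_eqF//.
Qed.

Lemma is_derive_regime_W_y (x y : R) i : 0 < y <= 1 ->
  is_derive y 1 (fun y => regime_W_extended x y i) (regime_W_y x y i).
Proof.
move=> /[dup] y01 /andP[y0 y1]; have yn0 : y != 0 by rewrite gt_eqF.
have h1 := is_derive_sub (is_derive_cst x y 1) (is_derive_theta y01).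
have h2 := is_derive_compose h1 (rs_derive rs i (x - th' y)).
have h3 := is_derive_mul (is_derive_id1 y) h2.
have h4 := is_derive_sub h3 (is_derive_scale rho^-1 (is_derive_linear_extension f_C1 y01)).
apply: is_derive_val h4 _; rewrite /regime_W_y (min_idPl y1); ring.
Qed.

Lemma d_y_regime_W x y i : 0 < y <= 1 ->
  derivable_within `]0, 1] (fun y => regime_W x y i) y /\
  d_y (fun x y => regime_W x y i) x y = regime_W_y x y i.
Proof.
move=> y01; apply: (derive_withinE y01 _ (is_derive_regime_W_y x i y01)).
by move=> z z01; exact: regime_WE.
Qed.

Lemma strip_continuous (h h' : R * R -> R) : (forall z, strip z -> {for z, continuous h'}) ->
  (forall z, strip z -> h z = h' z) -> {within strip, continuous h}.
Proof.
move=> ch E; apply: (@subspace_eq_continuous _ strip _ h' h).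
  by move=> z /set_mem zs; exact/esym/E.
by apply: continuous_in_subspaceT => z zs; apply: ch; move: zs; rewrite inE.
Qed.

Lemma continuous_x_theta (z : R * R) (q : R -> R) : strip z -> continuous q ->
  {for z, continuous (fun u : R * R => q (u.1 - th' u.2))}.
Proof.
move=> sz cq; have cth := is_derive_continuous (is_derive_theta sz).
have c2 : {for z, continuous (fun u : R * R => th' u.2)}.
  by apply: (@continuous_comp _ _ _ snd th' z) => //; exact: cvg_snd.
have c1 : {for z, continuous (fun u : R * R => u.1 - th' u.2)}.
  by apply: cvgB => //; exact: cvg_fst.
exact: (@continuous_comp _ _ _ (fun u : R * R => u.1 - th' u.2) q z c1 (cq _)).
Qed.

Lemma continuous_snd (z : R * R) (q : R -> R) : {for z.2, continuous q} ->
  {for z, continuous (fun u : R * R => q u.2)}.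
Proof. by move=> cq; apply: (@continuous_comp _ _ _ snd q z) => //; exact: cvg_snd. Qed.

Lemma rs_value_continuous i : continuous (v i).
Proof. by move=> y; exact: is_derive_continuous (rs_derive rs i y). Qed.

Lemma continuous_regime_W_extended (z : R * R) i : strip z ->
  {for z, continuous (fun u : R * R => regime_W_extended u.1 u.2 i)}.
Proof.
move=> sz; have cv := continuous_x_theta sz (@rs_value_continuous i).
have cF := continuous_snd (is_derive_continuous (is_derive_linear_extension f_C1 sz)).
have c2 : {for z, continuous (fun u : R * R => u.2)} by exact: cvg_snd.
have cc (a : R) : {for z, continuous (fun=> a : R)} by exact: cvg_cst.
exact: (continuousB (continuousM c2 cv) (continuousM (cc rho^-1) cF)).
Qed.

Lemma continuous_regime_W_y (z : R * R) i : strip z ->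
  {for z, continuous (fun u : R * R => regime_W_y u.1 u.2 i)}.
Proof.
move=> sz; have cp := continuous_x_theta sz (@rs_deriv_continuous _ _ _ _ _ _ _ rs i).
have cv := continuous_x_theta sz (@rs_value_continuous i).
have cF := continuous_snd (is_derive_continuous (is_derive_linear_extension f_C1 sz)).
have cdf := continuous_snd (derivative_continuous f_C1 sz).
have z20 : z.2 != 0 by move: sz => /andP[z0 _]; rewrite gt_eqF.
have c2 : {for z, continuous (fun u : R * R => u.2)} by exact: cvg_snd.
have cc (a : R) : {for z, continuous (fun=> a : R)} by exact: cvg_cst.
have ci : {for z, continuous (fun u : R * R => u.2^-1)} by exact: (cvgV z20 c2).
have ci2 : {for z, continuous (fun u : R * R => (u.2 ^+ 2)^-1)}.
  by apply: (cvgV _ (continuousM c2 c2)); rewrite mulf_neq0.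
have cs := continuousM (cc rho^-1) (continuousB (continuousM cdf ci) (continuousM cF ci2)).
exact: (continuousB (continuousD cv (continuousM (continuousM c2 cp) cs))
  (continuousM (cc rho^-1) cdf)).
Qed.

Lemma regime_W_C11 i : C11_on_strip (fun x y => regime_W x y i).
Proof.
have y0 (z : R * R) : strip z -> z.2 != 0 by move=> /andP[z0 _]; rewrite gt_eqF.
split.
- apply: (strip_continuous (h' := fun u => regime_W_extended u.1 u.2 i)) => z sz.
    exact: continuous_regime_W_extended.
  exact: regime_WE.
- by move=> z sz; have [] := is_derive_regime_W_x z.1 i (y0 z sz).
- by move=> z sz; have [] := d_y_regime_W z.1 i sz.
- apply: (strip_continuous (h' := fun u => u.2 * p i (u.1 - th' u.2))) => z sz.
    apply: cvgM; [exact: cvg_snd|exact: (continuous_x_theta sz (@rs_deriv_continuous _ _ _ _ _ _ _ rs i))].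
  rewrite (congr1 (fun q => q z.1) (d_x_regime_W i (y0 z sz))).
  by rewrite theta_extended//; move: sz => /andP[].
- apply: (strip_continuous (h' := fun u => regime_W_y u.1 u.2 i)) => z sz.
    exact: continuous_regime_W_y.
  by have [] := d_y_regime_W z.1 i sz.
Qed.

Lemma regime_W_continuous i : {within strip_closed, continuous (fun z => regime_W z.1 z.2 i)}.
Proof.
suff H (z : R * R) : strip_closed z -> forall e, 0 < e -> \forall u \near z, strip_closed u ->
    `|regime_W z.1 z.2 i - regime_W u.1 u.2 i| < e.
  move=> z; case: (pselect (strip_closed z)) => sz; last first.
    by apply/cvgrPdist_lt => e e0; rewrite /prop_near1 /nbhs /= -nbhs_subspace_out// => u ->;
       rewrite subrr normr0.
  apply/cvgrPdist_lt => e e0; rewrite /prop_near1 /nbhs /= -nbhs_subspace_in//.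
  exact: H.
move=> /[dup] sz /andP[z0 z1] e e0.
have [z20|zn0] := eqVneq z.2 0.
  have [r r0 Hr] := regime_W_near0 z.1 i e0.
  have : \forall u \near z, ball z r u by exact: nbhsx_ballx.
  apply: filterS => u [/= u1 u2] /andP[su0 su1].
  rewrite {1}/regime_W z20 eqxx sub0r normrN; apply: Hr => //.
    by rewrite distrC.
  rewrite su0/=; move: u2; rewrite z20 /ball /= sub0r normrN; apply: le_lt_trans; exact: ler_norm.
have zp : 0 < z.2 by rewrite lt_neqAle eq_sym zn0.
have sz' : strip z by apply/andP.
have /cvgrPdist_lt/(_ e e0) h1 := @continuous_regime_W_extended z i sz'.
have h2 : \forall u \near z, 0 < u.2.
  have : \forall u \near z, ball z z.2 u by exact: nbhsx_ballx.
  by apply: filterS => u [_ ]; rewrite /ball /= ltr_norml; lra.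
apply: filterS2 h1 h2 => u h1 h2 /andP[_ su1].
by rewrite !regime_WE ?h2 ?zp.
Qed.

End regularity.

Section hjb.
Context {R : realType}.
Variables (rho c : R) (f : R -> R).
Hypotheses (rho_gt0 : 0 < rho) (c_gt0 : 0 < c) (f_ge0 : forall y, 0 <= f y)
  (f_continuous : {within `[0, 1], continuous f}) (f_0 : f 0 = 0)
  (f_concave : concave_on `[0, 1] f)
  (f_C1 : continuously_differentiable_on `]0, 1] f).
Variables (k mu : 'I_2 -> R) (v p : 'I_2 -> R -> R) (b : 'I_2 -> R) (C : R).
Hypotheses (k_gt0 : forall i, 0 < k i) (mu_gt0 : forall i, 0 < mu i)
  (rs : regime_solution k mu v p b C).
Variables (lambda sigma : 'I_2 -> R).
Hypotheses (sigma_gt0 : forall i, 0 < sigma i)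
  (kE : forall i, k i ^+ 2 = 2 * (rho + lambda i) / sigma i ^+ 2)
  (muE : forall i, mu i = 2 * lambda i / sigma i ^+ 2).
Local Notation df := (derive_within `]0, 1] f).
Local Notation F := (linear_extension f).
Local Notation g := (regime_curvature k mu v).
Local Notation th := (theta rho c f).
Local Notation th' := (theta rho c F).
Local Notation W := (regime_W rho c f v).
Local Notation leb := (@lebesgue_measure R).
Local Notation Wx i := (d_x (fun x y => W x y i)).

(* Every horizontal section of the free boundary is a single point; the vertical ones
   need not be null, as [theta] may be locally constant. *)
Lemma free_boundary_ae i :
  {ae (@lebesgue2 R), forall z, strip z -> z.1 - th z.2 != b i}.
Proof.
pose D : set R := `]0, 1]%classic.
have mD : measurable D by exact: measurable_itv.
have mth : measurable_fun D th'.
  apply: subspace_continuous_measurable_fun => //.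
  apply: continuous_in_subspaceT => y /set_mem /= yD.
  have y01 : 0 < y <= 1 by move: yD; rewrite /D /= in_itv.
  have h := is_derive_continuous (is_derive_theta c rho_gt0 f_C1 y01).
  exact: h.
pose E : set (R * R) := setT `*` D.
have mE : measurable E by exact: measurableX.
have mh : measurable_fun E (fun z : R * R => z.1 - th' z.2).
  apply: measurable_funB; first exact: measurable_funTS (@measurable_fst _ _ _ _).
  apply: (measurable_comp mD _ mth); first by move=> _ [z [_ zD] <-].
  exact: measurable_funTS (@measurable_snd _ _ _ _).
pose N : set (R * R) := E `&` (fun z : R * R => z.1 - th' z.2) @^-1` [set b i].
have mN : measurable N by apply: mh => //; exact: measurable_set1.
exists N; split=> //.
  rewrite /lebesgue2 (@product_measure_unique _ _ _ _ R leb leb (leb \x^ leb)%E)//; last first.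
    by move=> A1 A2 mA1 mA2; exact: product_measure2E.
  rewrite /product_measure2; apply: integral0_eq => y _ /=.
  have -> : ysection N y = [set x | (D y /\ x = th' y + b i)%R].
    apply/seteqP; split => x; rewrite /ysection /= inE /N /E /=.
      by move=> [[_ Dy] <-]; split=> //; rewrite addrC subrK.
    by move=> [Dy ->]; split=> //; rewrite addrC addKr.
  apply/eqP; rewrite eq_le measure_ge0 andbT -(lebesgue_measure_set1 (th' y + b i)).
  apply: le_measure; rewrite ?inE.
  - have [Dy|nDy] := pselect (D y).
      rewrite (_ : [set _ | _] = [set th' y + b i]); first exact: measurable_set1.
      by apply/seteqP; split => x //= [].
    by rewrite (_ : [set _ | _] = set0)//; apply/seteqP; split => x //= [].
  - exact: measurable_set1.
  - by move=> x [_ ->].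
move=> z /= nz; apply: contrapT => nN; apply: nz => sz; apply/eqP => e; apply: nN.
split; first by split=> //; rewrite /D /= in_itv.
by rewrite /= theta_extended//; move: sz => /andP[].
Qed.

Lemma ae_off_free_boundary i (Q : R -> R -> Prop) :
  (forall x y, 0 < y <= 1 -> x - th y != b i -> Q x y) -> ae_on_strip Q.
Proof.
move=> HQ; have [N [mN N0 HN]] := free_boundary_ae i.
exists N; split=> // z /= nz; apply: HN => /= H; apply: nz => sz.
by apply: HQ; [exact: sz|exact: H].
Qed.

Lemma is_derive_W_xx (x y : R) i : 0 < y <= 1 -> x - th y != b i ->
  is_derive x 1 ((Wx i) ^~ y) (if x - th y < b i then y * g i (x - th y) else 0).
Proof.
move=> /andP[y0 y1] xb; rewrite (d_x_regime_W rho c f rs i (lt0r_neq0 y0)).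
have h1 : is_derive x 1 (fun x => x - th y) (1 - 0) by apply: is_derive_sub.
have H q : is_derive (x - th y) 1 (p i) q -> is_derive x 1 (fun x => y * p i (x - th y)) (y * q).
  move=> hq; apply: is_derive_val (is_derive_scale y (is_derive_compose h1 hq)) _; ring.
case: ltP => xb'; first by apply: H; exact: (rs_derive2 rs).
have {}xb : b i < x - th y by rewrite lt_neqAle eq_sym xb.
apply: is_derive_val (H 0 _) _; last by rewrite mulr0.
apply: (@is_derive_gt_eq R (fun=> 1) (p i) (b i) (x - th y) 0 xb) => z bz.
by rewrite (rs_deriv_stop rs)// ltW.
Qed.

Lemma W_xxE (x y : R) i : 0 < y <= 1 -> x - th y != b i ->
  d_xx (fun x y => W x y i) x y = if x - th y < b i then y * g i (x - th y) else 0.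
Proof.
move=> y01 xb; rewrite /d_xx {1}/d_x derive1E; apply: derive_val; exact: is_derive_W_xx.
Qed.

Lemma W_xx_le (x y : R) i : 0 < y <= 1 -> x - th y != b i ->
  `|d_xx (fun x y => W x y i) x y| <= (k i ^+ 2 + mu i) * (C + Num.max 0 (b i)).
Proof.
move=> y01 xb; rewrite W_xxE//; set M := C + _.
have M0 : 0 <= M by rewrite addr_ge0 ?(rs_C_ge0 rs)// le_max lexx.
have km : 0 <= k i ^+ 2 by rewrite exprn_ge0// ltW.
have mi : 0 <= mu i by rewrite ltW.
case: ltP => xb'; last by rewrite normr0 mulr_ge0// addr_ge0.
have vM j : `|v j (x - th y)| <= M.
  rewrite ger0_norm ?(rs_ge0 rs)// (le_trans (rs_le rs j _))// lerD2l ge_max !le_max lexx/=.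
  by rewrite (ltW xb') orbT.
have /andP[y0 y1] := y01.
rewrite normrM (ger0_norm (ltW y0)) -[leRHS]mul1r.
apply: ler_pM => //; first exact: ltW.
rewrite /regime_curvature mulrDl; apply: le_trans (ler_normB _ _) _; apply: lerD.
  by rewrite normrM (ger0_norm km) ler_wpM2l.
by rewrite normrM (ger0_norm mi) ler_wpM2l.
Qed.

(** On a horizontal line [W_xx] is given by the curvature before the boundary point [beta] and is 0
    after it, while [W_x] is continuous. The fundamental theorem applies up to [beta], past which
    [W_x] is constantly [y]. *)
Lemma W_xx_integral a e y i : a <= e -> 0 < y <= 1 ->
  leb.-integrable `[a, e] (fun x => (d_xx (fun x y => W x y i) x y)%:E) /\
  (\int[leb]_(x in `[a, e]) (d_xx (fun x y => W x y i) x y)%:E =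
    (Wx i e y - Wx i a y)%:E)%E.
Proof.
move=> ae y01; have /andP[y0 y1] := y01.
pose beta := b i + th y.
pose q x := y * p i (x - th y).
pose h x := y * g i (x - th y).
have WxE x : Wx i x y = q x by rewrite (congr1 (fun q => q x) (d_x_regime_W rho c f rs i (lt0r_neq0 y0))).
have cshift : continuous (fun x : R => x - th y).
  by move=> x; apply: cvgB; [exact: cvg_id|exact: cvg_cst].
have cq : continuous q.
  move=> x; apply: cvgM; first exact: cvg_cst.
  exact: (continuous_comp (cshift x) (@rs_deriv_continuous _ _ _ _ _ _ _ rs i _)).
have ch : continuous h.
  move=> x; apply: cvgM; first exact: cvg_cst.
  exact: (continuous_comp (cshift x) (@curvature_continuous _ _ _ _ _ _ _ rs i _)).
set w := fun x => d_xx (fun x y => W x y i) x y.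
have wlt x : x < beta -> w x = h x.
  by move=> xb; rewrite /w W_xxE ?ifT ?lt_eqF ?ltrBlDr.
have wgt x : beta < x -> w x = 0.
  move=> xb; rewrite /w W_xxE ?gt_eqF ?ltrBrDr//.
  by rewrite ltNge ltW// ltrBrDr.
(* The value of [d_xx] at [beta], where the derivative need not exist, is carried along as a
   multiple of the indicator of one point. *)
have wE : w = fun x => \1_(`]-oo, beta[) x * h x + w beta * \1_[set beta] x.
  apply/funext => x; rewrite !indicE !mem_setE in_itv/=.
  have -> : (x \in [set beta]) = (x == beta).
    by apply/idP/eqP => [/set_mem|->]; [|apply/mem_set].
  have [xb|xb|->] := ltgtP x beta.
  - by rewrite mul1r mulr0 addr0 wlt.
  - by rewrite mul0r mulr0 addr0 wgt.
  - by rewrite mul0r mulr1 add0r.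
have wEx x : w x = \1_(`]-oo, beta[) x * h x + w beta * \1_[set beta] x := congr1 (fun q => q x) wE.
have mw : measurable_fun setT w.
  rewrite wE; apply: measurable_funD; apply: measurable_funM.
  - by apply: measurable_indic; exact: measurable_itv.
  - exact: continuous_measurable_fun.
  - exact: measurable_cst.
  - by apply: measurable_indic; exact: measurable_set1.
have iw : leb.-integrable `[a, e] (EFin \o w).
  apply: (@le_integrable _ _ _ leb _ (measurable_itv _) _ (fun x => (`|h x| + `|w beta|)%:E)).
  - by apply/measurable_EFinP; exact: measurable_funTS.
  - move=> x _ /=; rewrite lee_fin wEx [leRHS]ger0_norm ?addr_ge0//.
    apply: le_trans (ler_normD _ _) _; rewrite !normrM; apply: lerD.
      by rewrite indicE; case: (_ \in _); rewrite ?normr1 ?normr0 ?mul1r ?mul0r.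
    by rewrite indicE; case: (_ \in _); rewrite ?normr1 ?normr0 ?mulr1 ?mulr0.
  - have ci : {within `[a, e], continuous (fun x : R => `|h x| + `|w beta|)}.
      apply: continuous_subspaceT => x; apply: cvgD; last exact: cvg_cst.
      exact: (cvg_norm (ch x)).
    exact: (continuous_compact_integrable (@segment_compact R a e) ci).
split; first exact: iw.
have FTC r : a <= r -> r <= beta -> (\int[leb]_(x in `[a, r]) (h x)%:E = (q r - q a)%:E)%E.
  rewrite le_eqVlt => /predU1P[<- _|ar rb].
    rewrite subrr (@integral_Sset1 _ _ _ a)// => x /=.
    by rewrite in_itv/= => /andP[ax xa]; apply/eqP; rewrite eq_le xa ax.
  have qd x : x < r -> is_derive x 1 q (h x).
    move=> xr; have xb : x - th y < b i by rewrite ltrBlDr (lt_le_trans xr).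
    have h1 : is_derive x 1 (fun x => x - th y) (1 - 0) by apply: is_derive_sub.
    apply: is_derive_val (is_derive_scale y (is_derive_compose h1 (rs_derive2 rs xb))) _.
    rewrite /h; ring.
  rewrite (@continuous_FTC2 R h q a r ar); first by rewrite EFinB.
  - exact: continuous_subspaceT.
  - split; first by move=> x; rewrite in_itv/= => /andP[_ /qd[]].
      exact: cvg_at_right_filter (cq a).
    exact: cvg_at_left_filter (cq r).
  - by move=> x; rewrite in_itv/= => /andP[_ xr]; rewrite derive1E; apply: derive_val; exact: qd.
have mS : measurable (`[a, e]%classic `\ beta) by apply: measurableD => //; exact: measurable_set1.
rewrite -(@integral_setD1 _ _ beta)//; last by apply/measurable_EFinP; exact: measurable_funTS.
transitivity (\int[leb]_(x in `[a, e]%classic `\ beta)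
    (((fun x => (h x)%:E) \_ `]-oo, beta[%classic) x))%E.
  apply: eq_integral => x /set_mem[/= _ /eqP xb]; rewrite patchE mem_setE in_itv/=.
  case: ltP => xb'; first by rewrite -/(w x) wlt.
  by rewrite -/(w x) wgt// lt_neqAle eq_sym xb.
rewrite -integral_mkcondr !WxE.
have q1 x : beta <= x -> q x = y by move=> bx; rewrite /q (rs_deriv_stop rs) ?mulr1// lerBrDr.
have [ba|ab] := leP beta a.
  rewrite !q1 ?(le_trans ba ae)// subrr (_ : _ `&` _ = set0) ?integral_set0//.
  apply/seteqP; split => x //= [[]]; rewrite !in_itv/= => /andP[ax _] _.
  by rewrite ltNge (le_trans ba ax).
have [eb|be] := ltP e beta.
  rewrite -(FTC e ae (ltW eb)); congr (integral _ _ _).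
  apply/seteqP; split => x /=; rewrite !in_itv/=; first by move=> [[]].
  move=> /andP[ax xe]; have xb := le_lt_trans xe eb.
  by split=> //; split; [rewrite ax xe|move=> E; rewrite E ltxx in xb].
rewrite (q1 e be) -(q1 beta (lexx _)) -(FTC beta (ltW ab) (lexx _)) -integral_itv_bndo_bndc; last first.
  by apply/measurable_EFinP; apply: measurable_funTS; exact: continuous_measurable_fun.
congr (integral _ _ _); apply/seteqP; split => x /=; rewrite !in_itv/=.
  by move=> [[/andP[-> _] _] ->].
move=> /andP[ax xb]; split=> //; split; first by rewrite ax (le_trans (ltW xb)).
by move=> E; rewrite E ltxx in xb.
Qed.

Lemma regime_W_Linfty i : Linfty_loc_d_xx (fun x y => W x y i).
Proof.
split.
- by apply: (@ae_off_free_boundary i) => x y y01 xb; have [] := is_derive_W_xx y01 xb.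
- move=> K _ _; exists ((k i ^+ 2 + mu i) * (C + Num.max 0 (b i))).
  by apply: (@ae_off_free_boundary i) => x y y01 xb _; exact: W_xx_le.
- by move=> a e y ae y01; exact: W_xx_integral.
Qed.

Lemma regime_W_hjb i : ae_on_strip (fun x y =>
  Num.max (generator_G sigma lambda W x y i - rho * W x y i - f y)
    (x - c - d_y (fun x y => W x y i) x y) = 0).
Proof.
apply: (@ae_off_free_boundary i) => x y y01 H.
have /andP[y0 y1] := y01.
have [_ ->] := d_y_regime_W c rho_gt0 f_C1 rs x i y01.
rewrite /regime_W_y (min_idPl y1) theta_extended// linear_extensionE//.
rewrite /generator_G W_xxE// /regime_W gt_eqF//.
have sl : 0 <= f y / y - df y by rewrite subr_ge0; exact: slope_le.
set z := x - th y in H *.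
have zE : x - c = z - rho^-1 * (f y / y) by rewrite /z /theta; ring.
have r0 : 0 <= rho^-1 by rewrite invr_ge0 ltW.
have -> : x - c - (v i z + y * p i z * (rho^-1 * (df y / y - f y / y ^+ 2)) - rho^-1 * df y) =
    (z - v i z) - rho^-1 * (f y / y - df y) * (1 - p i z).
  by rewrite zE; field; rewrite !gt_eqF.
have second_le : (z - v i z) - rho^-1 * (f y / y - df y) * (1 - p i z) <= 0.
  have /andP[p0 p1] := rs_deriv_itv rs i z.
  have h1 : 0 <= rho^-1 * (f y / y - df y) * (1 - p i z) by rewrite !mulr_ge0// subr_ge0.
  by have := rs_ge rs i z; rewrite ge_max => /andP[_ zv]; lra.
have s0 : sigma i != 0 by rewrite gt_eqF.
(* [u] stands for [v'']: below the boundary it is the curvature and the expression vanishes; beyond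
   the boundary [u = 0], and nonnegative curvature makes the expression nonpositive. *)
have fact (u : R) : 2^-1 * sigma i ^+ 2 * (y * u) +
    lambda i * (y * v (rev_ord i) z - rho^-1 * f y - (y * v i z - rho^-1 * f y)) -
    rho * (y * v i z - rho^-1 * f y) - f y =
    y * (2^-1 * sigma i ^+ 2 * (u - g i z)).
  rewrite /regime_curvature kE muE; field.
  by rewrite s0 gt_eqF.
case: ltP => zb.
  by rewrite fact subrr !mulr0; apply/max_idPl.
have vz := rs_stop rs zb; have pz := rs_deriv_stop rs zb.
have f0 := fact 0; rewrite mulr0 in f0.
have second0 : (z - v i z) - rho^-1 * (f y / y - df y) * (1 - p i z) = 0.
  by rewrite vz pz !subrr mulr0 subr0.
rewrite f0 second0; apply/max_idPr.
rewrite sub0r mulrN mulrN oppr_le0 mulr_ge0 ?(ltW y0)// mulr_ge0//.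
  by rewrite mulr_ge0// ?invr_ge0// sqr_ge0.
exact: (rs_curvature_ge0 rs).
Qed.

End hjb.

Theorem proposition4p5 (d : measure_display) (T : measurableType d)
  (R : realType) (P : probability T R)
  (B : R -> T -> R) (eps : R -> T -> 'I_2) (X : R -> R -> T -> R)
  (lambda sigma : 'I_2 -> R) (rho c : R) (f : R -> R)
  (P_complete : measure_is_complete P)
  (lambda_gt0 : forall i, 0 < lambda i)
  (sigma_gt0 : forall i, 0 < sigma i)
  (rho_gt0 : 0 < rho) (c_gt0 : 0 < c)
  (B_bm : brownian_motion P B)
  (eps_mc : markov_chain P (generator_matrix lambda) eps)
  (B_eps_indep : independent_systems P
     (process_sigma measurable B `[0, +oo[) (process_sigma setT eps `[0, +oo[))
  (eps0_gt0 : forall i, (0 < P (eps 0%R @^-1` [set i]))%E)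
  (X_sde : forall x, regime_switching_diffusion P
     (augmented_filtration P B eps) sigma B eps x (X x))
  (f_ge0 : forall y, 0 <= f y)
  (f_nondecreasing : {homo f : y z / y <= z})
  (f_continuous : {within `[0, 1], continuous f})
  (f_0 : f 0 = 0)
  (f_concave : concave_on `[0, 1] f)
  (f_C1 : continuously_differentiable_on `]0, 1] f) :
  let u := value_u P B eps X rho c f in
  let W := value_W P B eps X rho c f in
  [/\ (* u is real-valued, and the limit defining W at y = 0 exists *)
      (forall x i y, 0 < y <= 1 -> u x i y \is a fin_num) /\
      (forall x i, cvg (W x y i @[y --> 0^'+])),
      forall x i, W x 0 i = 0,
      exists2 K : R, 0 < K &
        forall x y i, 0 <= y <= 1 -> `|W x y i| <= K * (1 + `|x|),
      forall i,
        [/\ {within strip_closed, continuous (fun z => W z.1 z.2 i)},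
            C11_on_strip (fun x y => W x y i) &
            Linfty_loc_d_xx (fun x y => W x y i)] &
      forall i, ae_on_strip (fun x y =>
        Num.max (generator_G sigma lambda W x y i - rho * W x y i - f y)
                (x - c - d_y (fun x y => W x y i) x y) = 0)].
Proof.
move=> u W.
(* [k_i^2] and [mu_i] are the coefficients of the equation divided by [sigma_i^2 / 2]; [rho > 0]
   gives [mu_i < k_i^2]. *)
pose k i := Num.sqrt (2 * (rho + lambda i) / sigma i ^+ 2).
pose mu i := 2 * lambda i / sigma i ^+ 2.
have k2_gt0 i : 0 < 2 * (rho + lambda i) / sigma i ^+ 2.
  by rewrite divr_gt0 ?exprn_gt0// mulr_gt0// addr_gt0.
have k_gt0 i : 0 < k i by rewrite sqrtr_gt0.
have kE i : k i ^+ 2 = 2 * (rho + lambda i) / sigma i ^+ 2 by rewrite sqr_sqrtr// ltW.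
have mu_gt0 i : 0 < mu i by rewrite divr_gt0 ?exprn_gt0// mulr_gt0.
have mu_lt i : mu i < k i ^+ 2.
  by rewrite kE ltr_pM2r ?invr_gt0 ?exprn_gt0// ltr_pM2l// ltrDr.
have [v [p [b [C rs]]]] := regime_solution_exists k_gt0 mu_gt0 mu_lt.
have uE x i y : u x i y = (v i (x - theta rho c f y))%:E.
  exact: (value_uE P_complete lambda_gt0 sigma_gt0 rho_gt0 B_bm eps_mc B_eps_indep eps0_gt0
    X_sde k_gt0 mu_gt0 kE (fun=> erefl) rs).
have W_lim x i : regime_W rho c f v x y i @[y --> 0^'+] --> 0.
  apply/cvgrPdist_lt => e e0.
  have [r r0 Hr] := regime_W_near0 rho_gt0 c_gt0 f_ge0 f_continuous f_0 rs x i e0.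
  have rm : 0 < Num.min r 1 by rewrite lt_min r0 ltr01.
  near=> y; have y0 : 0 < y by near: y; exact: nbhs_right_gt.
  have : y < Num.min r 1 by near: y; exact: nbhs_right_lt.
  rewrite lt_min => /andP[yr y1]; rewrite sub0r normrN.
  by apply: Hr; rewrite ?subrr ?normr0 ?(ltW y0) ?(ltW y1).
have W_posE x y i : y != 0 -> W_pos P B eps X rho c f x y i = regime_W rho c f v x y i.
  by move=> y0; rewrite /W_pos -/u uE /regime_W (negbTE y0).
have W_pos_lim x i : W_pos P B eps X rho c f x y i @[y --> 0^'+] --> 0.
  apply: cvg_trans (W_lim x i); apply: near_eq_cvg; near=> y.
  by rewrite W_posE// gt_eqF//; near: y; exact: nbhs_right_gt.
have WE : W = regime_W rho c f v.
  apply/funext => x; apply/funext => y; apply/funext => i; rewrite /W /value_W.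
  have [->|y0] := eqVneq y 0; last exact: W_posE.
  by rewrite /regime_W eqxx; apply: cvg_lim => //; exact: W_pos_lim.
rewrite WE; split.
- split=> [x i y _|x i]; first by rewrite uE.
  exact: cvgP (W_lim x i).
- by move=> x i; rewrite /regime_W eqxx.
- have C0 := rs_C_ge0 rs; have f1 := f_ge0 1.
  have rf0 : 0 <= rho^-1 * f 1 by rewrite mulr_ge0// invr_ge0 ltW.
  (* The bound [y (C + |x| + c) + 2 f y / rho] is taken at [y = 1], as [f] is nondecreasing; the
     summand 1 accounts for the coefficient of [|x|]. *)
  exists (C + c + 1 + 2 * (rho^-1 * f 1)) => [|x y i /andP[y0 y1]].
    by move: (rho^-1 * f 1) rf0 => q q0; have := c_gt0; lra.
  have K0 : 0 <= C + c + 2 * (rho^-1 * f 1) by have := c_gt0; move: (rho^-1 * f 1) rf0 => q q0; lra.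
  have le1 : `|regime_W rho c f v x y i| <= C + c + `|x| + 2 * (rho^-1 * f 1).
    have [->|yn0] := eqVneq y 0.
      rewrite /regime_W eqxx normr0; have := normr_ge0 x; have := c_gt0.
      by move: (rho^-1 * f 1) rf0 => q q0; lra.
    have yp : 0 < y by rewrite lt_neqAle eq_sym yn0.
    apply: le_trans (regime_W_norm_le rho_gt0 c_gt0 f_ge0 rs x i _) _; first by rewrite yp.
    apply: lerD.
      rewrite addrAC ler_piMl//; by rewrite !addr_ge0// ltW.
    by rewrite ler_wpM2l// ler_wpM2l ?invr_ge0 ?(ltW rho_gt0)//; exact: f_nondecreasing.
  apply: le_trans le1 _; have := mulr_ge0 K0 (normr_ge0 x); lra.
- move=> i; split.
  + exact: (regime_W_continuous rho_gt0 c_gt0 f_ge0 f_continuous f_0 f_C1 rs).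
  + exact: (regime_W_C11 c rho_gt0 f_C1 rs).
  + exact: (regime_W_Linfty c rho_gt0 f_C1 k_gt0 mu_gt0 rs).
- move=> i.
  exact: (regime_W_hjb c rho_gt0 f_0 f_concave f_C1 rs sigma_gt0 kE (fun=> erefl)).
Unshelve. all: by end_near.
Qed.
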